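(* Let $(A,\mathfrak{m})$ be a complete, reduced local ring of equidimension $d>0$ with algebraically closed residue field. Suppose that the residue fields $k(\mathfrak{p})$, for $\mathfrak{p}$ ranging over the minimal primes of $A$, all have the same characteristic. Then for each prime number $p \in \mathbb{Z}$ there exists a parameter ideal $I=(f_1,f_2,\dots,f_d)\subseteq A$ such that the Hilbert-Samuel multiplicity $e_I(A)$ is relatively prime to $p$.
   Context: Local rings are Noetherian, and ''complete'' means complete with respect to the maximal ideal. ''Of equidimension $d$'' means $\dim(A/\mathfrak{p})=d$ for every minimal prime $\mathfrak{p}$ of $A$. For a prime $\mathfrak{p}$, $k(\mathfrak{p})$ is the residue field of $A_{\mathfrak{p}}$. A parameter ideal of a $d$-dimensional local ring is an $\mathfrak{m}$-primary ideal generated by $d$ elements. For a finitely generated $A$-module $M$ and an ideal $\mathfrak{a}$ with $\ell(M/\mathfrak{a}M)<\infty$ (where $\ell$ is length), the Hilbert-Samuel multiplicity is $e_{\mathfrak{a}}(M)=\lim_{n\to\infty}\frac{r!}{n^r}\,\ell(M/\mathfrak{a}^nM)$ with $r=\dim M$. *)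

(* Defs.v *)
From HB Require Import structures.
From mathcomp Require Import all_boot all_order all_algebra.
From mathcomp Require Import generic_quotient ring_quotient.
From mathcomp Require Import ring.
From mathcomp Require Import all_classical all_reals all_analysis.
Import numFieldNormedType.Exports.

Set Implicit Arguments.
Unset Strict Implicit.
Unset Printing Implicit Defensive.

Import GRing.Theory.
Local Open Scope ring_scope.
Local Open Scope quotient_scope.

Definition proper_sub (T : Type) (P Q : {pred T}) : Prop :=
  {subset P <= Q} /\ ~ {subset Q <= P}.

Definition longest (chain : nat -> Prop) (n : nat) : Prop :=
  chain n /\ forall k, chain k -> (k <= n)%N.

(* Submodules of V are the boolean predicates of type submodClosed V; by
   excluded middle every submodule is of this form. Ideals of A, possibly equal
   to A, are the submodules of A^o; proper ideals are also of type idealr A. *)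
Section Span.
Variables (A : comNzRingType) (V : lmodType A).

Definition span (X : V -> Prop) : {pred V} := fun v =>
  `[< exists2 s : seq (A * V), (forall c, c \in s -> X c.2) &
        v = \sum_(c <- s) c.1 *: c.2 >].

Lemma span_submod X : subsemimod_closed (span X).
Proof.
split; first split.
- by apply/asboolP; exists nil => //; rewrite big_nil.
- move=> u v /asboolP[s Xs ->] /asboolP[t Xt ->]; apply/asboolP.
  exists (s ++ t); last by rewrite big_cat.
  by move=> c; rewrite mem_cat => /orP[/Xs|/Xt].
- move=> a v /asboolP[s Xs ->]; apply/asboolP.
  exists [seq (a * c.1, c.2) | c <- s].
    by move=> c /mapP[c' /Xs ? ->].
  by rewrite big_map scaler_sumr; apply: eq_bigr => c _; rewrite scalerA.
Qed.

HB.instance Definition _ X := GRing.isSubmodClosed.Build A V (span X)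
  (span_submod X).

End Span.

Section IdealOperations.
Variable A : comNzRingType.

Definition ideal_gen (s : seq A) : submodClosed A^o :=
  span (fun x : A^o => x \in s).

Definition ideal_exp (a : {pred A}) (n : nat) : submodClosed A^o :=
  span (fun x : A^o => exists2 t : n.-tuple A, all (mem a) t &
                         x = \prod_(y <- t) y).

Definition ideal_scale (a : {pred A}) (M : lmodType A) : submodClosed M :=
  span (fun v : M => exists2 c, c \in a & exists w : M, v = c *: w).

End IdealOperations.

Section QuotientModule.
Variables (A : comNzRingType) (M : lmodType A) (N : submodClosed M).

(* submodClosed does not record closure under opposites, which the quotient
   group construction requires. *)
Definition submod_zmod : {pred M} := fun v => v \in N.

Lemma submod_zmod_closed : zmod_closed submod_zmod.
Proof.
split=> [|u v uN vN]; first exact: rpred0.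
by rewrite /submod_zmod unfold_in -scaleN1r rpredD // rpredZ.
Qed.

HB.instance Definition _ := GRing.isZmodClosed.Build M submod_zmod
  submod_zmod_closed.

Definition quot_mod := Quotient.quot submod_zmod.

HB.instance Definition _ := GRing.Zmodule.on quot_mod.
HB.instance Definition _ := EqQuotient.on quot_mod.

Definition quot_scale (a : A) : quot_mod -> quot_mod :=
  lift_op1 quot_mod ( *:%R a).

Lemma pi_quot_scale a v : quot_scale a (\pi_quot_mod v) = \pi_quot_mod (a *: v).
Proof.
rewrite /quot_scale; unlock; apply/eqP; rewrite -[_ == _]Quotient.idealrBE.
rewrite -scalerBr; apply: (rpredZ (s := N)).
by have := Quotient.idealrBE submod_zmod (repr (\pi_quot_mod v)) v;
  rewrite reprK eqxx.
Qed.

Lemma pi_quot_add u v :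
  \pi_quot_mod u + \pi_quot_mod v = \pi_quot_mod (u + v).
Proof. exact: (esym (@Quotient.pi_add M submod_zmod u v)). Qed.

Lemma quot_scaleA a b x :
  quot_scale a (quot_scale b x) = quot_scale (a * b) x.
Proof. by elim/quotW: x => v; rewrite !pi_quot_scale scalerA. Qed.

Lemma quot_scale1 : left_id 1 quot_scale.
Proof. by elim/quotW=> v; rewrite pi_quot_scale scale1r. Qed.

Lemma quot_scaleDr : right_distributive quot_scale +%R.
Proof.
move=> a; elim/quotW=> u; elim/quotW=> v.
by rewrite !pi_quot_scale !pi_quot_add pi_quot_scale scalerDr.
Qed.

Lemma quot_scaleDl x :
  {morph (fun a => quot_scale a x) : a b / a + b}.
Proof.
by elim/quotW: x => v a b; rewrite !pi_quot_scale pi_quot_add scalerDl.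
Qed.

HB.instance Definition _ := GRing.Zmodule_isLmodule.Build A quot_mod
  quot_scaleA quot_scale1 quot_scaleDr quot_scaleDl.

End QuotientModule.

Section Localization.
Variables (A : comNzRingType) (P : prime_idealr A).

Definition loc_frac := {x : A * A | x.2 \notin P}.
HB.instance Definition _ := Choice.on loc_frac.

Implicit Types x y z : loc_frac.
Local Notation num x := (val x).1.
Local Notation den x := (val x).2.

Definition loc_equiv x y : bool :=
  `[< exists2 u, u \notin P & u * (num x * den y) = u * (num y * den x) >].

Lemma notin_primeM u v : u \notin P -> v \notin P -> u * v \notin P.
Proof. by move=> uP vP; rewrite prime_idealrM negb_or uP. Qed.

Lemma notin_prime1 : 1 \notin P.
Proof. by rewrite idealr1. Qed.

Lemma loc_equiv_refl : reflexive loc_equiv.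
Proof. by move=> x; apply/asboolP; exists 1; rewrite ?notin_prime1. Qed.

Lemma loc_equiv_sym : symmetric loc_equiv.
Proof. by move=> x y; apply/asboolP/asboolP => -[u uP e]; exists u. Qed.

Lemma loc_equiv_trans : transitive loc_equiv.
Proof.
move=> y x z /asboolP[u uP exy] /asboolP[v vP eyz]; apply/asboolP.
exists (u * v * den y); first by rewrite !notin_primeM ?(valP y).
transitivity (v * den z * (u * (num x * den y))); first by ring.
rewrite exy; transitivity (u * den x * (v * (num y * den z))); first by ring.
by rewrite eyz; ring.
Qed.

Canonical loc_equivRel :=
  EquivRel loc_equiv loc_equiv_refl loc_equiv_sym loc_equiv_trans.

Definition localization := {eq_quot loc_equiv}.

HB.instance Definition _ : EqQuotient _ loc_equiv localization :=
  EqQuotient.on localization.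
HB.instance Definition _ := Choice.on localization.

Definition loc_mk (a s : A) (sP : s \notin P) : loc_frac :=
  exist (fun x : A * A => x.2 \notin P) (a, s) sP.

Definition loc_addf x y : loc_frac :=
  loc_mk (num x * den y + num y * den x) (notin_primeM (valP x) (valP y)).
Definition loc_mulf x y : loc_frac :=
  loc_mk (num x * num y) (notin_primeM (valP x) (valP y)).
Definition loc_oppf x : loc_frac := loc_mk (- num x) (valP x).

Definition loc_zero : localization := \pi_localization (loc_mk 0 notin_prime1).
Definition loc_one : localization := \pi_localization (loc_mk 1 notin_prime1).
Definition loc_add : localization -> localization -> localization :=
  lift_op2 localization loc_addf.
Definition loc_mul : localization -> localization -> localization :=
  lift_op2 localization loc_mulf.
Definition loc_opp : localization -> localization :=
  lift_op1 localization loc_oppf.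

Lemma loc_eqP x y : reflect
  (exists2 u, u \notin P & u * (num x * den y) = u * (num y * den x))
  (\pi_localization x == \pi_localization y).
Proof. by rewrite eqmodE; apply: asboolP. Qed.

Lemma loc_reprE x : exists2 u, u \notin P &
  u * (num (repr (\pi_localization x)) * den x)
  = u * (num x * den (repr (\pi_localization x))).
Proof. by apply/loc_eqP; rewrite reprK. Qed.

Lemma loc_pi_add x y :
  loc_add (\pi_localization x) (\pi_localization y)
  = \pi_localization (loc_addf x y).
Proof.
rewrite /loc_add; unlock; apply/eqP/loc_eqP => /=.
have [u uP ex] := loc_reprE x; have [v vP ey] := loc_reprE y.
move: ex ey; set x' := repr (\pi_localization x); set y' := repr _ => ex ey.
exists (u * v); rewrite ?notin_primeM //.
transitivity (v * den y * den y' * (u * (num x' * den x))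
  + u * den x * den x' * (v * (num y' * den y))); first by ring.
by rewrite ex ey; ring.
Qed.

Lemma loc_pi_mul x y :
  loc_mul (\pi_localization x) (\pi_localization y)
  = \pi_localization (loc_mulf x y).
Proof.
rewrite /loc_mul; unlock; apply/eqP/loc_eqP => /=.
have [u uP ex] := loc_reprE x; have [v vP ey] := loc_reprE y.
move: ex ey; set x' := repr (\pi_localization x); set y' := repr _ => ex ey.
exists (u * v); rewrite ?notin_primeM //.
transitivity ((u * (num x' * den x)) * (v * (num y' * den y))); first by ring.
by rewrite ex ey; ring.
Qed.

Lemma loc_pi_opp x :
  loc_opp (\pi_localization x) = \pi_localization (loc_oppf x).
Proof.
rewrite /loc_opp; unlock; apply/eqP/loc_eqP => /=.
have [u uP] := loc_reprE x; move: (repr _) => x' ex.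
exists u => //; transitivity (- (u * (num x' * den x))); first by ring.
by rewrite ex; ring.
Qed.

Let locE := (loc_pi_add, loc_pi_mul, loc_pi_opp).

Lemma loc_eq1 x y : num x * den y = num y * den x ->
  \pi_localization x = \pi_localization y.
Proof.
by move=> e; apply/eqP/loc_eqP; exists 1; rewrite ?e // notin_prime1.
Qed.

Lemma loc_addA : associative loc_add.
Proof.
elim/quotW=> x; elim/quotW=> y; elim/quotW=> z; rewrite !locE.
by apply: loc_eq1 => /=; ring.
Qed.

Lemma loc_addC : commutative loc_add.
Proof.
by elim/quotW=> x; elim/quotW=> y; rewrite !locE; apply: loc_eq1 => /=; ring.
Qed.

Lemma loc_add0 : left_id loc_zero loc_add.
Proof.
by elim/quotW=> x; rewrite /loc_zero !locE; apply: loc_eq1 => /=; ring.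
Qed.

Lemma loc_addN : left_inverse loc_zero loc_opp loc_add.
Proof.
by elim/quotW=> x; rewrite /loc_zero !locE; apply: loc_eq1 => /=; ring.
Qed.

HB.instance Definition _ :=
  GRing.isZmodule.Build localization loc_addA loc_addC loc_add0 loc_addN.

Lemma loc_mulA : associative loc_mul.
Proof.
elim/quotW=> x; elim/quotW=> y; elim/quotW=> z; rewrite !locE.
by apply: loc_eq1 => /=; ring.
Qed.

Lemma loc_mulC : commutative loc_mul.
Proof.
by elim/quotW=> x; elim/quotW=> y; rewrite !locE; apply: loc_eq1 => /=; ring.
Qed.

Lemma loc_mul1 : left_id loc_one loc_mul.
Proof.
by elim/quotW=> x; rewrite /loc_one !locE; apply: loc_eq1 => /=; ring.
Qed.

Lemma loc_mulDl : left_distributive loc_mul loc_add.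
Proof.
elim/quotW=> x; elim/quotW=> y; elim/quotW=> z; rewrite !locE.
by apply: loc_eq1 => /=; ring.
Qed.

Lemma loc_1neq0 : loc_one != loc_zero.
Proof.
apply/loc_eqP => -[u uP /=]; rewrite !mulr1 mulr0 => u0.
by move: uP; rewrite u0 idealr0.
Qed.

HB.instance Definition _ := GRing.Zmodule_isComNzRing.Build localization
  loc_mulA loc_mulC loc_mul1 loc_mulDl loc_1neq0.

(* The maximal ideal of A_P: the fractions with numerator in P. *)
Definition loc_max : {pred localization} := fun w => num (repr w) \in P.

Lemma loc_maxE x : (\pi_localization x \in loc_max) = (num x \in P).
Proof.
have dP (t : loc_frac) : (den t \in P) = false by exact: negPf (valP t).
rewrite unfold_in /loc_max; have [u uP] := loc_reprE x.
move: (repr _) => y /(congr1 (fun a => a \in P)).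
by rewrite !prime_idealrM !dP (negPf uP) !orbF.
Qed.

Lemma loc_max_ideal : idealr_closed loc_max.
Proof.
split; first by rewrite loc_maxE idealr0.
  by rewrite loc_maxE idealr1.
elim/quotW=> a; elim/quotW=> x; elim/quotW=> y; rewrite !loc_maxE => xP yP.
rewrite -[_ * _]/(loc_mul _ _) -[_ + _]/(loc_add _ _) !locE loc_maxE /=.
apply: rpredD; first by rewrite mulrC !idealMr.
by rewrite mulrC !idealMr.
Qed.

HB.instance Definition _ := isIdealr.Build localization loc_max loc_max_ideal.

Definition residue_field := {ideal_quot loc_max}.
HB.instance Definition _ := GRing.ComNzRing.on residue_field.

End Localization.

Section LocalRings.
Variable A : comNzRingType.

Definition maximal_ideal (m : idealr A) : Prop :=
  forall J : idealr A, {subset m <= J} -> J =i m.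

Definition noetherian : Prop :=
  forall I : submodClosed A^o, exists s : seq A, I =i ideal_gen s.

Definition local_ring (m : idealr A) : Prop :=
  [/\ noetherian, maximal_ideal m &
      forall J : idealr A, maximal_ideal J -> J =i m].

Definition adically_complete (m : idealr A) : Prop :=
  (forall x, (forall n, x \in ideal_exp m n) -> x = 0) /\
  (forall u : nat -> A,
     (forall k, exists N, forall i j, (N <= i)%N -> (N <= j)%N ->
        u i - u j \in ideal_exp m k) ->
     exists l, forall k, exists N, forall i, (N <= i)%N ->
        u i - l \in ideal_exp m k).

Definition reduced : Prop := forall (x : A) n, x ^+ n = 0 -> x = 0.

Definition minimal_prime (P : prime_idealr A) : Prop :=
  forall Q : prime_idealr A, {subset Q <= P} -> Q =i P.

Definition prime_chain (n : nat) : Prop :=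
  exists P : nat -> prime_idealr A,
    forall i, (i < n)%N -> proper_sub (P i) (P i.+1).

Definition krull_dim (d : nat) : Prop := longest prime_chain d.

Definition primary (I : submodClosed A^o) : Prop :=
  1 \notin I /\
  forall x y : A, x * y \in I -> x \in I \/ exists n, y ^+ n \in I.

Definition m_primary (m : idealr A) (I : submodClosed A^o) : Prop :=
  primary I /\ forall x : A, x \in m <-> exists n, x ^+ n \in I.

Definition parameter_ideal (m : idealr A) (I : submodClosed A^o) : Prop :=
  m_primary m I /\
  exists2 d, krull_dim d & exists f : d.-tuple A, I =i ideal_gen f.

End LocalRings.

Definition equidimensional (A : comNzRingType) (d : nat) : Prop :=
  forall P : prime_idealr A, minimal_prime P -> krull_dim {ideal_quot P} d.

Section Multiplicity.
Variables (A : comNzRingType) (M : lmodType A).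

Definition submod_chain (n : nat) : Prop :=
  exists N : nat -> submodClosed M,
    forall i, (i < n)%N -> proper_sub (N i) (N i.+1).

Definition module_length (l : nat) : Prop := longest submod_chain l.

(* dim M = dim (A / Ann M), computed with the primes of A containing Ann M. *)
Definition supp_chain (n : nat) : Prop :=
  exists P : nat -> prime_idealr A,
    (forall i a, (forall v : M, a *: v = 0) -> a \in P i) /\
    forall i, (i < n)%N -> proper_sub (P i) (P i.+1).

Definition module_dim (r : nat) : Prop := longest supp_chain r.

End Multiplicity.

Definition multiplicity (R : realType) (A : comNzRingType) (a : {pred A})
    (M : lmodType A) (e : R) : Prop :=
  exists r : nat, exists len : nat -> nat,
    [/\ module_dim M r,
        forall n, module_length
          (quot_mod (ideal_scale (A := A) (ideal_exp a n) M)) (len n) &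
        (fun n => (r`!)%:R / n%:R ^+ r * (len n)%:R : R) @ \oo --> e]%classic.

(* Main.v *)
Require Import Defs.
From HB Require Import structures.
From mathcomp Require Import all_boot all_order all_algebra.
From mathcomp Require Import ring_quotient.
From mathcomp Require Import ring zify.
From mathcomp Require Import all_classical all_reals all_analysis.

(* Lengths are additive along prime filtrations. Since A is reduced, each
   minimal prime occurs exactly once in a prime filtration of A, and cutting a
   domain A/P by f replaces it by the filtration of A/(P + fA). The parameters
   can therefore be chosen one at a time, the count modulo p of a fixed prime
   being kept nonzero, as soon as

   - every P of coheight at least 2 lies in some Q of coheight one less such
     that A_Q/PA_Q is a discrete valuation ring, Q avoiding a given element;
   - a complete one-dimensional domain with algebraically closed residue field
     has an element of colength prime to p: a valuation ring dominating it has
     the same residue field, so colength and valuation agree, and every element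
     of the fraction field is a quotient of two elements of the domain.

   For the first point let B = A/P. In characteristic p, B is finite over B^p.
   Take Q minimal over (x), and y with Q = (x : y) locally. Either some b in Q
   satisfies by = ux with u outside Q, and then b generates Q locally; or y^p Q
   lies in x^p B locally, and comparing coordinates over B^p gives Q = Q^p,
   against Nakayama.

   In characteristic 0, let W be a coefficient ring with uniformizer z and
   z, x, x_2, ..., x_h parameters of B. Then B is finite over R = R'[[x]] with
   R' = W[[x_2, ..., x_h]]. If Q is suitably chosen over x - z^k, then Q meets
   R' in 0 and hence R in (x - z^k). Adjoining to R one by one the generators
   of B preserves "Q is locally generated by x - z^k", provided the derivative
   of their minimal equations does not lie in Q; this excludes finitely
   many k. *)

Set Implicit Arguments.
Unset Strict Implicit.
Unset Printing Implicit Defensive.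

Import GRing.Theory.
Local Open Scope ring_scope.

(** Hilbert-Samuel functions are compared only up to errors one degree below the expected one.
    Artin-Rees makes colons commute with powers up to such errors, so additivity along filtrations
    and the effect of a cut hold in this weak sense. The multiplicity is read off as the factor e of
    a binomial coefficient, and dimension theory too comes from comparing growth. The obstacle is
    that cutting by f affects all primes of the filtration at once. Above dimension one, c is taken
    in all the other primes but not in P: a prime Q avoiding c can come from P alone. At the last
    cut every prime ends in m, and f = x^N + a is used, where a lies in all the other primes and has
    colength prime to p on P, while p divides N. At the other primes f is x^N, of colength divisible
    by p; at P it is a times a unit. The coefficient ring is the m-adic closure of a subring of B: a
    maximal subring meeting m in 0, with z adjoined, if the residue characteristic is 0; otherwise
    the subring generated by the elements with coherent systems of q-power roots, where z = q is the
    residue characteristic. *)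

Definition subI (T : Type) (P Q : T -> Prop) := forall x, P x -> Q x.
Notation "P <=I Q" := (subI P Q) (at level 70, no associativity).

Lemma subI_trans (T : Type) (P Q R : T -> Prop) : P <=I Q -> Q <=I R -> P <=I R.
Proof. by move=> h1 h2 x /h1 /h2. Qed.
Lemma subI_refl (T : Type) (P : T -> Prop) : P <=I P.
Proof. by []. Qed.
#[global] Hint Resolve subI_refl : core.

(** * Ideals and lengths *)

Section Ideals.
Variable A : comNzRingType.

(** Ideals as Prop-valued predicates, the whole ring included because colons and sums may be
    improper. By [idl_eq] extensionally equal ideals are equal, so identities between ideals can be
    rewritten. *)
Record idl := Idl { idl_set :> A -> Prop;
  idl_ax : [/\ idl_set 0, forall x y, idl_set x -> idl_set y -> idl_set (x + y)
             & forall a x, idl_set x -> idl_set (a * x)] }.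

#[local] Arguments idl_set : simpl never.
Implicit Types (J K L W X Y Z : idl) (a b c x y z : A) (s t : seq A).

Lemma idl_eq J K : (forall x, J x <-> K x) -> J = K.
Proof.
case: J K => [J hJ] [K hK] /= e; have {}e : J = K by apply/funext => x; apply/propext.
by subst K; rewrite (Prop_irrelevance hJ hK).
Qed.

Lemma idl0 J : J 0. Proof. by case: (idl_ax J). Qed.
Lemma idlD J x y : J x -> J y -> J (x + y). Proof. by case: (idl_ax J) => _ h _; apply: h. Qed.
Lemma idlM J a x : J x -> J (a * x). Proof. by case: (idl_ax J) => _ _ h; apply: h. Qed.
Lemma idlMr J a x : J x -> J (x * a). Proof. by rewrite mulrC; apply: idlM. Qed.
Lemma idlN J x : J x -> J (- x). Proof. by rewrite -mulN1r; apply: idlM. Qed.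
Lemma idlNr J x : J (- x) -> J x. Proof. by move=> /idlN; rewrite opprK. Qed.
Lemma idlB J x y : J x -> J y -> J (x - y). Proof. by move=> hx hy; apply/idlD/idlN. Qed.
Lemma idlDl J x y : J x -> J (x + y) -> J y.
Proof. by move=> hx /idlB /(_ hx); rewrite addrC addKr. Qed.
Lemma idl_sum J (T : Type) (r : seq T) (P : pred T) (F : T -> A) :
  (forall i, P i -> J (F i)) -> J (\sum_(i <- r | P i) F i).
Proof. by move=> h; apply: big_ind => //; [exact: idl0|exact: idlD]. Qed.

Lemma idl_anti J K : J <=I K -> K <=I J -> J = K.
Proof. by move=> h1 h2; apply: idl_eq => x; split; [apply: h1|apply: h2]. Qed.

Program Definition topI := @Idl (fun _ => True) _.
Next Obligation. by []. Qed.
Program Definition zeroI := @Idl (fun x => x = 0) _.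
Next Obligation.
by split=> // [x y -> ->|a x ->]; rewrite ?addr0 ?mulr0. Qed.

Program Definition addI J K := @Idl (fun x => exists j k, [/\ J j, K k & x = j + k]) _.
Next Obligation.
split.
- by exists 0, 0; rewrite addr0; split=> //; apply: idl0.
- move=> _ _ [j [k [hj hk ->]]] [j' [k' [hj' hk' ->]]].
  by exists (j + j'), (k + k'); split; [apply: idlD..|rewrite addrACA].
- move=> a _ [j [k [hj hk ->]]]; exists (a * j), (a * k).
  by split; [apply: idlM..|rewrite mulrDr].
Qed.

Program Definition capI J K := @Idl (fun x => J x /\ K x) _.
Next Obligation.
split; first by split; apply: idl0.
  by move=> x y [? ?] [? ?]; split; apply: idlD.
by move=> a x [? ?]; split; apply: idlM.
Qed.

Program Definition colI J x := @Idl (fun y => J (x * y)) _.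
Next Obligation.
split=> /=; first by rewrite mulr0; apply: idl0.
  by move=> y z hy hz; rewrite mulrDr; apply: idlD.
by move=> a y hy; rewrite mulrCA; apply: idlM.
Qed.

Program Definition mulI x J := @Idl (fun y => exists2 j, J j & y = x * j) _.
Next Obligation.
split=> /=; first by exists 0; rewrite ?mulr0 //; apply: idl0.
  move=> _ _ [j hj ->] [k hk ->]; exists (j + k); rewrite ?mulrDr //; exact: idlD.
by move=> a _ [j hj ->]; exists (a * j); [apply: idlM|rewrite mulrCA].
Qed.

Program Definition spanI (S : A -> Prop) := @Idl (fun x => forall L : idl, S <=I L -> L x) _.
Next Obligation.
split=> /=; first by move=> L _; apply: idl0.
  by move=> x y hx hy L h; apply: idlD; [apply: hx|apply: hy].
by move=> a x hx L h; apply/idlM/hx.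
Qed.

#[local] Arguments spanI : simpl never.
Lemma colP J x y : colI J x y = J (x * y). Proof. by []. Qed.

Definition prodI J K := spanI (fun x => exists j k, [/\ J j, K k & x = j * k]).
Fixpoint expI J n := if n is n'.+1 then prodI J (expI J n') else topI.
Definition genI s := spanI (fun x => x \in s).
#[local] Arguments prodI : simpl never.
#[local] Arguments genI : simpl never.
#[local] Arguments addI : simpl never.

Lemma sub_spanI (S : A -> Prop) : S <=I spanI S.
Proof. by move=> x hx L; apply. Qed.
Lemma spanI_min (S : A -> Prop) J : S <=I J -> spanI S <=I J.
Proof. by move=> h x; apply. Qed.

Lemma mem_genI s x : x \in s -> genI s x.
Proof. by move=> h L; apply. Qed.
Lemma genI_min s J : (forall x, x \in s -> J x) -> genI s <=I J.
Proof. by move=> h; apply: spanI_min. Qed.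

Lemma sub_top J : J <=I topI. Proof. by []. Qed.
Lemma zero_sub J : zeroI <=I J. Proof. by move=> x ->; apply: idl0. Qed.
Lemma sub_addl J K : J <=I addI J K.
Proof. by move=> x hx; exists x, 0; rewrite addr0; split=> //; apply: idl0. Qed.
Lemma sub_addr J K : K <=I addI J K.
Proof. by move=> x hx; exists 0, x; rewrite add0r; split=> //; apply: idl0. Qed.
Lemma addI_min J K L : J <=I L -> K <=I L -> addI J K <=I L.
Proof. by move=> h1 h2 _ [j [k [hj hk ->]]]; apply: idlD; [apply: h1|apply: h2]. Qed.
Lemma addI_mono J K J' K' : J <=I J' -> K <=I K' -> addI J K <=I addI J' K'.
Proof.
by move=> h1 h2 _ [j [k [hj hk ->]]]; exists j, k; split; [apply: h1|apply: h2|].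
Qed.
Lemma addIC J K : addI J K = addI K J.
Proof. by apply: idl_anti => _ [j [k [hj hk ->]]]; exists k, j; rewrite addrC. Qed.
Lemma addIA J K L : addI J (addI K L) = addI (addI J K) L.
Proof.
apply: idl_anti.
  apply: addI_min; first by apply: subI_trans (@sub_addl _ _); apply: sub_addl.
  by apply: addI_mono => //; apply: sub_addr.
apply: addI_min; first by apply: addI_mono => //; apply: sub_addl.
by apply: subI_trans (@sub_addr _ _); apply: sub_addr.
Qed.
Lemma addI_idr J K : K <=I J -> addI J K = J.
Proof. by move=> h; apply: idl_anti; [apply: addI_min|apply: sub_addl]. Qed.

Lemma topP J : J 1 <-> J = topI.
Proof.
split=> [h|->//]; apply: idl_anti => // x _; rewrite -[x]mulr1; exact: idlM.
Qed.

Lemma genI_nil : genI [::] = zeroI.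
Proof. by apply: idl_anti; [apply: genI_min|apply: zero_sub]. Qed.
Lemma genI1P a x : genI [:: a] x <-> exists c, x = c * a.
Proof.
split=> [|[c ->]]; last by apply/idlM/mem_genI; rewrite mem_head.
move=> /(_ (mulI a topI)) [|c _ ->]; last by exists c; rewrite mulrC.
by move=> y /=; rewrite inE => /eqP ->; exists 1; rewrite ?mulr1.
Qed.
Lemma genI_cat s t : genI (s ++ t) = addI (genI s) (genI t).
Proof.
apply: idl_anti.
  apply: genI_min => x; rewrite mem_cat => /orP[] /mem_genI; first exact: sub_addl.
  exact: sub_addr.
by apply: addI_min; apply: genI_min => x h; apply: mem_genI; rewrite mem_cat h ?orbT.
Qed.
Lemma genI_cons a s : genI (a :: s) = addI (genI [:: a]) (genI s).
Proof. by rewrite -cat1s genI_cat. Qed.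
Lemma genI_map_sub s t : (forall x, x \in s -> x \in t) -> genI s <=I genI t.
Proof. by move=> h; apply: genI_min => x /h /mem_genI. Qed.

Lemma genI_sumP s x : genI s x <-> exists c : nat -> A, x = \sum_(i < size s) c i * s`_i.
Proof.
split=> [|[c ->]]; last by apply: idl_sum => i _; apply/idlM/mem_genI/mem_nth.
elim: s x => [|a s IH] x; first by rewrite genI_nil => ->; exists (fun=> 0); rewrite big_ord0.
rewrite genI_cons => -[_ [_ [/genI1P[c ->] /IH[c' ->] ->]]].
exists (fun i => if i is i'.+1 then c' i' else c); rewrite /= big_ord_recl.
by congr (_ + _).
Qed.

Lemma prodI_mem J K x y : J x -> K y -> prodI J K (x * y).
Proof. by move=> hx hy; apply: sub_spanI; exists x, y. Qed.
Lemma prodI_min J K L : (forall x y, J x -> K y -> L (x * y)) -> prodI J K <=I L.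
Proof. by move=> h; apply: spanI_min => _ [x [y [hx hy ->]]]; apply: h. Qed.
Lemma prodI_mono J K J' K' : J <=I J' -> K <=I K' -> prodI J K <=I prodI J' K'.
Proof. by move=> h1 h2; apply: prodI_min => x y /h1 hx /h2 hy; apply: prodI_mem. Qed.
Lemma prodIC J K : prodI J K = prodI K J.
Proof. by apply: idl_anti; apply: prodI_min => x y hx hy; rewrite mulrC; apply: prodI_mem. Qed.
Lemma prodI_subl J K : prodI J K <=I J.
Proof. by apply: prodI_min => x y hx _; apply: idlMr. Qed.
Lemma prodI_subr J K : prodI J K <=I K.
Proof. by apply: prodI_min => x y _; apply: idlM. Qed.
Lemma prodIA J K L : prodI J (prodI K L) = prodI (prodI J K) L.
Proof.
have h x y z : J x -> K y -> L z -> prodI (prodI J K) L (x * (y * z)).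
  by move=> hx hy hz; rewrite mulrA; apply: prodI_mem => //; apply: prodI_mem.
have h' x y z : J x -> K y -> L z -> prodI J (prodI K L) (x * y * z).
  by move=> hx hy hz; rewrite -mulrA; apply: prodI_mem => //; apply: prodI_mem.
apply: idl_anti; apply: prodI_min => x y.
  move=> hx hy; suff: prodI K L <=I colI (prodI (prodI J K) L) x by apply.
  by apply: prodI_min => u v hu hv; apply: h.
move=> hx hy; rewrite mulrC; suff: prodI J K <=I colI (prodI J (prodI K L)) y by apply.
by apply: prodI_min => u v hu hv; rewrite colP mulrC; apply: h'.
Qed.
Lemma prodI1 J : prodI J topI = J.
Proof.
apply: idl_anti; first exact: prodI_subl.
by move=> x hx; rewrite -[x]mulr1; apply: prodI_mem.
Qed.
Lemma prodID J K L : prodI J (addI K L) = addI (prodI J K) (prodI J L).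
Proof.
apply: idl_anti.
  apply: prodI_min => x _ hx [k [l [hk hl ->]]]; rewrite mulrDr.
  by apply: idlD; [apply: sub_addl|apply: sub_addr]; apply: prodI_mem.
by apply: addI_min; apply: prodI_mono => //; [apply: sub_addl|apply: sub_addr].
Qed.

Lemma expI1 J : expI J 1 = J. Proof. exact: prodI1. Qed.
Lemma expI_add J m n : expI J (m + n) = prodI (expI J m) (expI J n).
Proof.
elim: m => [|m IH]; first by rewrite add0n prodIC prodI1.
by rewrite addSn /= IH prodIA.
Qed.
Lemma expI_memM J m n x y : expI J m x -> expI J n y -> expI J (m + n) (x * y).
Proof. by rewrite expI_add; apply: prodI_mem. Qed.
Lemma expI_mem J n x : J x -> expI J n (x ^+ n).
Proof. by move=> h; elim: n => [|n IH] //; rewrite exprS; apply: prodI_mem. Qed.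
Lemma expI_le J m n : (n <= m)%N -> expI J m <=I expI J n.
Proof. by move=> /subnK <-; rewrite expI_add; apply: prodI_subr. Qed.
Lemma expI_mono J K n : J <=I K -> expI J n <=I expI K n.
Proof. by move=> h; elim: n => //= n IH; apply: prodI_mono. Qed.
Lemma expI_sub J n : (0 < n)%N -> expI J n <=I J.
Proof. by case: n => // n _; apply: prodI_subl. Qed.
Lemma expI_expI J m n : expI (expI J m) n = expI J (m * n).
Proof.
elim: n => [|n IH]; first by rewrite muln0.
by rewrite mulnS expI_add -IH.
Qed.

Lemma col_sub J x : J <=I colI J x.
Proof. by move=> y hy /=; apply: idlM. Qed.
Lemma col_mono J K x : J <=I K -> colI J x <=I colI K x.
Proof. by move=> h y /h. Qed.
Lemma mul_top x : mulI x topI = genI [:: x].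
Proof.
apply: idl_eq => y; rewrite genI1P; split=> [[c _ ->]|[c ->]]; exists c => //; exact: mulrC.
Qed.

(* Chains of ideals between [X] and [Y]; [ilen X Y l] says that the length of
   [Y / X] is [l]. *)
Fixpoint rch n X Y : Prop :=
  if n is n'.+1 then exists K, [/\ X <=I K, K <> X & rch n' K Y] else X <=I Y.

Definition ilen X Y l := rch l X Y /\ forall n, rch n X Y -> (n <= l)%N.

Lemma rch_sub n X Y : rch n X Y -> X <=I Y.
Proof.
elim: n X => [|n IH] X //= [K [h _ /IH]]; exact: subI_trans.
Qed.
Lemma rch_cat m n X Y Z : rch m X Y -> rch n Y Z -> rch (m + n) X Z.
Proof.
elim: m X => [|m IH] X /=; last first.
  by case=> K [hK nK hr] hn; exists K; split=> //; apply: IH hr hn.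
rewrite add0n; case: n => [|n] /= h; first exact: subI_trans.
case=> K [hK nK hr]; exists K; split=> //; first exact: subI_trans hK.
by move=> e; subst K; apply: nK; apply: idl_anti.
Qed.
Lemma rch_subl n X X' Y : X' <=I X -> rch n X Y -> rch n X' Y.
Proof. by move=> h; apply: (@rch_cat 0). Qed.
Lemma rch_subr n X Y Y' : Y <=I Y' -> rch n X Y -> rch n X Y'.
Proof. by move=> h hr; rewrite -[n]addn0; apply: rch_cat hr _. Qed.

Lemma rch_map (phi : idl -> idl) X Y n :
  (forall K L, X <=I K -> K <=I L -> L <=I Y -> phi K <=I phi L) ->
  (forall K L, X <=I K -> K <=I L -> L <=I Y -> phi K = phi L -> K = L) ->
  rch n X Y -> rch n (phi X) (phi Y).
Proof.
elim: n X => [|n IH] X hm hi /=; first by move=> h; apply: hm.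
case=> K [hK nK hr]; have KY := rch_sub hr; exists (phi K); split.
- exact: hm.
- by move=> e; apply: nK; apply/esym/hi.
- apply: IH hr => K' L h1 h2 h3; [apply: hm|apply: hi] => //; exact: subI_trans h1.
Qed.

(* Multiplication by [f] induces an isomorphism between X / (X n (W : f)) and
   (fX + W) / W. *)
Lemma rch_mul n f X W :
  rch n (capI X (colI W f)) X <-> rch n W (addI (mulI f X) W).
Proof.
pose U := addI (mulI f X) W; pose V := capI X (colI W f).
pose phi K := addI (mulI f K) W; pose psi K := capI X (colI K f).
have WU : W <=I U by apply: sub_addr.
have pm K L : K <=I L -> phi K <=I phi L.
  by move=> h; apply: addI_mono => // _ [x /h hx ->]; exists x.
have qm K L : K <=I L -> psi K <=I psi L by move=> h x [hx /h].
have pq K : W <=I K -> K <=I U -> phi (psi K) = K.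
  move=> h1 h2; apply: idl_anti => x.
    by case=> _ [w [[y [hy hy'] ->] hw ->]]; apply: idlD => //; apply: h1.
  move=> hx; have [_ [w [[y hy ->] hw e]]] := h2 _ hx.
  exists (f * y), w; split=> //; exists y => //; split=> //=.
  by have := idlB hx (h1 _ hw); rewrite e addrK.
have qp K : V <=I K -> K <=I X -> psi (phi K) = K.
  move=> h1 h2; apply: idl_anti => x.
    case=> hx [_ [w [[y hy ->] hw e]]].
    rewrite -[x](subrK y); apply: idlD => //; apply: h1; split.
      by apply: idlB => //; apply: h2.
    by rewrite colP mulrBr e addrC addKr.
  by move=> hx; split; [apply: h2|apply: sub_addl; exists x].
have phiV : phi V = W.
  apply: idl_anti; last exact: sub_addr.
  by apply: addI_min => // _ [x [hx hfx] ->].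
have psiU : psi U = X.
  by apply: idl_anti => [x []//|x hx]; split=> //; apply: sub_addl; exists x.
have phiX : phi X = U by [].
have psiW : psi W = V by [].
split=> h; rewrite -/V -/U.
  rewrite -phiV -phiX; apply: rch_map h => [K L h1 h2 h3|K L h1 h2 h3 e].
    exact: pm.
  rewrite -(qp K) ?e ?qp //; [exact: subI_trans h2|exact: subI_trans h3].
rewrite -psiW -psiU; apply: rch_map h => [K L h1 h2 h3|K L h1 h2 h3 e].
  exact: qm.
rewrite -(pq K) ?e ?pq //; [exact: subI_trans h2|exact: subI_trans h3].
Qed.

Lemma mul1I X : mulI 1 X = X.
Proof. by apply: idl_eq => x; split=> [[y hy ->]|hx]; [rewrite mul1r|exists x; rewrite ?mul1r]. Qed.

Lemma rch_diamond n X W : rch n (capI X W) X <-> rch n W (addI X W).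
Proof.
have := rch_mul n 1 X W; rewrite mul1I.
by have -> : colI W 1 = W by apply: idl_eq => x; rewrite colP mul1r.
Qed.

(** Each strict step enlarges the intersection with Y or the sum with Y. This gives additivity of
    length without composition series. *)
Lemma rch_split n X Y Z : X <=I Y -> Y <=I Z -> rch n X Z ->
  exists a b : nat, [/\ (n <= a + b)%N, rch a X Y & rch b Y Z].
Proof.
elim: n X Y => [|n IH] X Y XY YZ; first by exists 0%N, 0%N.
case=> K [XK nK hr]; have KZ := rch_sub hr.
have [a [b [ab ha hb]]] := IH K (addI Y K) (@sub_addr _ _) (addI_min YZ KZ) hr.
have ha' : rch a (capI Y K) Y by apply/rch_diamond.
have XYK : X <=I capI Y K by move=> x hx; split; [apply: XY|apply: XK].
have [e|ne] := EM (capI Y K = X); last first.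
  exists a.+1, b; split; first by lia.
    by exists (capI Y K).
  by apply: rch_subl hb; apply: sub_addl.
exists a, b.+1; split; first by lia.
  by rewrite -e.
exists (addI Y K); split=> //; first exact: sub_addl.
move=> e'; apply: nK; apply: idl_anti => //; rewrite -e => x hx; split=> //.
by rewrite -e'; apply: sub_addr.
Qed.

Lemma ilen_uniq X Y l l' : ilen X Y l -> ilen X Y l' -> l = l'.
Proof.
move=> [h1 h2] [h1' h2']; apply/eqP; rewrite eqn_leq.
by rewrite (h2' _ h1) (h2 _ h1').
Qed.
Lemma ilen_add X Y Z (a b : nat) : ilen X Y a -> ilen Y Z b -> ilen X Z (a + b).
Proof.
move=> [h1 h2] [h1' h2']; split; first exact: rch_cat h1 h1'.
move=> n /(rch_split (rch_sub h1) (rch_sub h1')) [a' [b' [le /h2 ? /h2' ?]]]; lia.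
Qed.
Lemma bounded_ilen X Y l : X <=I Y -> (forall n, rch n X Y -> (n <= l)%N) ->
  exists2 l', ilen X Y l' & (l' <= l)%N.
Proof.
move=> XY h.
have [l' [/asboolP h1 h2]] : exists l', `[< rch l' X Y >] /\ forall n, `[< rch n X Y >] -> (n <= l')%N.
  have ex0 : exists n, `[< rch n X Y >] by exists 0; apply/asboolP.
  have ub n : `[< rch n X Y >] -> (n <= l)%N by move/asboolP/h.
  by case: (ex_maxnP ex0 ub) => i hi hm; exists i.
by exists l'; [split=> // n hn; apply: h2; apply/asboolP|apply: h].
Qed.

Definition fin J := exists b : nat, forall n, rch n J topI -> (n <= b)%N.
Lemma fin_ilen J : fin J -> exists l, ilen J topI l.
Proof. by case=> b /(bounded_ilen (@sub_top J))[l hl _]; exists l. Qed.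
Lemma ilen_fin J l : ilen J topI l -> fin J.
Proof. by case=> _ h; exists l. Qed.

(* The length of A/J, and 0 when that is infinite. *)
Definition lam J : nat := if pselect (exists l, ilen J topI l) is left h then projT1 (cid h) else 0%N.
Lemma lamE J l : ilen J topI l -> lam J = l.
Proof.
rewrite /lam; case: pselect => [h hl|]; last by move=> nh hl; case: nh; exists l.
by apply: ilen_uniq hl; case: cid.
Qed.
Lemma lamP J : fin J -> ilen J topI (lam J).
Proof. by move=> /fin_ilen[l hl]; rewrite (lamE hl). Qed.

Lemma fin_sub J K : J <=I K -> fin J -> fin K.
Proof. by move=> h [b hb]; exists b => n /(rch_subl h)/hb. Qed.
Lemma lam_le J K : J <=I K -> fin J -> (lam K <= lam J)%N.
Proof.
move=> h fJ; have [hK _] := lamP (fin_sub h fJ); have [_ hJ] := lamP fJ.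
by apply/hJ/(rch_subl h).
Qed.
Lemma lam_lt J K : J <=I K -> K <> J -> fin J -> (lam K < lam J)%N.
Proof.
move=> h nK fJ; have [hK _] := lamP (fin_sub h fJ); have [_ hJ] := lamP fJ.
by apply: hJ; exists K.
Qed.
Lemma ilen_top : ilen topI topI 0.
Proof.
split=> // -[|n] //= [K [hK nK _]]; case: nK; exact: idl_anti.
Qed.
Lemma fin_top : fin topI. Proof. exact: ilen_fin ilen_top. Qed.
Lemma lam_top : lam topI = 0%N. Proof. exact: lamE ilen_top. Qed.
Lemma lam_gt0 J : fin J -> ~ J 1 -> (0 < lam J)%N.
Proof.
move=> fJ h; rewrite -lam_top; have: (lam topI < lam J)%N; last by rewrite lam_top.
by apply: lam_lt => // e; apply: h; rewrite -e.
Qed.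

Lemma ilen_rest X Y : X <=I Y -> fin X -> exists2 l, ilen X Y l & lam X = (l + lam Y)%N.
Proof.
move=> h fX; have [b hb] := fX.
have [l hl _] : exists2 l, ilen X Y l & (l <= b)%N.
  by apply: bounded_ilen => // n /(rch_subr (@sub_top Y)) /hb.
by exists l => //; apply/lamE/(ilen_add hl)/lamP/(fin_sub h).
Qed.

Lemma lam_mul f X W : fin X -> fin W -> fin (capI X (colI W f)) ->
  (lam (capI X (colI W f)) + lam (addI (mulI f X) W) = lam X + lam W)%N.
Proof.
move=> fX fW fc.
have VX : capI X (colI W f) <=I X by move=> x [].
have [l [hl hl'] ->] := ilen_rest VX fc.
have WU : W <=I addI (mulI f X) W by apply: sub_addr.
have [l2 hl2 ->] := ilen_rest WU fW.
have -> : l2 = l by apply: ilen_uniq hl2 _; split=> [|n]; rewrite -rch_mul //; apply: hl'.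
lia.
Qed.

(** Read off from 0 -> A/(W : f) -> A/W -> A/(W + fA) -> 0, the sequence behind most of the later
    counts. *)
Lemma fin_col W f : fin (addI W (genI [:: f])) -> fin (colI W f) -> fin W.
Proof.
move=> f1 f2; have [h1 h2] := lamP f2.
have e : capI topI (colI W f) = colI W f by apply: idl_eq => x; split=> [[]//|?]; split.
have hU : ilen W (addI (mulI f topI) W) (lam (colI W f)).
  by split=> [|n]; rewrite -rch_mul e // => /h2.
rewrite mul_top addIC in hU; exact/ilen_fin/(ilen_add hU)/lamP.
Qed.
Lemma lam_col W f : fin W -> lam W = (lam (addI W (genI [:: f])) + lam (colI W f))%N.
Proof.
move=> fW.
have e : capI topI (colI W f) = colI W f by apply: idl_eq => x; split=> [[]//|?]; split.
have fc : fin (colI W f) by apply: fin_sub fW; apply: col_sub.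
have := @lam_mul f topI W fin_top fW; rewrite e mul_top addIC lam_top => /(_ fc); lia.
Qed.
End Ideals.

Arguments spanI : simpl never.
Arguments prodI : simpl never.
Arguments genI : simpl never.
Arguments addI : simpl never.
Arguments expI : simpl nomatch.
Arguments idl_set : simpl never.

(** * Growth of Hilbert-Samuel functions *)

Section Growth.
Variable A : comNzRingType.
Implicit Types (J K L W : idl A) (x y z : A) (s t : seq A).

(* The exponent is truncated so that [pw 0] vanishes: error terms of degree
   [d - 1] are then zero, not constant, when [d = 0]. *)
Definition pw (d n : nat) : nat := if d is d'.+1 then (n.+1 ^ d')%N else 0%N.

Lemma leq_expl d m n : (m <= n)%N -> (m ^ d <= n ^ d)%N.
Proof. by case: d => // d h; rewrite leq_exp2r. Qed.
Lemma pw_mono d m n : (m <= n)%N -> (pw d m <= pw d n)%N.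
Proof. by case: d => //= d h; apply: leq_expl. Qed.
Lemma pwS d n : (pw d n <= pw d.+1 n)%N.
Proof. by case: d => //= d; rewrite expnS leq_pmull. Qed.
Lemma pw_shift d c n : (pw d (n + c) <= c.+1 ^ d * pw d n)%N.
Proof.
case: d => //= d; rewrite expnS -mulnA -expnMn.
by apply: leq_trans (leq_pmull _ (ltn0Sn c)); apply: leq_expl; rewrite mulSn mulnS; lia.
Qed.
Lemma pw_sum d n : (\sum_(i < n) pw d i <= pw d.+1 n)%N.
Proof.
apply: (@leq_trans (\sum_(i < n) pw d n)); first by apply: leq_sum => i _; apply: pw_mono; apply: ltnW.
rewrite sum_nat_const card_ord; case: d => [|d] /=; first by rewrite muln0.
by rewrite expnS leq_mul2r leqnSn orbT.
Qed.

Fixpoint monos s : nat -> seq A :=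
  if s is f :: s' then
    fix ms n := if n is n'.+1 then [seq f * y | y <- ms n'] ++ monos s' n else [:: 1]
  else fun n => if n is 0 then [:: 1] else [::].

Lemma monos0 s : monos s 0 = [:: 1]. Proof. by case: s. Qed.
Lemma monosS f s n : monos (f :: s) n.+1 = [seq f * y | y <- monos (f :: s) n] ++ monos s n.+1.
Proof. by []. Qed.

(** Restricted to positive degrees because of the empty list: its only monomial 1 has degree 0,
    where [pw 0] is 0. *)
Lemma size_monos s n : (size (monos s n.+1) <= pw (size s) n.+1)%N.
Proof.
have h0 t : (size (monos t 0) <= pw (size t).+1 0)%N by rewrite monos0 /= exp1n.
elim: s n => // f s IH n.
suff : forall n, (size (monos (f :: s) n) <= n.+1 ^ size s)%N by [].
elim=> [|{}n IHn]; first by rewrite monos0 exp1n.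
rewrite monosS size_cat size_map.
move: (IH n) IHn; case: (size s) => [|d] /=; first by lia.
rewrite !expnS; have : (n.+1 ^ d <= n.+2 ^ d)%N by apply: leq_expl.
nia.
Qed.

Lemma genI_mulmap f s : genI [seq f * y | y <- s] = mulI f (genI s).
Proof.
apply: idl_anti.
  apply: genI_min => _ /mapP[y hy ->]; exists y => //; exact: mem_genI.
move=> _ [y hy ->]; suff: genI s <=I colI (genI [seq f * y | y <- s]) f by apply.
by apply: genI_min => z hz /=; apply/mem_genI/map_f.
Qed.

Lemma genI_one : genI [:: 1 : A] = topI A.
Proof. by apply/topP/mem_genI; rewrite mem_head. Qed.

Lemma prod_gen1 f J : prodI (genI [:: f]) J = mulI f J.
Proof.
apply: idl_anti.
  by apply: prodI_min => _ y /genI1P[c ->] hy; exists (c * y); [apply: idlM|rewrite mulrAC mulrA [f * c]mulrC mulrAC].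
by move=> _ [y hy ->]; apply: prodI_mem => //; apply: mem_genI; rewrite mem_head.
Qed.

(** A product of n + 1 factors either has a factor from J or lies in K^(n+1). With J = fA this
    separates the multiples of f from the monomials in the other generators. *)
Lemma expI_addS J K n :
  expI (addI J K) n.+1 = addI (prodI J (expI (addI J K) n)) (expI K n.+1).
Proof.
set I := addI J K; have JI : J <=I I by apply: sub_addl.
have KI : K <=I I by apply: sub_addr.
apply: idl_anti; last first.
  by apply: addI_min; [apply: prodI_mono|apply: expI_mono].
rewrite {1}/expI -/expI {1}/I prodIC prodID.
apply: addI_min; first by rewrite prodIC; apply: sub_addl.
rewrite prodIC; elim: n => [|n IH]; first exact: sub_addr.
rewrite -[expI I n.+1]/(prodI I (expI I n)).
set X := expI I n in IH *.
have h : prodI I X <=I addI (prodI J X) (expI K n.+1).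
  rewrite {1}/I prodIC prodID; apply: addI_min; first by rewrite prodIC; apply: sub_addl.
  by rewrite prodIC.
apply: subI_trans (prodI_mono (subI_refl (P := K)) h) _; rewrite prodID.
apply: addI_mono => //; rewrite prodIA [prodI K J]prodIC -prodIA.
by apply: prodI_mono => //; apply: prodI_mono.
Qed.

Lemma genI_monos s n : genI (monos s n) = expI (genI s) n.
Proof.
elim: s n => [|f s IH] n.
  case: n => [|n] /=; first exact: genI_one.
  rewrite genI_nil; apply: idl_anti; first exact: zero_sub.
  exact: prodI_subl.
elim: n => [|n IHn]; first by rewrite monos0 genI_one.
rewrite monosS genI_cat genI_mulmap IHn IH -prod_gen1 [genI (f :: s)]genI_cons.
by rewrite -expI_addS.
Qed.

(** (W + (t))/W is a quotient of [size t] copies of A/L. *)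
Lemma fin_gens W L t : fin L -> (forall y z, y \in t -> L z -> W (y * z)) ->
  fin (addI W (genI t)) ->
  fin W /\ (lam W <= lam (addI W (genI t)) + lam L * size t)%N.
Proof.
move=> fL; elim: t W => [|y t IH] W h.
  by rewrite genI_nil addI_idr ?muln0 ?addn0 //; apply: zero_sub.
rewrite genI_cons addIA => fWt.
have [|f1 le1] := IH _ _ fWt; first by move=> y' z hy hz; apply/sub_addl/h; rewrite ?inE ?hy ?orbT.
have Lc : L <=I colI W y by move=> z hz; apply: h; rewrite ?mem_head.
have fc := fin_sub Lc fL; have fW := fin_col f1 fc; split=> //.
rewrite (lam_col y fW); have := lam_le Lc fL => /=; lia.
Qed.

(** Modulo J, (s)^k/(s)^(k+1) is generated over A/(J + (s)) by the monomials of degree k. *)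
Lemma fin_pow J s n : fin (addI J (genI s)) -> fin (addI J (expI (genI s) n)) /\
  (lam (addI J (expI (genI s) n.+2)) <= lam (addI J (expI (genI s) n.+1))
     + lam (addI J (genI s)) * pw (size s) n.+1)%N.
Proof.
set I := genI s => fI.
have step k : fin (addI J (expI I k)) -> fin (addI J (expI I k.+1)) /\
   (lam (addI J (expI I k.+1)) <= lam (addI J (expI I k)) + lam (addI J I) * size (monos s k))%N.
  have e : addI (addI J (expI I k.+1)) (genI (monos s k)) = addI J (expI I k).
    by rewrite -addIA genI_monos -/I [addI (expI I k.+1) _]addIC (addI_idr (expI_le (leqnSn k))).
  move=> fk; have := @fin_gens (addI J (expI I k.+1)) (addI J I) (monos s k) fI.
  rewrite e; apply => // y z /mem_genI; rewrite genI_monos -/I => hy [a [b [ha hb ->]]].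
  rewrite mulrDr; apply: idlD; first by apply/sub_addl/idlM.
  by apply: sub_addr; rewrite mulrC; apply: (@prodI_mem _ I).
have fk k : fin (addI J (expI I k)).
  by elim: k => [|k /step[]//]; rewrite /= addIC addI_idr //; apply: fin_top.
split=> //; have [_ le] := step n.+1 (fk _); apply: leq_trans le _.
by rewrite leq_add2l leq_mul2l size_monos orbT.
Qed.

(** u - v = O(n^(d-1)), as two inequalities because subtraction on [nat] truncates. This is equality
    of the degree d terms, without Hilbert polynomials. *)
Definition eqO d (u v : nat -> nat) := exists C : nat, forall n,
  (u n <= v n + C * pw d n)%N /\ (v n <= u n + C * pw d n)%N.

Lemma eqO_refl d u : eqO d u u.
Proof. by exists 0%N => n; lia. Qed.
Lemma eqO_trans d u v w : eqO d u v -> eqO d v w -> eqO d u w.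
Proof.
move=> [C h] [D h']; exists (C + D)%N => n; have := h n; have := h' n; nia.
Qed.
Lemma eqO_ext d u v u' v' : u =1 u' -> v =1 v' -> eqO d u v -> eqO d u' v'.
Proof. by move=> e1 e2 [C h]; exists C => n; rewrite -e1 -e2. Qed.
Lemma eqO_add d u v u' v' : eqO d u v -> eqO d u' v' ->
  eqO d (fun n => u n + u' n)%N (fun n => v n + v' n)%N.
Proof.
move=> [C h] [D h']; exists (C + D)%N => n; have := h n; have := h' n; nia.
Qed.
Lemma eqO_sum d u v : eqO d u v ->
  eqO d.+1 (fun n => \sum_(i < n) u i)%N (fun n => \sum_(i < n) v i)%N.
Proof.
case=> C h; exists C => n.
have key (a b : nat -> nat) : (forall i, a i <= b i + C * pw d i)%N ->
    (\sum_(i < n) a i <= \sum_(i < n) b i + C * pw d.+1 n)%N.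
  move=> hab; apply: (@leq_trans (\sum_(i < n) (b i + C * pw d i))%N).
    by apply: leq_sum.
  by rewrite big_split -big_distrr leq_add2l leq_mul2l pw_sum orbT.
by split; apply: key => i; have [] := h i.
Qed.
Lemma eqO_S d u v : eqO d u v -> eqO d.+1 u v.
Proof.
case=> C h; exists C => n; have := h n; have := pwS d n; nia.
Qed.

(** The Hilbert-Samuel function of A/J for the ideal (s), shifted by one: its value at n adds up the
    graded pieces of degrees 0 to n. *)
Definition pfun J s n := lam (addI J (expI (genI s) n.+1)).

Lemma fin_expI J s n : fin (addI J (genI s)) -> fin (addI J (expI (genI s) n)).
Proof. by move=> /(fin_pow n)[]. Qed.

Lemma pfun_mono J s m n : fin (addI J (genI s)) -> (m <= n)%N -> (pfun J s m <= pfun J s n)%N.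
Proof.
move=> h mn; apply: lam_le; last exact: fin_expI.
by apply: addI_mono => //; apply: expI_le.
Qed.

Lemma pfunS J s : fin (addI J (genI s)) -> exists C : nat, forall n,
  (pfun J s n.+1 <= pfun J s n + C * pw (size s) n)%N.
Proof.
move=> h; exists (lam (addI J (genI s)) * 2 ^ size s)%N => n.
have [_ le] := fin_pow n h; apply: leq_trans le _; rewrite leq_add2l -mulnA leq_mul2l.
by rewrite -addn1 pw_shift orbT.
Qed.

(** Artin-Rees fixes exponents only up to a constant c; this absorbs the shift into the error. *)
Lemma pfun_shift J s c : fin (addI J (genI s)) ->
  eqO (size s) (fun n => pfun J s (n + c)) (pfun J s).
Proof.
move=> h; elim: c => [|c [C hC]].
  by apply: eqO_ext (eqO_refl _ (pfun J s)) => // n; rewrite addn0.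
have [D hD] := pfunS h; exists (C + D * c.+1 ^ size s)%N => n.
rewrite addnS; have := hC n; have := hD (n + c)%N; have := pw_shift (size s) c n.
have := pfun_mono h (leqnSn (n + c)); set a := pw _ n; set b := pw _ (n + c).
set e := (c.+1 ^ _)%N => h1 h2 h3 [h4 h5]; split; last by lia.
apply: leq_trans h3 _; apply: (@leq_trans (pfun J s n + C * a + D * (e * a))%N); last by nia.
by rewrite leq_add // leq_mul2l h2 orbT.
Qed.

Lemma pfun_bound J s : fin (addI J (genI s)) -> eqO (size s).+1 (pfun J s) (fun=> 0%N).
Proof.
move=> h; have [C hC] := pfunS h; exists (C + pfun J s 0)%N => n; split=> //.
rewrite add0n; apply: (@leq_trans (pfun J s 0 + C * \sum_(i < n) pw (size s) i)%N).
  elim: n => [|n IH]; first by lia.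
  by rewrite big_ord_recr /= mulnDr addnA; apply: leq_trans (hC n) _; rewrite leq_add2r.
have := pw_sum (size s) n; have : (0 < pw (size s).+1 n)%N by rewrite /= expn_gt0.
nia.
Qed.

End Growth.

(** * Noetherian induction and maximal elements *)

Section Noetherian.
Definition noeth (A : comNzRingType) := forall J : idl A, exists s, J = genI s.

Variables (A : comNzRingType) (nA : noeth A).
Implicit Types (J K L : idl A).

(** A counterexample starts a strictly increasing sequence of counterexamples; its union is finitely
    generated and hence already reached at a finite stage. *)
Lemma noeth_ind (Phi : idl A -> Prop) :
  (forall J, (forall K, J <=I K -> K <> J -> Phi K) -> Phi J) -> forall J, Phi J.
Proof.
move=> h J0; have [//|nP] := EM (Phi J0); exfalso.
have step (J : {J | ~ Phi J}) : {K : {K | ~ Phi K} | sval J <=I sval K /\ sval K <> sval J}.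
  case: J => J nJ; apply: cid; apply: contrapT => hn; apply: (nJ); apply: h => K JK nK.
  by apply: contrapT => nPK; apply: hn; exists (exist _ K nPK).
pose u := fix u n := if n is n'.+1 then sval (step (u n')) else exist _ J0 nP.
have us n : sval (u n) <=I sval (u n.+1) /\ sval (u n.+1) <> sval (u n).
  by rewrite /=; case: (step _).
have um m n : (m <= n)%N -> sval (u m) <=I sval (u n).
  elim: n => [|n IH]; first by rewrite leqn0 => /eqP ->.
  rewrite leq_eqVlt => /predU1P[->//|/IH h']; apply: subI_trans h' _; apply: (us n).1.
pose U := Idl (idl_set := fun x => exists n, sval (u n) x).
have axU : [/\ exists n, sval (u n) 0,
   forall x y : A, (exists n, sval (u n) x) -> (exists n, sval (u n) y) -> exists n, sval (u n) (x + y)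
  & forall a x : A, (exists n, sval (u n) x) -> exists n, sval (u n) (a * x)].
  split; first by exists 0%N; apply: idl0.
    move=> x y [m hm] [n hn]; exists (maxn m n); apply: idlD.
      by apply: um hm; rewrite leq_maxl.
    by apply: um hn; rewrite leq_maxr.
  by move=> a x [n hn]; exists n; apply: idlM.
have [s es] := nA (U axU).
have [N hN] : exists N, forall x, x \in s -> sval (u N) x.
  have : forall x, x \in s -> U axU x by move=> x hx; rewrite es; apply: mem_genI.
  elim: s {es} => [|x s IH] hs; first by exists 0%N.
  have [N hN] := IH (fun y hy => hs y (mem_behead (s := x :: s) hy)).
  have [n hn] := hs x (mem_head _ _); exists (maxn n N) => y; rewrite inE => /predU1P[->|hy].
    by apply: um hn; rewrite leq_maxl.
  by apply: um (hN y hy); rewrite leq_maxr.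
apply: (us N).2; apply: idl_anti; last exact: (us N).1.
have : U axU <=I sval (u N) by rewrite es; apply: genI_min.
by move=> hU x hx; apply: hU; exists N.+1.
Qed.

Lemma noeth_max (Phi : idl A -> Prop) J : Phi J ->
  exists K, [/\ J <=I K, Phi K & forall L, K <=I L -> Phi L -> L = K].
Proof.
elim/noeth_ind: J => J IH hJ.
have [[K [JK nK hK]]|hn] := EM (exists K, [/\ J <=I K, K <> J & Phi K]).
  have [L [KL hL mL]] := IH K JK nK hK; exists L; split=> //; exact: subI_trans KL.
exists J; split=> // L JL hL; apply: contrapT => nL; apply: hn; by exists L.
Qed.
End Noetherian.

(** * Hilbert's basis theorem and the Artin-Rees lemma *)

Section HilbertBasis.
Variables (R : comNzRingType) (nR : noeth R).

Lemma size_leP (n : nat) (f : {poly R}) :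
  (size f <= n)%N <-> forall i, (n <= i)%N -> f`_i = 0.
Proof. by split=> [h|h]; [move/leq_sizeP: h => h i /h | apply/leq_sizeP => i /h]. Qed.

(** Hilbert's argument: the ideals [L n] of coefficients at degree n of members of J of degree at
    most n are stationary from some N on, so lifts of generators of [L 0], ..., [L N] generate J. *)
Lemma noeth_poly : noeth {poly R}.
Proof.
move=> J.
have ax n : [/\ exists f : {poly R}, [/\ J f, (size f <= n.+1)%N & f`_n = 0],
    forall x y, (exists f : {poly R}, [/\ J f, (size f <= n.+1)%N & f`_n = x]) ->
      (exists f : {poly R}, [/\ J f, (size f <= n.+1)%N & f`_n = y]) ->
      exists f : {poly R}, [/\ J f, (size f <= n.+1)%N & f`_n = x + y]
  & forall a x, (exists f : {poly R}, [/\ J f, (size f <= n.+1)%N & f`_n = x]) ->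
      exists f : {poly R}, [/\ J f, (size f <= n.+1)%N & f`_n = a * x]].
  split; first by exists 0; rewrite size_poly0 coef0; split=> //; apply: idl0.
    move=> _ _ [f [Jf /size_leP sf <-]] [g [Jg /size_leP sg <-]]; exists (f + g).
    rewrite coefD; split=> //; first exact: idlD.
    by apply/size_leP => i hi; rewrite coefD sf // sg // addr0.
  move=> a _ [f [Jf /size_leP sf <-]]; exists (a%:P * f).
  rewrite coefCM; split=> //; first exact: idlM.
  by apply/size_leP => i hi; rewrite coefCM sf // mulr0.
pose L n := Idl (ax n).
have Lmono m n : (m <= n)%N -> L m <=I L n.
  move=> /subnK <- _ [f [Jf /size_leP sf <-]]; exists ('X^(n - m) * f).
  split; first exact: idlM.
    apply/size_leP => i hi; rewrite coefXnM; case: ltnP => // h; apply: sf; lia.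
  by rewrite coefXnM -ltn_subRL subnn ltn0 addnC addnK.
have [_ [_ [N ->] Nmax]] := noeth_max nR (Phi := fun K => exists n, K = L n) (ex_intro _ 0%N (erefl (L 0%N))).
have LN n : (N <= n)%N -> L n <=I L N.
  by move=> h; rewrite (Nmax (L n)) //; [apply: Lmono|exists n].
have lift n : exists G : seq {poly R}, (forall g, g \in G -> J g) /\
    forall c, L n c -> exists g : {poly R}, [/\ genI G g, J g, (size g <= n.+1)%N & g`_n = c].
  have [t et] := nR (L n); rewrite et.
  have : forall c, c \in t -> L n c by move=> c hc; rewrite et; apply: mem_genI.
  elim: t {et} => [|c t IH] ht.
    exists [::]; split=> // c; rewrite genI_nil => ->; exists 0.
    by rewrite size_poly0 coef0; split=> //; apply: idl0.
  have [G [GJ hG]] := IH (fun c hc => ht c (mem_behead (s := _ :: _) hc)).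
  have [f [Jf /size_leP sf ef]] := ht c (mem_head _ _).
  exists (f :: G); split; first by move=> g; rewrite inE => /predU1P[->//|/GJ].
  move=> d; rewrite genI_cons => -[_ [d' [/genI1P[e ->] /hG[g [Gg Jg /size_leP sg eg]] ->]]].
  exists (e%:P * f + g); split.
  - rewrite genI_cons; exists (e%:P * f), g; split=> //; apply/genI1P; by exists e%:P.
  - by apply: idlD => //; apply: idlM.
  - by apply/size_leP => i hi; rewrite coefD coefCM sf // sg // mulr0 addr0.
  - by rewrite coefD coefCM ef eg.
have [G hG] := choice lift.
exists (flatten [seq G i | i <- iota 0 N.+1]); set F := flatten _.
have GF n : (n <= N)%N -> genI (G n) <=I genI F.
  move=> h; apply: genI_map_sub => g hg; apply/flattenP; exists (G n) => //.
  by apply: map_f; rewrite mem_iota; lia.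
apply: idl_anti; last first.
  by apply: genI_min => g /flattenP[_ /mapP[n _ ->]]; case: (hG n) => + _; apply.
suff : forall n (f : {poly R}), (size f <= n)%N -> J f -> genI F f by move=> h f; apply: (h (size f)).
elim=> [|n IH] f sf Jf.
  by move: sf; rewrite leqn0 size_poly_eq0 => /eqP ->; apply: idl0.
have Lf : L n f`_n by exists f.
have [g [Fg Jg sg eg]] : exists g : {poly R}, [/\ genI F g, J g, (size g <= n.+1)%N & g`_n = f`_n].
  have [le|lt] := leqP n N.
    have [_ /(_ _ Lf)[g [Gg Jg sg eg]]] := hG n; exists g; split=> //; exact: GF Gg.
  have [_ /(_ _ (LN n (ltnW lt) _ Lf))[g [Gg Jg sg eg]]] := hG N.
  exists ('X^(n - N) * g); split.
  - by apply/idlM/(GF N).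
  - exact: idlM.
  - move/size_leP: sg => sg; apply/size_leP => i hi; rewrite coefXnM; case: ltnP => // h; apply: sg; lia.
  - by rewrite coefXnM ltnNge leq_subr /= subKn // ltnW.
rewrite -[f](subrK g); apply: idlD => //; apply: IH; last exact: idlB.
move/size_leP: sf => sf; move/size_leP: sg => sg; apply/size_leP => i.
rewrite coefB leq_eqVlt => /predU1P[<-|lt]; first by rewrite eg subrr.
by rewrite sf // sg // subrr.
Qed.
End HilbertBasis.

Section ArtinRees.
Variables (A : comNzRingType) (nA : noeth A).
Implicit Types (J K : idl A) (x y : A) (s : seq A).

(* A noetherian ring mapping onto the Rees algebra of [I], inside A[X]. *)
Lemma rees_cover (I : idl A) s : genI s <=I I -> exists (S : comNzRingType)
    (phi : {rmorphism S -> {poly A}}),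
  [/\ noeth S, forall t n, expI I n (phi t)`_n, forall a, exists t, phi t = a%:P
    & forall f, f \in s -> exists t, phi t = f *: 'X].
Proof.
elim: s => [|f s IH] hs.
  exists A, (polyC : {rmorphism A -> {poly A}}); split=> // [t n|a]; last by exists a.
  by rewrite coefC; case: eqP => [->//|_]; apply: idl0.
have [|S [phi [nS hI hC hX]]] := IH.
  by apply: genI_min => y hy; apply: hs; apply: mem_genI; rewrite inE hy orbT.
have If : I f by apply: hs; apply: mem_genI; rewrite mem_head.
have cfu : commr_rmorph phi (f *: 'X) by move=> a; apply: mulrC.
exists {poly S}, (horner_morph cfu : {rmorphism {poly S} -> {poly A}}); split.
- exact: noeth_poly.
- elim/poly_ind => [|p c IHp] n; first by rewrite rmorph0 coef0; apply: idl0.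
  rewrite rmorphD rmorphM /= horner_morphX horner_morphC coefD.
  apply: idlD => //; rewrite -scalerAr coefZ coefMX; case: eqP => [_|].
    by rewrite mulr0; apply: idl0.
  by case: n => // n _ /=; apply: prodI_mem.
- by move=> a; have [t <-] := hC a; exists t%:P; rewrite /= horner_morphC.
- move=> g; rewrite inE => /predU1P[->|/hX[t <-]]; last by exists t%:P; rewrite /= horner_morphC.
  by exists (polyX S); rewrite /= horner_morphX.
Qed.

(** If x y = j + u with u in I^(n+c), then u X^(n+c) is an element of the Rees algebra with
    coefficient in xA + J. The elements of S whose images have all coefficients in xA + J form a
    finitely generated ideal, and c bounds the sizes of the generators. Expanding u in them gives u
    = x z + j' with z in I^n, so that y - z lies in (J : x). *)
Lemma artin_rees J x s : exists c : nat, forall n,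
  colI (addI J (expI (genI s) (n + c))) x <=I addI (colI J x) (expI (genI s) n).
Proof.
set I := genI s; have [S [phi [nS hI hC hX]]] := rees_cover (subI_refl (P := I)).
have hT n u : expI I n u -> exists t, phi t = u *: 'X^n.
  elim: n u => [|n IH] u; first by move=> _; rewrite expr0 alg_polyC.
  have ax : [/\ exists t, phi t = (0 : A) *: 'X^(n.+1),
     forall u v : A, (exists t, phi t = u *: 'X^(n.+1)) -> (exists t, phi t = v *: 'X^(n.+1)) ->
        exists t, phi t = (u + v) *: 'X^(n.+1)
     & forall a u : A, (exists t, phi t = u *: 'X^(n.+1)) -> exists t, phi t = (a * u) *: 'X^(n.+1)].
    split; first by exists 0; rewrite rmorph0 scale0r.
      by move=> a b [t et] [t' et']; exists (t + t'); rewrite rmorphD et et' scalerDl.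
    move=> a b [t et]; have [t' et'] := hC a; exists (t' * t).
    by rewrite rmorphM et et' mul_polyC scalerA.
  move: u; apply: (prodI_min (L := Idl ax)) => a b ha /IH[t' et'].
  have [t et] : exists t, phi t = a *: 'X.
    have ax' : [/\ exists t, phi t = (0 : A) *: 'X,
     forall u v : A, (exists t, phi t = u *: 'X) -> (exists t, phi t = v *: 'X) ->
        exists t, phi t = (u + v) *: 'X
     & forall a u : A, (exists t, phi t = u *: 'X) -> exists t, phi t = (a * u) *: 'X].
      split; first by exists 0; rewrite rmorph0 scale0r.
        by move=> p q [t et] [u eu]; exists (t + u); rewrite rmorphD et eu scalerDl.
      move=> p q [t et]; have [u eu] := hC p; exists (u * t).
      by rewrite rmorphM et eu mul_polyC scalerA.
    by move: a ha; apply: (genI_min (J := Idl ax')).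
  exists (t * t'); rewrite rmorphM et et' -scalerAl -scalerAr scalerA.
  by rewrite exprS mulrC.
pose K := addI (genI [:: x]) J.
have ax : [/\ forall k, K (phi 0)`_k,
    forall t u, (forall k, K (phi t)`_k) -> (forall k, K (phi u)`_k) -> forall k, K (phi (t + u))`_k
  & forall a t, (forall k, K (phi t)`_k) -> forall k, K (phi (a * t))`_k].
  split=> [k|t u ht hu k|a t ht k]; first by rewrite rmorph0 coef0; apply: idl0.
    by rewrite rmorphD coefD; apply: idlD.
  by rewrite rmorphM coefM; apply: idl_sum => i _; apply: idlM.
have [ts ets] := nS (Idl ax).
have [c hc] : exists c, forall t, t \in ts -> (size (phi t) <= c)%N.
  elim: ts {ets} => [|t ts [c hc]]; first by exists 0%N.
  exists (maxn (size (phi t)) c) => u; rewrite inE => /predU1P[->|/hc h].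
    by rewrite leq_maxl.
  by rewrite (leq_trans h) // leq_maxr.
exists c => n y /= [j [u [Jj Iu exy]]].
have [t et] := hT _ _ Iu.
have Tt : Idl ax t.
  move=> k; rewrite et coefZ coefXn; case: eqP => _; last by rewrite mulr0; apply: idl0.
  rewrite mulr1; have -> : u = x * y - j by rewrite exy addrC addKr.
  apply: idlB; last exact: sub_addr.
  by apply: sub_addl; rewrite mulrC; apply/genI1P; exists y.
move: Tt; rewrite ets => /genI_sumP[g eg].
(* The coefficient at n + c of a combination of the generators: these vanish from degree c on, so
   every cofactor enters with degree at least n and its coefficient lies in I^n. *)
have cut (Q : A -> A -> Prop) : Q 0 0 -> (forall a b a' b', Q a a' -> Q b b' -> Q (a + b) (a' + b')) ->
   (forall (a b : A), expI I n a -> K b -> exists2 z, Q (a * b) z & expI I n z) ->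
   exists2 z, Q u z & expI I n z.
  move=> Q0 QD QM.
  have -> : u = (phi t)`_(n + c) by rewrite et coefZ coefXn eqxx mulr1.
  rewrite eg rmorph_sum coef_sum.
  have sumQ m (F : 'I_m -> A) : (forall i, exists2 z, Q (F i) z & expI I n z) ->
     exists2 z, Q (\sum_i F i) z & expI I n z.
    move=> h; apply: (big_ind (fun a => exists2 z, Q a z & expI I n z)) => //.
      by exists 0 => //; apply: idl0.
    move=> a b [z h1 h2] [z' h1' h2']; exists (z + z'); [exact: QD|exact: idlD].
  apply: (sumQ) => i; rewrite rmorphM coefMr; apply: (sumQ) => k.
  have [lt|le] := ltnP k c; last first.
    rewrite [(phi ts`_i)`_k]nth_default ?mulr0; first by exists 0 => //; apply: idl0.
    by apply: leq_trans le; apply/hc/mem_nth.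
  apply: QM; first by apply: expI_le (hI _ _); lia.
  have : Idl ax ts`_i by rewrite ets; apply/mem_genI/mem_nth.
  exact.
have [z [j' Jj' ez] Iz] : exists2 z, (exists2 j', J j' & u = x * z + j') & expI I n z.
  apply: (cut (fun a b => exists2 j', J j' & a = x * b + j')).
  - by exists 0; rewrite ?mulr0 ?addr0 //; apply: idl0.
  - move=> _ _ a b [j1 h1 ->] [j2 h2 ->]; exists (j1 + j2); first exact: idlD.
    by rewrite mulrDr addrACA.
  - move=> a _ Ia [_ [j1 [/genI1P[d ->] h1 ->]]]; exists (a * d); last exact: idlMr.
    by exists (a * j1); [apply: idlM|rewrite mulrDr mulrA mulrC].
exists (y - z), z; split=> //; last by rewrite subrK.
rewrite colP mulrBr exy ez.
have -> : j + (x * z + j') - x * z = j + j' by ring.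
exact: idlD.
Qed.
End ArtinRees.

Notation In := List.In.

(** * Prime filtrations and dimension *)

Section Primes.
Variable A : comNzRingType.
Implicit Types (J K L P Q : idl A) (x y z : A) (s t : seq A) (l ps : seq (idl A)).

Definition primeI P := ~ P 1 /\ forall x y, P (x * y) -> P x \/ P y.

Lemma primeX P x n : primeI P -> P (x ^+ n) -> P x.
Proof.
move=> [h1 hM]; elim: n => [/h1//|n IH]; by rewrite exprS => /hM[|/IH].
Qed.
Lemma prime_col P x : primeI P -> ~ P x -> colI P x = P.
Proof. by move=> [_ hM] nx; apply: idl_anti; [move=> y /hM[]|apply: col_sub]. Qed.

Lemma not_subI J K : ~ (J <=I K) -> exists2 x, J x & ~ K x.
Proof. by move=> /existsNP[x /not_implyP[? ?]]; exists x. Qed.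

(* [l] lists the primes of a prime filtration of K/J. *)
Inductive pfilt : idl A -> idl A -> seq (idl A) -> Prop :=
| Pfilt_nil J : pfilt J J [::]
| Pfilt_cons J K x l : primeI (colI J x) -> pfilt (addI J (genI [:: x])) K l ->
    pfilt J K (colI J x :: l).

Lemma mem_gen1 x : genI [:: x] x. Proof. by apply: mem_genI; rewrite mem_head. Qed.
Lemma add_gen1 J x : addI J (genI [:: x]) x.
Proof. exact/sub_addr/mem_gen1. Qed.
Lemma gen1_min J x : J x -> genI [:: x] <=I J.
Proof. by move=> h; apply: genI_min => y; rewrite inE => /eqP ->. Qed.

(** A maximal one among the colons (J : y) with y in K but not in J is prime, and J can be replaced
    by J + yA. *)
Lemma pfilt_ex J K : noeth A -> J <=I K -> exists l, pfilt J K l.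
Proof.
move=> nA; elim/(noeth_ind nA): J => J IH JK.
have [|nKJ] := EM (K <=I J); first by move=> KJ; rewrite (idl_anti KJ JK); exists [::]; left.
have [x Kx nx] := not_subI nKJ.
pose Phi L := exists y, [/\ K y, ~ J y & L = colI J y].
have [_ [_ [y [Ky ny ->]] ymax]] := @noeth_max A nA Phi _ (ex_intro _ x (And3 Kx nx (erefl _))).
have pr : primeI (colI J y).
  split; first by rewrite colP mulr1.
  move=> a b; rewrite !colP => hab; have [|nya] := EM (J (y * a)); first by left.
  right; rewrite -[J (y * b)]/(colI J y b) -(ymax (colI J (y * a))).
  - by rewrite colP -mulrA.
  - by move=> z; rewrite !colP => hz; rewrite mulrAC; apply: idlMr.
  - by exists (y * a); split=> //; apply: idlMr.
have JJ : J <=I addI J (genI [:: y]) by apply: sub_addl.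
have [|||l hl] := IH (addI J (genI [:: y])) => //.
- by move=> e; apply: ny; rewrite -e; apply: add_gen1.
- by apply: addI_min => //; apply: gen1_min.
by exists (colI J y :: l); right.
Qed.

Lemma pfilt_sub J K l : pfilt J K l -> J <=I K.
Proof. by elim=> // {}J {}K x {}l _ _; apply: subI_trans; apply: sub_addl. Qed.
Lemma pfilt_prime J K l Q : pfilt J K l -> In Q l -> primeI Q.
Proof. by elim=> //= {}J {}K x {}l pr _ IH [<-|/IH]. Qed.
Lemma pfilt_le J K l Q : pfilt J K l -> In Q l -> J <=I Q.
Proof.
elim=> //= {}J {}K x {}l pr _ IH [<-|/IH h]; first exact: col_sub.
by apply: subI_trans h; apply: sub_addl.
Qed.
Lemma pfilt_col J K l a Q : pfilt J K l -> (forall y, K y -> J (a * y)) -> In Q l -> Q a.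
Proof.
elim=> //= {}J {}K x {}l pr hl IH h [<-|]; last by apply: IH => y /h; apply: sub_addl.
rewrite colP mulrC; apply/h/(pfilt_sub hl)/add_gen1.
Qed.
Lemma pfilt_cat J K L l l' : pfilt J K l -> pfilt K L l' -> pfilt J L (l ++ l').
Proof. by elim=> //= {}J {}K x {}l pr hl IH /IH; right. Qed.
Lemma pfilt_min J l P : pfilt J (topI A) l -> primeI P -> J <=I P -> exists2 Q, In Q l & Q <=I P.
Proof.
move E : (topI A) => T h; elim: h E => [{}J <- [h1 _] JP|{}J {}K x {}l pr hl IH e pP JP].
  by case: h1; apply: JP.
have [Px|nPx] := EM (P x).
  have [|Q Ql QP] := IH e pP; first by apply: addI_min => //; apply: gen1_min.
  by exists Q => //; right.
exists (colI J x); first by left.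
by move=> y; rewrite colP => /JP; case: pP => _ hM /hM[].
Qed.

Lemma pfilt_fin J K l : pfilt J K l -> (forall Q, In Q l -> fin Q) -> fin K -> fin J.
Proof.
elim=> // {}J {}K x {}l pr hl IH h fK; apply: (fin_col (f := x)).
  by apply: IH => // Q hQ; apply: h; right.
by apply: h; left.
Qed.

Lemma col_add_sub J K x : addI (colI J x) K <=I colI (addI J K) x.
Proof.
apply: addI_min; first by apply: col_mono; apply: sub_addl.
by apply: subI_trans (@sub_addr _ J K) _; apply: col_sub.
Qed.

(** (J + I^(n+1)) : x contains (J : x) + I^(n+1) and, by Artin-Rees, lies in (J : x) + I^(n+1-c). *)
Lemma pfun_col J x s : noeth A -> fin (addI J (genI s)) ->
  eqO (size s) (fun n => lam (colI (addI J (expI (genI s) n.+1)) x)) (pfun (colI J x) s).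
Proof.
move=> nA fJ; have [c hc] := artin_rees nA J x s.
have f' : fin (addI (colI J x) (genI s)) by apply: fin_sub fJ; apply: addI_mono => //; apply: col_sub.
have up n : (lam (colI (addI J (expI (genI s) n.+1)) x) <= pfun (colI J x) s n)%N.
  by apply: lam_le; [apply: col_add_sub|apply: fin_expI].
(* For empty s the error term [pw 0] is 0, so equality has to be exact; it is, because I^(n+1) =
   0. *)
have [es|ns] := eqVneq s [::].
  exists 0%N => n; rewrite es /pfun; suff e L : addI L (expI (genI [::]) n.+1) = L by rewrite !e; lia.
  apply: addI_idr; rewrite genI_nil; apply: subI_trans (@zero_sub _ L); apply: prodI_subl.
have [C hC] := pfun_shift c f'; exists (C + pfun (colI J x) s c)%N => n.
split; first exact: leq_trans (up n) (leq_addr _ _).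
have pw1 : (0 < pw (size s) n)%N by case: (s) ns => //= a t _; rewrite expn_gt0.
have [lt|le] := ltnP n c.
  have := pfun_mono f' (ltnW lt); nia.
have [k ek] : exists k, n = (k + c)%N by exists (n - c)%N; lia.
have [h1 _] := hC k; have := hc k.+1; rewrite addSn -ek => h2.
have : (pfun (colI J x) s k <= lam (colI (addI J (expI (genI s) n.+1)) x))%N.
  apply: lam_le => //; apply: fin_sub (fin_expI n.+1 fJ); apply: col_sub.
have : (pw (size s) k <= pw (size s) n)%N by apply: pw_mono; lia.
rewrite ek in h1 *; nia.
Qed.

Lemma pfun_pfilt J l s : noeth A -> fin (addI J (genI s)) -> pfilt J (topI A) l ->
  eqO (size s) (pfun J s) (fun n => \sum_(Q <- l) pfun Q s n)%N.
Proof.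
move=> nA + h; move E : (topI A) h => T h; elim: h E => [{}J <- _|{}J {}T x {}l pr hl IH e fJ].
  exists 0%N => n; rewrite big_nil /pfun (idl_anti (@sub_top _ _) (@sub_addl _ _ _)) lam_top; lia.
have f' : fin (addI (addI J (genI [:: x])) (genI s)).
  by apply: fin_sub fJ; apply: addI_mono => //; apply: sub_addl.
apply: eqO_ext (eqO_add (pfun_col x nA fJ) (IH e f')) => n; last by rewrite big_cons.
rewrite /pfun [RHS](lam_col x (fin_expI n.+1 fJ)) [RHS]addnC; congr (_ + lam _)%N.
by rewrite -!addIA [addI (genI [:: x]) _]addIC.
Qed.

Lemma In_rem P ps : In P ps -> exists ps', [/\ (size ps' < size ps)%N, forall Q, In Q ps' -> In Q ps
  & forall Q, In Q ps -> Q = P \/ In Q ps'].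
Proof.
elim: ps => //= R ps IH [->|/IH[ps' [h1 h2 h3]]].
  by exists ps; split=> //= Q; [right|case=> [<-|]; [left|right]].
exists (R :: ps'); split=> //= Q; first by case=> [->|/h2]; [left|right].
by case=> [<-|/h3[->|]]; [right; left|left|right; right].
Qed.

(** Prime avoidance in a coset of J. A prime contained in another of the list may be dropped.
    Otherwise, if a + u avoids all but P, it is corrected by some v in J and in the other primes but
    not in P. *)
Lemma coset_avoid ps J a : (forall P, In P ps -> primeI P /\ ~ (J <=I P)) ->
  exists2 u, J u & forall P, In P ps -> ~ P (a + u).
Proof.
have [n] := ubnP (size ps); elim: n ps => // n IH [|P ps] /= sz h.
  by exists 0 => //; apply: idl0.
have [pP JP] := h P (or_introl erefl).
have h' Q : In Q ps -> primeI Q /\ ~ (J <=I Q) by move=> hQ; apply: h; right.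
have [[Q [Qps QP]]|nQ] := EM (exists Q, In Q ps /\ Q <=I P).
  have [ps' [sz' s1 s2]] := In_rem Qps.
  have [|Q' /= hQ'|u Ju hu] := IH (P :: ps'); first by move=> /=; lia.
    by case: hQ' => [<-//|/s1/h'].
  exists u => // R [<-|/s2[->|hR]]; [exact: hu _ (or_introl erefl)| |exact: hu _ (or_intror hR)].
  by move/QP; apply: hu _ (or_introl erefl).
have [|u Ju hu] := IH ps _ h'; first by lia.
have [Pu|nPu] := EM (P (a + u)); last by exists u => // R [<-|/hu].
have [v [Jv nPv hv]] : exists v, [/\ J v, ~ P v & forall Q, In Q ps -> Q v].
  have : forall Q, In Q ps -> ~ (Q <=I P) by move=> Q hQ hQP; apply: nQ; exists Q.
  elim: (ps) => [|Q qs IHq] hq; first by have [x Jx nPx] := not_subI JP; exists x.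
  have [|v [Jv nPv hv]] := IHq; first by move=> R hR; apply: hq; right.
  have [w Qw nPw] := not_subI (hq Q (or_introl erefl)).
  exists (v * w); split; first exact: idlMr.
    by case: pP => _ hM /hM[].
  by move=> R [<-|/hv]; [apply: idlM|apply: idlMr].
exists (u + v) => [|R [<-|hR]]; first exact: idlD.
  by rewrite addrA => /(idlDl Pu).
by rewrite addrA addrC => /(idlDl (hv _ hR)); apply: hu.
Qed.

Lemma avoid ps J : (forall P, In P ps -> primeI P /\ ~ (J <=I P)) ->
  exists2 u, J u & forall P, In P ps -> ~ P u.
Proof.
by move=> /(coset_avoid 0)[u Ju hu]; exists u => // P /hu; rewrite add0r.
Qed.

(* [coh_ge P n]: dim A/P >= n. *)
Fixpoint coh_ge P n : Prop :=
  if n is n'.+1 then exists Q, [/\ primeI Q, P <=I Q, Q <> P & coh_ge Q n'] else True.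

Lemma coh_ge_sub P Q n : P <=I Q -> coh_ge Q n -> coh_ge P n.
Proof.
case: n => //= n PQ [R [pR QR nR h]]; exists R; split=> //; first exact: subI_trans QR.
by move=> e; subst R; apply: nR; apply: idl_anti.
Qed.
Lemma coh_ge_le P m n : (m <= n)%N -> coh_ge P n -> coh_ge P m.
Proof.
elim: m n P => [|m IH] [|n] P //= mn [Q [h1 h2 h3 /(IH _ _ mn)]]; by exists Q.
Qed.

(** dim A/J < n. The strict form includes J = A, as the case n = 0 in a local ring. *)
Definition dim_lt J n := forall P, primeI P -> J <=I P -> ~ coh_ge P n.
Lemma dim_lt_eq J n P Q : dim_lt J n.+1 -> primeI P -> J <=I P -> P <=I Q -> primeI Q -> coh_ge Q n -> Q = P.
Proof.
move=> h pP JP PQ pQ hQ; apply: contrapT => nQ; apply: (h P pP JP); by exists Q.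
Qed.
(** A prime of coheight n over J + fA contains, hence equals, a prime of the filtration; that prime
    would have coheight n and contain f. *)
Lemma dim_lt_drop J n l f : dim_lt J n.+1 -> pfilt J (topI A) l ->
  (forall Q, In Q l -> coh_ge Q n -> ~ Q f) -> dim_lt (addI J (genI [:: f])) n.
Proof.
move=> hJ hl hf P pP JP hP.
have JP' : J <=I P by apply: subI_trans JP; apply: sub_addl.
have [Q Ql QP] := pfilt_min hl pP JP'.
have e : P = Q.
  by apply: dim_lt_eq hJ _ _ QP pP hP; [apply: pfilt_prime hl Ql|apply: pfilt_le hl Ql].
by apply: (hf Q Ql); rewrite -e //; apply/JP/add_gen1.
Qed.
End Primes.

Definition locl (A : comNzRingType) (m : idl A) :=
  ~ m 1 /\ forall x, ~ m x -> exists y, x * y = 1.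

(** * Local rings: Nakayama, Krull's intersection theorem, dimension and growth *)

Section Local.
Variables (A : comNzRingType) (m : idl A).
Hypothesis (nA : noeth A) (lA : locl m).
Implicit Types (J K L P Q : idl A) (x y z : A) (s t : seq A) (l ps : seq (idl A)).

Lemma locl_max J : ~ J 1 -> J <=I m.
Proof.
move=> nJ x Jx; apply: contrapT => /lA.2[y xy]; apply: nJ; rewrite -xy; exact: idlMr.
Qed.
Lemma m_unit x : m x -> exists y, (1 - x) * y = 1.
Proof.
move=> mx; apply: lA.2 => h; apply: lA.1; rewrite -[1](subrK x); exact: idlD.
Qed.
Lemma m_prime : primeI m.
Proof.
split; first exact: lA.1.
move=> x y mxy; apply: contrapT => /not_orP[/lA.2[x' ex] /lA.2[y' ey]].
apply: lA.1; rewrite -[1]mulr1 -{1}ex -ey mulrACA; exact: idlMr.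
Qed.
Lemma prime_sub_m P : primeI P -> P <=I m.
Proof. by case=> h _; apply: locl_max. Qed.
Lemma coh_m : ~ coh_ge m 1.
Proof.
move=> [Q [pQ mQ nQ _]]; apply: nQ; apply: idl_anti => //; exact: prime_sub_m.
Qed.
Lemma dim_lt1 J : dim_lt J 1 -> forall P, primeI P -> J <=I P -> P = m.
Proof.
move=> h P pP JP; apply: contrapT => nP; apply: (h P pP JP); exists m.
by split=> //; [exact: m_prime|exact: prime_sub_m|move=> e; apply: nP].
Qed.
Lemma ilen_m : ilen m (topI A) 1.
Proof.
have nm : topI A <> m by move=> e; apply: lA.1; rewrite -e.
split; first by exists (topI A); split.
case=> [|[|n]] // [K [mK nK [L [KL nL _]]]].
have [K1|nK1] := EM (K 1).
  by case: nL; apply: idl_anti => //; move/topP: K1 => ->.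
by case: nK; apply: idl_anti => //; apply: locl_max.
Qed.
Lemma fin_m : fin m. Proof. exact: ilen_fin ilen_m. Qed.
Lemma lam_m : lam m = 1%N. Proof. exact: lamE ilen_m. Qed.

Lemma nakayama J K : J <=I addI K (prodI m J) -> J <=I K.
Proof.
move=> h; have [s es] := nA J.
suff : forall t s, genI (s ++ t) <=I addI K (prodI m (genI (s ++ t))) ->
    genI t <=I K -> genI (s ++ t) <=I K.
  move/(_ [::] s); rewrite cats0 -es; apply=> //; rewrite genI_nil; exact: zero_sub.
move=> {h es} t {}s; elim: s => [|x s IH] //= h htK.
set G := genI (s ++ t) in IH *.
have Kx : addI K G x.
  have : addI K (prodI m (genI (x :: s ++ t))) x by apply/h/mem_genI; rewrite mem_head.
  rewrite genI_cons -/G prodID => -[k [_ [Kk [a [b [ha hb ->]] ex]]]].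
  have {ha}[c mc ea] : exists2 c, m c & a = c * x.
    move: ha; rewrite prodIC prod_gen1 => -[c mc ->]; exists c => //; exact: mulrC.
  have [y hy] := m_unit mc.
  have h1 : (1 - c) * x = k + b by rewrite mulrBl mul1r {1}ex ea; ring.
  have -> : x = y * (k + b) by rewrite -h1 mulrA [y * _]mulrC hy mul1r.
  by apply: idlM; exists k, b; split=> //; apply: prodI_subr hb.
have hs : G <=I addI K (prodI m G).
  have sub : genI (x :: s ++ t) <=I addI K G.
    by rewrite genI_cons; apply: addI_min; [apply: gen1_min|apply: sub_addr].
  apply: subI_trans (_ : G <=I genI (x :: s ++ t)) _; first by rewrite genI_cons; apply: sub_addr.
  apply: subI_trans h _; apply: addI_min; first exact: sub_addl.
  apply: subI_trans (prodI_mono (subI_refl (P := m)) sub) _; rewrite prodID.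
  by apply: addI_mono => //; apply: prodI_subr.
have GK := IH hs htK; rewrite genI_cons; apply: addI_min => //; apply: gen1_min.
by rewrite (addI_idr GK) in Kx.
Qed.

(** Artin-Rees for J = P + mx gives 1 in (J : x) + m. So (J : x) contains a unit, x lies in P + mx,
    and 1 - c' is invertible for c' in m. *)
Lemma krull P x : (forall n, addI P (expI m n) x) -> P x.
Proof.
move=> h; have [s es] := nA m.
have [c hc] := artin_rees nA (addI P (prodI m (genI [:: x]))) x s.
have : colI (addI (addI P (prodI m (genI [:: x]))) (expI (genI s) (1 + c))) x 1.
  rewrite colP mulr1 -es; have [p [u [Pp mu ->]]] := h (1 + c)%N.
  apply: idlD; last exact: sub_addr.
  by do 2 apply: sub_addl.
move/hc => [a [b [ha hb e]]].
have mb : m b by move: hb; rewrite -es expI1.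
have /lA.2[a' ea] : ~ m a.
  by move=> ma; apply: lA.1; rewrite e; apply: idlD.
move: ha; rewrite colP => ha.
have := idlMr a' ha; rewrite -mulrA ea mulr1.
case=> p [q [Pp hq ex]]; move: hq; rewrite prodIC prod_gen1 => -[c' mc e'].
have [y hy] := m_unit mc.
have h1 : (1 - c') * x = p by rewrite mulrBl mul1r {1}ex e'; ring.
have -> : x = y * p by rewrite -h1 mulrA [y * _]mulrC hy mul1r.
exact: idlM.
Qed.

(** If J + m^n decreased strictly forever, its colength would exceed that of J. Where it stops,
    Nakayama applies. *)
Lemma fin_pow_ex J : fin J -> exists n, expI m n <=I J.
Proof.
move=> fJ.
have fn n : fin (addI J (expI m n)) by apply: fin_sub fJ; apply: sub_addl.
have [n hn] : exists n, addI J (expI m n.+1) = addI J (expI m n).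
  apply: contrapT => hne.
  have lt n : (lam (addI J (expI m n)) < lam (addI J (expI m n.+1)))%N.
    apply: lam_lt => //; first by apply: addI_mono => //; apply: expI_le.
    by move=> e; apply: hne; exists n.
  have le n : (n <= lam (addI J (expI m n)))%N by elim: n => // n IH; apply: leq_ltn_trans (lt n).
  have := le (lam J).+1; have := lam_le (@sub_addl _ J (expI m (lam J).+1)) fJ; lia.
exists n; apply: nakayama; have := @sub_addr _ J (expI m n); by rewrite -hn.
Qed.

Lemma fin_prime P : primeI P -> fin P -> P = m.
Proof.
move=> pP /fin_pow_ex[n hn]; apply: idl_anti; first exact: prime_sub_m.
by move=> x mx; apply: (primeX (n := n) pP); apply/hn/expI_mem.
Qed.

Lemma fin_dim J : fin J <-> dim_lt J 1.
Proof.
split=> [fJ P pP JP hP|h].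
  by apply: coh_m; rewrite -(fin_prime pP (fin_sub JP fJ)).
have [l hl] := pfilt_ex nA (@sub_top _ J).
apply: (pfilt_fin hl) (@fin_top A) => Q hQ.
rewrite (dim_lt1 h (pfilt_prime hl hQ) (pfilt_le hl hQ)); exact: fin_m.
Qed.

Lemma fin_primes J : (forall P, primeI P -> J <=I P -> P = m) -> fin J.
Proof.
move=> h; apply/fin_dim => P pP JP hP; apply: coh_m; by rewrite -(h P pP JP).
Qed.

Lemma dim_lt0 J : dim_lt J 0 -> J = topI A.
Proof.
move=> h; apply/topP; apply: contrapT => /locl_max Jm; exact: (h m m_prime Jm).
Qed.

Lemma dim_lt_step J n : dim_lt J n.+2 -> exists f, m f /\ dim_lt (addI J (genI [:: f])) n.+1.
Proof.
move=> hJ; have [l hl] := pfilt_ex nA (@sub_top _ J).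
pose ps := List.filter (fun Q => `[< coh_ge Q n.+1 >]) l.
have psP Q : In Q ps <-> In Q l /\ coh_ge Q n.+1.
  by rewrite /ps; split=> [/List.filter_In[h /asboolP]//|[h1 h2]]; apply/List.filter_In; split=> //; apply/asboolP.
have [Q /psP[hQ cQ]|f mf hf] := @avoid _ ps m.
  split; first exact: pfilt_prime hl hQ.
  move=> mQ; apply: coh_m; rewrite (_ : m = Q); last first.
    by apply: idl_anti => //; apply: prime_sub_m; apply: pfilt_prime hl hQ.
  exact: coh_ge_le cQ.
exists f; split=> //; apply: dim_lt_drop hJ hl _ => Q hQ cQ; apply: hf; exact/psP.
Qed.

Lemma params J h : dim_lt J h.+1 -> exists s, [/\ size s = h, forall x, x \in s -> m x
  & fin (addI J (genI s))].
Proof.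
elim: h J => [|h IH] J hJ.
  exists [::]; split=> //; rewrite genI_nil addI_idr; last exact: zero_sub.
  by apply/fin_dim.
have [f [mf hf]] := dim_lt_step hJ; have [s [ss ms fs]] := IH _ hf.
exists (f :: s); split=> /=; [by rewrite ss|by move=> x; rewrite inE => /predU1P[->|/ms]|].
by rewrite genI_cons addIA.
Qed.

Lemma expI_addI_sub J K n : expI (addI J K) n <=I addI J (expI K n).
Proof.
case: n => [|n]; first by move=> x _; apply: sub_addr.
rewrite expI_addS; apply: addI_mono => //; exact: prodI_subl.
Qed.

(** Compare with d - 1 parameters t: a power of (t) lies in J + (s), so (t)^((a+1)(n+1)) lies in J +
    (s)^(n+1), and the function of t grows with degree at most d - 1. *)
Lemma pfun_small J d s : dim_lt J d -> fin (addI J (genI s)) -> eqO d (pfun J s) (fun=> 0%N).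
Proof.
case: d => [|d] hJ fJ.
  by exists 0%N => n; rewrite /pfun (dim_lt0 hJ) addI_idr // lam_top.
have [t [st mt ft]] := params hJ.
have [a ha] := fin_pow_ex fJ; have [C hC] := pfun_bound ft.
have mt' : genI t <=I m by apply: genI_min.
exists (C * a.+1 ^ d.+1)%N => n; split=> //; rewrite add0n.
have sub : addI J (expI (genI t) (a.+1 * n.+1)) <=I addI J (expI (genI s) n.+1).
  apply: addI_min; first exact: sub_addl.
  apply: (subI_trans _ (@expI_addI_sub J (genI s) n.+1)).
  rewrite -expI_expI; apply: expI_mono; apply: (subI_trans _ ha).
  by apply: (subI_trans (expI_le (leqnSn a))); apply: expI_mono.
apply: (@leq_trans (pfun J t (n + a * n.+1))).
  have -> : pfun J t (n + a * n.+1) = lam (addI J (expI (genI t) (a.+1 * n.+1))).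
    by rewrite /pfun mulSn addSn.
  exact: lam_le (fin_expI _ ft).
have [h _] := hC (n + a * n.+1)%N; rewrite st add0n in h; apply: leq_trans h _.
rewrite -mulnA leq_mul2l; apply/orP; right; rewrite /pw.
have e : (n + a * n.+1).+1 = (a.+1 * n.+1)%N by lia.
rewrite e expnMn leq_mul2r; apply/orP; right; apply: leq_pexp2l; lia.
Qed.

Lemma pow_diff d n c : (n ^ d.+1 <= (n - c) ^ d.+1 + d.+1 * c * n ^ d)%N.
Proof.
elim: d => [|d IH]; first by rewrite !expn1 expn0; lia.
set a := (n - c)%N in IH *.
have h1 : (n * n ^ d.+1 <= (a + c) * n ^ d.+1)%N by rewrite leq_mul2r /a; apply/orP; right; lia.
have h2 : (a * n ^ d.+1 <= a * (a ^ d.+1 + d.+1 * c * n ^ d))%N by rewrite leq_mul2l IH orbT.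
have h3 : (a * n ^ d <= n ^ d.+1)%N by rewrite expnS leq_mul2r leq_subr orbT.
rewrite expnS [(a ^ d.+2)%N]expnS; nia.
Qed.

(** For f in Q but not in P, Artin-Rees with (P : f) = P yields [pfun P s n] >= [pfun Q s n] +
    [pfun P s (n - c)], and summing this recursion raises the degree of growth by one. *)
Lemma pfun_large P d s : primeI P -> coh_ge P d -> (forall x, x \in s -> m x) ->
  fin (addI P (genI s)) -> exists C : nat, forall n, (n ^ d <= C * pfun P s n)%N.
Proof.
move=> + + ms; elim: d P => [|d IH] P pP.
  move=> _ fP; exists 1%N => n; rewrite expn0 mul1n; apply: lam_gt0; first exact: fin_expI.
  move=> h; apply: lA.1; move: h; apply: addI_min; first exact: prime_sub_m.
  by apply: subI_trans (expI_sub (ltn0Sn n)) _; apply: genI_min.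
move=> [Q [pQ PQ nQ cQ]] fP.
have [C hC] := IH Q pQ cQ (fin_sub (addI_mono PQ (subI_refl (P := _))) fP).
have [f Qf nPf] : exists2 f, Q f & ~ P f.
  by apply: not_subI => QP; apply: nQ; apply: idl_anti.
have [c hc] := artin_rees nA P f s; rewrite (prime_col pP nPf) in hc.
have rec n : (c <= n)%N -> (pfun Q s n + pfun P s (n - c) <= pfun P s n)%N.
  move=> cn; rewrite [X in (_ <= X)%N]/pfun (lam_col f (fin_expI n.+1 fP)).
  have fc := fin_sub (@col_sub _ _ f) (fin_expI n.+1 fP).
  apply: leq_add; apply: lam_le.
  - apply: addI_min; last by apply: gen1_min; apply: sub_addl.
    by apply: addI_mono.
  - by apply: fin_sub (fin_expI n.+1 fP); apply: sub_addl.
  - by have := hc (n - c).+1; rewrite addSn subnK.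
  - exact: fc.
have mono n : (pfun Q s n <= pfun P s n)%N.
  by apply: lam_le; [apply: addI_mono|apply: fin_expI].
(* The factor (d+1)(c+1) is that of [pow_diff] for the step c + 1, which is taken instead of c so
   that the recursion descends even if c = 0. *)
exists (d.+1 * c.+1 * C)%N; elim/ltn_ind => n IHn.
have [lt|le] := ltnP n c.+1.
  rewrite expnS; apply: (@leq_trans (c.+1 * (C * pfun P s n))%N); last by nia.
  apply: leq_mul; first exact: ltnW.
  by apply: leq_trans (hC n) _; rewrite leq_mul2l mono orbT.
have mn : (pfun P s (n - c.+1) <= pfun P s (n - c))%N by apply: pfun_mono => //; lia.
have h1 := pow_diff d n c.+1; have h2 := IHn (n - c.+1)%N (ltac:(lia)).
have h3 := rec n (ltnW le); have h4 := hC n.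
have h5 : (d.+1 * c.+1 * n ^ d <= d.+1 * c.+1 * (C * pfun Q s n))%N by rewrite leq_mul2l h4 orbT.
apply: (leq_trans h1); apply: (leq_trans (leq_add h2 h5)).
rewrite [X in (_ + X <= _)%N]mulnA -mulnDr leq_mul2l; apply/orP; right; lia.
Qed.

Lemma not_large_small P d s : (exists C : nat, forall n, (n ^ d <= C * pfun P s n)%N) ->
  ~ eqO d (pfun P s) (fun=> 0%N).
Proof.
case: d => [|d] [C hC] [D hD].
  by have := hC 0%N; have := hD 0%N; rewrite /= expn0; nia.
pose n := (C * D * 2 ^ d).+1; have h1 := hC n; have [h2 _] := hD n; move: h2; rewrite add0n /= => h2.
have h3 : (n.+1 ^ d <= 2 ^ d * n ^ d)%N by rewrite -expnMn; apply: leq_expl; rewrite /n; lia.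
have h4 : (0 < n ^ d)%N by rewrite expn_gt0.
have h5 : (n ^ d.+1 <= C * D * 2 ^ d * n ^ d)%N.
  apply: leq_trans h1 _; rewrite -!mulnA leq_mul2l; apply/orP; right.
  by apply: leq_trans h2 _; rewrite leq_mul2l h3 orbT.
by move: h5; rewrite expnS leq_mul2r /n ltnn orbF => /eqP h5; rewrite h5 in h4.
Qed.
End Local.

(** Each increment of S is counted by at most c of the differences. *)
Lemma sum_window (S : nat -> nat) c N : S 0%N = 0%N -> {homo S : m n / (m <= n)%N} ->
  (\sum_(n < N) (S n - S (n - c)) <= c * S N)%N.
Proof.
move=> S0 Sm; elim: c => [|c IH].
  by rewrite big1 // => i _; rewrite subn0 subnn.
rewrite mulSn addnC; apply: (@leq_trans (\sum_(n < N) ((S n - S (n - c)) + (S (n - c) - S (n - c.+1))))%N).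
  by apply: leq_sum => n _; lia.
rewrite big_split; apply: leq_add => //.
case: N {IH} => [|N]; first by rewrite big_ord0.
apply: leq_trans (_ : S (N - c)%N <= _)%N; last by apply: Sm; lia.
elim: N => [|N IH].
  by rewrite big_ord_recr big_ord0 /= !sub0n subnn.
rewrite big_ord_recr /= addnC.
have -> : (N.+1 - c.+1 = N - c)%N by lia.
by apply: leq_trans (leq_add (leqnn _) IH) _; have : (S (N - c) <= S (N.+1 - c))%N by [apply: Sm; lia]; lia.
Qed.

(** * The effect of one more generator on Hilbert-Samuel functions of domains *)

Section RegularStep.
Variable A : comNzRingType.
Hypothesis nA : noeth A.
Implicit Types (J K L P Q X Y W : idl A) (x y z f : A) (s t : seq A) (l ps : seq (idl A)).

Lemma lam_cap X W : fin X -> fin W -> fin (capI X W) ->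
  (lam (capI X W) + lam (addI X W) = lam X + lam W)%N.
Proof.
move=> fX fW; have := @lam_mul A 1 X W fX fW; rewrite mul1I.
have -> : colI W 1 = W by apply: idl_eq => x; rewrite colP mul1r.
exact.
Qed.

(* The kernels [z j] of [f] on the graded ring of I + P have lengths adding up
   to O(N^d), because the cokernel is generated by monomials in [s] alone; by
   Artin-Rees the kernel of [f] on A / (P + I^n) is filtered by boundedly many
   of them. *)
Lemma pfun_regular P f s : primeI P -> ~ P f -> fin (addI P (genI (f :: s))) ->
  eqO (size s).+1 (pfun P (f :: s)) (fun n => \sum_(i < n) pfun (addI P (genI [:: f])) s i)%N.
Proof.
move=> pP nf fP; set I := genI (f :: s) in fP *; set d := size s.
pose X n := addI P (expI I n).
have fX n : fin (X n) by apply: fin_expI.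
have Xm m n : (m <= n)%N -> X n <=I X m.
  by move=> mn; apply: addI_mono => //; apply: expI_le.
have lX m n : (m <= n)%N -> (lam (X m) <= lam (X n))%N.
  by move=> mn; apply: lam_le => //; apply: Xm.
have X0 : lam (X 0%N) = 0%N.
  by rewrite /X /= addIC addI_idr // lam_top.
have IE : I = addI (genI [:: f]) (genI s) by rewrite /I genI_cons.
pose a' n := pfun (addI P (genI [:: f])) s n.
have fa' : fin (addI (addI P (genI [:: f])) (genI s)) by rewrite -addIA -IE.
have Xf n : addI (X n.+1) (genI [:: f]) = addI (addI P (genI [:: f])) (expI (genI s) n.+1).
  rewrite /X IE expI_addS; set F := genI [:: f]; set H := prodI F _; set G := expI _ _.
  have HF : H <=I F by apply: prodI_subl.
  by rewrite -addIA -[addI (addI H G) F]addIA [addI G F]addIC [addI H _]addIA [addI H F]addIC (addI_idr HF) addIA.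
pose c n := lam (colI (X n.+1) f).
have rec n : (lam (X n.+1) = a' n + c n)%N by rewrite (lam_col f (fX _)) Xf.
have cX n : X n <=I colI (X n.+1) f.
  move=> x [p [i [Pp Ii ->]]]; rewrite colP mulrDr; apply: idlD; first exact/sub_addl/idlM.
  by apply/sub_addr/prodI_mem => //; apply: mem_genI; rewrite mem_head.
have fc n : fin (colI (X n.+1) f) by apply: fin_sub (fX n); apply: cX.
have cle n : (c n <= lam (X n))%N by apply: lam_le.
(* [lam (X i) - c i] is the length of the kernel of f from A/X_i to A/X_(i+1). The total of these
   kernels is the error to be bounded. *)
have sum_a' n : (\sum_(i < n) a' i = lam (X n) + \sum_(i < n) (lam (X i) - c i))%N.
  elim: n => [|n IH]; first by rewrite !big_ord0 X0.
  rewrite !big_ord_recr /= IH rec; set U := (\sum_(i < n) _)%N; have := cle n. lia.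
pose Z j := capI (X j) (colI (X j.+2) f).
have XZ j : X j.+1 <=I Z j by move=> x hx; split; [apply: Xm hx|apply: cX].
pose z j := (lam (X j.+1) - lam (Z j))%N.
have fZ j : fin (Z j) by apply: fin_sub (fX j.+1); apply: XZ.
have Zle j : (lam (Z j) <= lam (X j.+1))%N by apply: lam_le.
pose B := lam (addI P I).
(* Modulo f X_j + X_(j+2), the ideal X_(j+1) is generated by the monomials of degree j + 1 in s
   alone, over A/(P + I). *)
have coker j : (lam (X j) + lam (X j.+2) <= lam (Z j) + lam (X j.+1) + B * pw d j.+1)%N.
  have <- := lam_mul (fX j) (fX j.+2) (fZ j); rewrite -addnA leq_add2l.
  set W := addI (mulI f (X j)) (X j.+2).
  have sub : X j.+1 <=I addI W (genI (monos s j.+1)).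
    rewrite genI_monos {1}/X IE expI_addS -IE prod_gen1; apply: addI_min.
      by apply: subI_trans (@sub_addl _ P (expI I j.+2)) _; apply: subI_trans (@sub_addr _ (mulI f (X j)) _) _; apply: sub_addl.
    apply: addI_min; last exact: sub_addr.
    move=> _ [y Iy ->]; do 2 apply: sub_addl; exists y => //; exact: sub_addr.
  have [||fW le] := @fin_gens _ W (addI P I) (monos s j.+1) fP.
  - move=> y x /mem_genI; rewrite genI_monos => sy [p [i [Pp Ii ->]]].
    apply: sub_addr; rewrite mulrDr; apply: idlD; first exact/sub_addl/idlM.
    apply: sub_addr; rewrite mulrC; apply: prodI_mem => //.
    by apply: (@expI_mono _ (genI s)) sy; rewrite IE; apply: sub_addr.
  - exact: fin_sub (fX j.+1).
  apply: leq_trans le _; apply: leq_add; first exact: lam_le (fX _).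
  by rewrite leq_mul2l size_monos orbT.
pose S n := (\sum_(j < n) z j)%N.
have S0 : S 0%N = 0%N by rewrite /S big_ord0.
have SS n : S n.+1 = (S n + z n)%N by rewrite /S big_ord_recr.
have Sm : {homo S : m n / (m <= n)%N}.
  move=> m n /subnK <-; elim: (n - m)%N => // k IH; rewrite addSn SS; lia.
have Sb n : (S n + lam (X n.+1) <= lam (X n) + lam (X 1%N) + B * \sum_(j < n) pw d j.+1)%N.
  elim: n => [|n IH]; first by rewrite S0 X0 big_ord0; lia.
  rewrite SS big_ord_recr /= mulnDr; set U := (\sum_(j < n) _)%N in IH *; have := coker n; have := Zle n; rewrite /z; lia.
have [e he] := artin_rees nA P f (f :: s); rewrite (prime_col pP nf) -/I in he.
(* By Artin-Rees the kernel of f from A/X_n to A/X_(n+1) lies in X_(n-e). Filtering it by the X_j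
   with n - e <= j < n, each graded piece embeds into the kernel measured by [z j]. *)
have win n : (lam (X n) - c n <= S n - S (n - e))%N.
  pose Y j := capI (colI (X n.+1) f) (X j).
  have XY j : (j <= n)%N -> X n <=I Y j by move=> jn x hx; split; [apply: cX|apply: Xm hx].
  have fY j : (j <= n)%N -> fin (Y j) by move=> jn; apply: fin_sub (fX n); apply: XY.
  have step k : (k <= n)%N -> (lam (X n) <= lam (Y (n - k)) + (S n - S (n - k)))%N.
    elim: k => [_|k IH kn].
      rewrite subn0 subnn addn0; apply: lam_le; [by move=> x []|exact: fY].
    have := IH (ltnW kn); pose j := (n - k.+1)%N.
    have -> : (n - k)%N = j.+1 by rewrite /j; lia.
    rewrite -/j SS; have jn : (j.+1 <= n)%N by rewrite /j; lia.
    have Yj : capI (Y j) (X j.+1) = Y j.+1.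
      apply: idl_eq => x; split=> [[[h1 _] h2]|[h1 h2]]; first by split.
      by split=> //; split=> //; apply: Xm h2.
    have := lam_cap (fY j (ltnW jn)) (fX j.+1); rewrite Yj => /(_ (fY _ jn)).
    have : (lam (Z j) <= lam (addI (Y j) (X j.+1)))%N.
      apply: lam_le; last by apply: fin_sub (fX j.+1); apply: sub_addr.
      apply: addI_min; last exact: XZ.
      by move=> x [h1 h2]; split=> //; apply: col_mono h1; apply: Xm.
    have := Zle j; have := Sm _ _ jn; rewrite SS /z; lia.
  have [le|lt] := leqP e n.
    have := step e le; have : Y (n - e)%N = colI (X n.+1) f.
      apply: idl_eq => x; split=> [[]//|hx]; split=> //.
      apply: (Xm _ (n - e).+1) => //; apply: he; by rewrite addSn subnK.
    by move=> ->; rewrite -/(c n); lia.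
  have := step n (leqnn n); rewrite subnn S0.
  have -> : (n - e = 0)%N by lia.
  have -> : Y 0%N = colI (X n.+1) f.
    apply: idl_eq => x; split=> [[]//|hx]; split=> //; exact: sub_addr.
  by rewrite -/(c n) S0; lia.
have [C hC] := pfun_bound fa'.
exists (C + e * (lam (X 1%N) + B * 2 ^ d.+1))%N => n.
have Sn : (S n <= (lam (X 1%N) + B * 2 ^ d.+1) * pw d.+1 n)%N.
  have h1 := Sb n; have h2 := lX _ _ (leqnSn n).
  have h3 : (\sum_(j < n) pw d j.+1 <= 2 ^ d.+1 * pw d.+1 n)%N.
    apply: (@leq_trans (\sum_(j < n.+1) pw d j)).
      by rewrite big_ord_recl /=; apply: leq_addl.
    by apply: leq_trans (pw_sum d n.+1) _; have := pw_shift d.+1 1 n; rewrite addn1.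
  have h4 : (0 < pw d.+1 n)%N by rewrite /= expn_gt0.
  rewrite mulnDl -mulnA; nia.
have sw := sum_window e n S0 Sm.
have sl : (\sum_(i < n) (lam (X i) - c i) <= e * S n)%N.
  by apply: leq_trans sw; apply: leq_sum => i _; apply: win.
have [hCn _] := hC n; rewrite add0n -/d in hCn.
have e1 : pfun P (f :: s) n = lam (X n.+1) by [].
split.
  rewrite e1 rec -[X in (_ <= X + _)%N]/(\sum_(i < n) a' i)%N sum_a'.
  have : (a' n <= C * pw d.+1 n)%N by [].
  have := cle n; rewrite mulnDl; lia.
rewrite e1 -[X in (X <= _)%N]/(\sum_(i < n) a' i)%N sum_a'.
have := lX _ _ (leqnSn n); rewrite mulnDl -mulnA.
have : (e * S n <= e * ((lam (X 1%N) + B * 2 ^ d.+1) * pw d.+1 n))%N by rewrite leq_mul2l Sn orbT.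
lia.
Qed.

(** An f in P drops out modulo P, and the remaining [size s] generators give growth of degree at
    most [size s], which is negligible here. *)
Lemma pfun_in P f s : P f -> fin (addI P (genI s)) ->
  eqO (size s).+1 (pfun P (f :: s)) (fun=> 0%N).
Proof.
move=> Pf fP; apply: eqO_trans (pfun_bound fP).
apply: eqO_ext (eqO_refl _ (pfun P s)) => // n; rewrite /pfun genI_cons expI_addS addIA.
congr (lam (addI _ _)); rewrite addI_idr // prod_gen1 => _ [y _ ->]; exact: idlMr.
Qed.
End RegularStep.

Lemma sum_bin d n : (\sum_(i < n) 'C(i, d) = 'C(n, d.+1))%N.
Proof.
elim: n => [|n IH]; first by rewrite big_ord0 bin0n.
by rewrite big_ord_recr /= IH binS.
Qed.

(** * Choosing the parameters one at a time *)

Section Induction.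
Variables (A : comNzRingType) (m : idl A).
Hypothesis (nA : noeth A) (lA : locl m).
Implicit Types (J K L P Q R : idl A) (x y z f : A) (fs : seq A) (l s ps : seq (idl A)).

Definition cnt P s := count (fun Q => `[< Q = P >]) s.

Lemma cnt_cat P s s' : cnt P (s ++ s') = (cnt P s + cnt P s')%N.
Proof. exact: count_cat. Qed.
Lemma cnt_notin P s : ~ In P s -> cnt P s = 0%N.
Proof.
elim: s => //= Q s IH /not_orP[nQ /IH ->]; rewrite addn0; by case: asboolP.
Qed.

Lemma separate P s : primeI P -> (forall R, In R s -> R <> P -> ~ (R <=I P)) ->
  exists c, ~ P c /\ forall R, In R s -> R <> P -> R c.
Proof.
move=> [P1 PM]; elim: s => [|R s IH] h; first by exists 1.
have [|c [nc hc]] := IH; first by move=> Q hQ; apply: h; right.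
have [e|nR] := EM (R = P).
  by exists c; split=> // Q [<-//|]; apply: hc.
have [a Ra nPa] := not_subI (h R (or_introl erefl) nR).
exists (a * c); split; first by move/PM => [].
by move=> Q [<- _|hQ nQ]; [apply: idlMr|apply/idlM/hc].
Qed.

Lemma dim_lt_prime_add P n x : primeI P -> ~ coh_ge P n.+1 -> ~ P x ->
  dim_lt (addI P (genI [:: x])) n.
Proof.
move=> pP h nx Q pQ PQ cQ; apply: h; exists Q; split=> //.
  by apply: subI_trans PQ; apply: sub_addl.
by move=> e; apply: nx; rewrite -e; apply/PQ/add_gen1.
Qed.

(** In the domain A/P one has (xy : x) = (y). *)
Lemma lam_mulr P x y : primeI P -> ~ P x -> fin (addI P (genI [:: x * y])) ->
  lam (addI P (genI [:: x * y])) = (lam (addI P (genI [:: x])) + lam (addI P (genI [:: y])))%N.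
Proof.
move=> pP nx fxy; rewrite (lam_col x fxy).
have -> : addI (addI P (genI [:: x * y])) (genI [:: x]) = addI P (genI [:: x]).
  rewrite -addIA; congr addI; rewrite addIC addI_idr //; apply: gen1_min.
  exact/idlMr/mem_gen1.
suff -> : colI (addI P (genI [:: x * y])) x = addI P (genI [:: y]) by [].
apply: idl_eq => z; rewrite colP; split.
  case=> a [b [Pa /genI1P[c eb] e]]; case: pP => _ PM.
  have : P (x * (z - c * y)) by rewrite mulrBr e eb (_ : a + _ - _ = a) //; ring.
  move/PM => [//|h]; rewrite -[z](subrK (c * y)); apply: idlD; first exact: sub_addl.
  by apply/sub_addr/genI1P; exists c.
move=> [a [b [Pa /genI1P[c ->] ->]]]; rewrite mulrDr; apply: idlD; first exact/sub_addl/idlM.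
by apply/sub_addr/genI1P; exists c; rewrite mulrCA.
Qed.

Lemma lam_exp P x n : primeI P -> ~ P x -> (forall k, fin (addI P (genI [:: x ^+ k]))) ->
  lam (addI P (genI [:: x ^+ n])) = (n * lam (addI P (genI [:: x])))%N.
Proof.
move=> pP nx fx; elim: n => [|n IH].
  by rewrite expr0 genI_one addIC addI_idr // lam_top.
by rewrite exprS lam_mulr -?exprS // IH mulSn.
Qed.

Lemma pfilt_lam K l : pfilt K (topI A) l -> (forall Q, In Q l -> Q = m) -> lam K = size l.
Proof.
move E : (topI A) => T h; elim: h E => [{}K <- _|{}K {}T x {}l pr hl IH e h]; first exact: lam_top.
have fK : fin K.
  apply: (pfilt_fin (Pfilt_cons pr hl)); last by rewrite -e; apply: fin_top.
  by move=> Q /h ->; apply: fin_m.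
rewrite (lam_col x fK) IH //; last by move=> Q hQ; apply: h; right.
by rewrite (h (colI K x)) ?(lam_m lA) ?addn1 //; left.
Qed.

Lemma cnt_all P s : (forall Q, In Q s -> Q = P) -> cnt P s = size s.
Proof.
elim: s => //= Q s IH h; rewrite IH => [|R hR]; last by apply: h; right.
by case: asboolP => // -[]; apply: h; left.
Qed.

Variable p : nat.
Hypothesis p_prime : prime.prime p.

(** The sum runs over a list s of primes, repetitions included, instead of being the function of
    A/J, so that multiplicities of single primes can be followed. The number e is the multiplicity,
    since C(n, d) grows like n^d/d!. *)
Definition has_params J s d := exists fs, [/\ size fs = d, forall x, x \in fs -> m x,
  fin (addI J (genI fs)) & exists e, ~~ (p %| e)%N /\
   eqO d (fun n => \sum_(Q <- s) pfun Q fs n)%N (fun n => e * 'C(n, d))%N].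

(** Primes containing f contribute lower order terms and are dropped; for the others a cut turns the
    function into the summatory one, and summing C(i, d) gives C(n, d+1). *)
Lemma params_step J s f d (ch : idl A -> seq (idl A)) :
  m f -> (forall Q, In Q s -> primeI Q /\ J <=I Q) ->
  (forall Q, pfilt (addI Q (genI [:: f])) (topI A) (ch Q)) ->
  has_params (addI J (genI [:: f])) (flatten [seq (if `[< Q f >] then [::] else ch Q) | Q <- s]) d ->
  has_params J s d.+1.
Proof.
move=> mf hs hch [fs [sz mfs fJ [e [pe he]]]]; exists (f :: fs); split.
- by rewrite /= sz.
- by move=> x; rewrite inE => /predU1P[->|/mfs].
- by rewrite genI_cons addIA.
exists e; split=> //.
have fJ' : fin (addI J (genI (f :: fs))) by rewrite genI_cons addIA.
apply: eqO_trans (_ : eqO _ _ (fun n => \sum_(i < n) (e * 'C(i, d)))%N) _; last first.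
  by apply: eqO_ext (eqO_refl _ _) => // n; rewrite -big_distrr sum_bin.
apply: eqO_trans (eqO_sum he); move=> {he}.
elim: s hs => [|Q s IH] hs.
  by apply: eqO_ext (eqO_refl _ (fun=> 0%N)) => n; rewrite ?big_nil ?big1 // => i _; rewrite big_nil.
have {}IH := IH (fun R hR => hs R (or_intror hR)).
have [pQ JQ] := hs Q (or_introl erefl).
have fQ : fin (addI Q (genI (f :: fs))) by apply: fin_sub fJ'; apply: addI_mono.
have key : eqO d.+1 (pfun Q (f :: fs))
    (fun n => \sum_(i < n) \sum_(R <- if `[< Q f >] then [::] else ch Q) pfun R fs i)%N.
  case: asboolP => Qf.
    have fQ' : fin (addI Q (genI fs)) by move: fQ; rewrite genI_cons addIA (addI_idr (gen1_min Qf)).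
    rewrite -sz; apply: (eqO_ext _ _ (pfun_in Qf fQ')) => // n; by rewrite big1 // => i _; rewrite big_nil.
  rewrite -sz; apply: eqO_trans (pfun_regular nA pQ Qf fQ) _; apply: (@eqO_sum _ _ (fun i => \sum_(R <- ch Q) pfun R fs i)%N).
  by apply: pfun_pfilt => //; rewrite -addIA -genI_cons.
apply: eqO_ext (eqO_add key IH) => n; first by rewrite big_cons.
by rewrite -big_split; apply: eq_bigr => i _ /=; rewrite big_cat.
Qed.

(** The last condition says that Q A_Q/P A_Q is generated by f. It makes Q occur exactly once in a
    filtration of A/(P + fA) ending with A/Q. Avoiding c keeps Q out of the filtrations that come
    from other primes. *)
Hypothesis good_prime : forall P c d, primeI P -> ~ P c -> coh_ge P d.+2 -> ~ coh_ge P d.+3 ->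
  exists Q f t, [/\ primeI Q /\ P <=I Q, Q f /\ ~ P f, ~ Q t /\ ~ Q c, coh_ge Q d.+1
    & forall b, Q b -> addI P (genI [:: f]) (t * b)].

Hypothesis one_dim : forall P, primeI P -> coh_ge P 1 -> ~ coh_ge P 2 ->
  exists h, ~ P h /\ ~~ (p %| lam (addI P (genI [:: h])))%N.

Lemma pfilt_top Q : primeI Q -> pfilt Q (topI A) [:: Q].
Proof.
move=> pQ; have e : colI Q 1 = Q by apply: idl_eq => x; rewrite colP mul1r.
have := @Pfilt_cons A Q (topI A) 1 [::]; rewrite e genI_one addIC addI_idr //.
by apply=> //; left.
Qed.

Lemma cntP P s : ~~ (p %| cnt P s)%N -> In P s.
Proof. by move=> h; apply: contrapT => /cnt_notin e; rewrite e dvdn0 in h. Qed.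

Lemma params_ind d J s P : (forall Q, In Q s -> primeI Q /\ J <=I Q) ->
  dim_lt J d.+1 -> coh_ge P d -> ~~ (p %| cnt P s)%N -> has_params J s d.
Proof.
elim: d J s P => [|d IH] J s P hs hJ cP pcnt.
  have sm Q : In Q s -> Q = m by move=> /hs[pQ JQ]; apply: dim_lt1 hJ _ pQ JQ.
  have Pm : P = m by apply/sm/cntP.
  exists [::]; split=> //; first by rewrite genI_nil addI_idr; [apply/(fin_dim nA lA)|apply: zero_sub].
  exists (cnt P s); split=> //; rewrite Pm cnt_all //.
  apply: eqO_ext (eqO_refl _ (fun=> size s)) => n; last by rewrite bin0 muln1.
  elim: (s) sm => [|Q s' IHs] sm; first by rewrite big_nil.
  rewrite big_cons -IHs => [|R hR]; last by apply: sm; right.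
  rewrite (sm Q); last by left.
  rewrite /pfun addI_idr ?lam_m //; apply: subI_trans (expI_sub (ltn0Sn n)) _.
  by rewrite genI_nil; apply: zero_sub.
have sP := cntP pcnt; have [pP JP] := hs P sP.
have ncP : ~ coh_ge P d.+2 by apply: hJ.
have [l hl] := pfilt_ex nA (@sub_top _ J).
have [ps psP] : exists ps, forall Q, In Q ps <-> [/\ In Q l, coh_ge Q d.+1 & Q <> P].
  exists (List.filter (fun Q => `[< coh_ge Q d.+1 /\ Q <> P >]) l) => Q.
  split=> [/List.filter_In[h /asboolP[]]//|[h1 h2 h3]].
  by apply/List.filter_In; split=> //; apply/asboolP.
have psQ Q : In Q ps -> [/\ primeI Q, J <=I Q & coh_ge Q d.+1].
  by move/psP=> [h1 h2 h3]; split=> //; [apply: pfilt_prime hl h1|apply: pfilt_le hl h1].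
have top_eq Q R : primeI Q -> J <=I Q -> Q <=I R -> primeI R -> coh_ge R d.+1 -> R = Q.
  by move=> pQ JQ QR pR cR; apply: dim_lt_eq hJ pQ JQ QR pR cR.
case: d IH cP ncP psP psQ top_eq hJ => [|d] IH cP ncP psP psQ top_eq hJ.
  (* The last cut. The list [ps] holds the other primes of top coheight over J, which f must avoid
     for the dimension to drop. *)
  have [c [ncc hc]] : exists c, ~ P c /\ forall R, In R (s ++ ps) -> R <> P -> R c.
    apply: separate => // R hR nR RP; apply: nR; apply/esym/top_eq => //.
      by move: hR => /List.in_app_iff[/hs[]//|/psQ[]].
    by move: hR => /List.in_app_iff[/hs[]//|/psQ[]].
  have fP y : ~ P y -> fin (addI P (genI [:: y])).
    by move=> ny; apply/(fin_dim nA lA)/dim_lt_prime_add.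
  (* Colengths on P add under products, so if p divides that of c, the factor h repairs it. *)
  have [a [nPa ha pa]] : exists a, [/\ ~ P a, forall R, In R (s ++ ps) -> R <> P -> R a
       & ~~ (p %| lam (addI P (genI [:: a])))%N].
    have [pc|] := boolP (p %| lam (addI P (genI [:: c])))%N; last by exists c.
    have [h [nh ph]] := one_dim pP cP ncP; have nch : ~ P (c * h) by case: pP => _ PM /PM[].
    exists (c * h); split=> // [R hR nR|]; first exact/idlMr/hc.
    by rewrite lam_mulr ?dvdn_addr // ; apply: fP.
  have ma : m a.
    apply: contrapT => /lA.2[b ab]; move/negP: pa; apply.
    rewrite (_ : addI _ _ = topI A) ?lam_top ?dvdn0 //; apply/topP/sub_addr/genI1P.
    by exists b; rewrite mulrC.
  have [x mx hx] : exists2 x, m x & forall R, In R (P :: ps ++ List.filter (fun Q => `[< coh_ge Q 1 >]) s) -> ~ R x.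
    apply: avoid => R hR; suff [pR cR] : primeI R /\ coh_ge R 1.
      split=> // mR; apply: (coh_m lA); rewrite (_ : m = R) //; apply: idl_anti => //; exact: prime_sub_m.
    case: hR => [<-//|/List.in_app_iff[/psQ[]//|/List.filter_In[/hs[? _] /asboolP]]] //.
  have [k hk] := fin_pow_ex nA lA (fP a nPa).
  (* The factor p makes colengths of x^N divisible by p. Since N > k and m^k lies in P + aA, x^N is
     in a m modulo P, and so x^N + a is a times a unit there. *)
  pose N := (p * k.+1)%N.
  have [u [_ [Pu [v mv ->] exN]]] : exists u w, [/\ P u, exists2 v, m v & w = a * v & x ^+ N = u + w].
    have : expI m k.+1 (x ^+ N).
      by apply: expI_le (expI_mem N mx); rewrite /N leq_pmull // prime_gt0.
    move/(prodI_mono (subI_refl (P := m)) hk); rewrite prodID => -[u [w [hu hw e]]].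
    exists u, w; split=> //; first exact: prodI_subr hu.
    by move: hw; rewrite prodIC prod_gen1.
  pose f := x ^+ N + a.
  have ef : f = u + a * (1 + v) by rewrite /f exN mulrDr mulr1 -addrA [a * v + a]addrC.
  have [w hw] : exists w, (1 + v) * w = 1.
    by have [w hw] := m_unit lA (idlN mv); exists w; rewrite opprK in hw.
  have Paf : addI P (genI [:: f]) = addI P (genI [:: a]).
    apply: idl_anti; apply: addI_min; try exact: sub_addl; apply: gen1_min.
      rewrite ef; apply: idlD; [exact: sub_addl|exact/sub_addr/idlMr/mem_gen1].
    have -> : a = w * (f - u) by rewrite ef addrC addKr mulrCA [w * _]mulrC hw mulr1.
    by apply/idlM/idlB; [apply: add_gen1|apply: sub_addl].
  have nPf : ~ P f.
    move=> Pf; apply: nPa; have -> : a = w * (f - u) by rewrite ef addrC addKr mulrCA [w * _]mulrC hw mulr1.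
    by apply/idlM/idlB.
  have mf : m f.
    apply: idlD => //; apply: expI_sub (expI_mem N mx); by rewrite /N muln_gt0 prime_gt0.
  have dJf : dim_lt (addI J (genI [:: f])) 1.
    apply: (dim_lt_drop hJ hl) => Q hQ cQ.
    have [->//|nQ] := EM (Q = P); have Qps : In Q ps by apply/psP.
    have Qa : Q a by apply: ha => //; apply/List.in_app_iff; right.
    rewrite /f addrC => /(idlDl Qa) /(primeX (pfilt_prime hl hQ)); apply: hx.
    by right; apply/List.in_app_iff; left.
  have [ch hch] := choice (fun Q => pfilt_ex nA (@sub_top _ (addI Q (genI [:: f])))).
  apply: (params_step mf hs hch); apply: (IH _ _ m) => //.
    move=> Q; elim: (s) hs => //= R s' IHs hs' /List.in_app_iff[|hQ]; last first.
      by apply: IHs => // T hT; apply: hs'; right.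
    case: asboolP => // _ hQ; have [_ JR] := hs' R (or_introl erefl).
    split; first exact: pfilt_prime (hch R) hQ.
    by apply: subI_trans (pfilt_le (hch R) hQ); apply: addI_mono.
  have cR R : In R s -> ~ R f -> cnt m (ch R) = lam (addI R (genI [:: f])).
    move=> hR nRf; have [pR JR] := hs R hR.
    have all_m Q : In Q (ch R) -> Q = m.
      move=> hQ; apply: dim_lt1 dJf _ _ _ => //; first exact: pfilt_prime (hch R) hQ.
      by apply: subI_trans (pfilt_le (hch R) hQ); apply: addI_mono.
    by rewrite cnt_all // (pfilt_lam (hch R)).
  (* P contributes the colength of a once per occurrence. Any other R contains a, so f acts on it as
     x^N and contributes N times the colength of x. *)
  have mod_p : exists q, cnt m (flatten [seq (if `[< Q f >] then [::] else ch Q) | Q <- s]) =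
      (cnt P s * lam (addI P (genI [:: a])) + q * p)%N.
    have : forall R, In R s -> In R s by [].
    elim: {1 3 4}s => [|R s' IHs] sub /=; first by exists 0%N.
    have [|q hq] := IHs; first by move=> T hT; apply: sub; right.
    have sR := sub R (or_introl erefl); rewrite cnt_cat hq; case: (asboolP (R = P)) => [eR|nR].
      rewrite eR; case: asboolP => // _; exists q; rewrite cR // Paf mulnDl mul1n addnA //.
    rewrite add0n; case: asboolP => Rf; first by exists q.
    have [pR JR] := hs R sR; have Ra : R a by apply: ha => //; apply/List.in_app_iff; left.
    have nRx : ~ R x by move=> Rx; apply: Rf; apply: idlD => //; rewrite /N -[p]prednK ?prime_gt0 // mulSn addSn exprS; apply: idlMr.
    have eRf : addI R (genI [:: f]) = addI R (genI [:: x ^+ N]).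
      apply: idl_anti; apply: addI_min; try exact: sub_addl; apply: gen1_min.
        by apply: idlD; [apply: add_gen1|apply: sub_addl].
      have -> : x ^+ N = f - a by rewrite /f addrK.
      by apply: idlB; [apply: add_gen1|apply: sub_addl].
    have ncR : ~ coh_ge R 2 by apply: hJ.
    exists (q + k.+1 * lam (addI R (genI [:: x])))%N.
    rewrite cR // eRf lam_exp //; last first.
      move=> i; apply/(fin_dim nA lA)/dim_lt_prime_add => // /(primeX pR); exact: nRx.
    rewrite /N; lia.
  have [q ->] := mod_p; rewrite (dvdn_addl _ (dvdn_mull q (dvdnn p))) Euclid_dvdM // negb_or pcnt pa //.
have [c [ncc hc]] : exists c, ~ P c /\ forall R, In R s -> R <> P -> R c.
  apply: separate => // R hR nR RP; apply: nR; apply/esym/top_eq => //; by case: (hs R hR).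
have [Q [f [t [[pQ PQ] [Qf nPf] [nQt nQc] cQ ht]]]] := good_prime pP ncc cP ncP.
(* Adding u from P changes nothing modulo P, but moves f off the other primes of top coheight. *)
have [R hR|u Pu hu] := @coset_avoid _ ps P f.
  have [pR JR cR] := psQ R hR; split=> // PR.
  by have [_ _ []] := (psP R).1 hR; apply: top_eq.
pose f' := f + u.
have Pf : addI P (genI [:: f']) = addI P (genI [:: f]).
  apply: idl_anti; apply: addI_min; try exact: sub_addl; apply: gen1_min.
    by apply: idlD; [apply: add_gen1|apply: sub_addl].
  have -> : f = f' - u by rewrite /f' addrK.
  by apply: idlB; [apply: add_gen1|apply: sub_addl].
have Qf' : Q f' by apply: idlD => //; apply: PQ.
have nPf' : ~ P f' by move=> h; apply: nPf; apply: (idlDl Pu); rewrite addrC.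
have dJf : dim_lt (addI J (genI [:: f'])) d.+2.
  apply: (dim_lt_drop hJ hl) => R hR cR.
  have [->//|nR] := EM (R = P); apply: hu; exact/psP.
have [l1 hl1] : exists l1, pfilt (addI P (genI [:: f'])) Q l1.
  by apply: pfilt_ex => //; apply: addI_min => //; apply: gen1_min.
have hP : pfilt (addI P (genI [:: f'])) (topI A) (l1 ++ [:: Q]).
  by apply: pfilt_cat hl1 (pfilt_top pQ).
(* t kills Q/(P + f'A), hence lies in all primes of [l1], but not in Q. *)
have nQl1 : ~ In Q l1.
  by move=> /(pfilt_col (a := t) hl1) h; apply/nQt/h => y /ht; rewrite Pf.
have : forall R, exists l', pfilt (addI R (genI [:: f'])) (topI A) l' /\ (R = P -> l' = l1 ++ [:: Q]).
  move=> R; have [->|nR] := EM (R = P); first by exists (l1 ++ [:: Q]).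
  by have [l' hl'] := pfilt_ex nA (@sub_top _ (addI R (genI [:: f']))); exists l'.
move=> /choice[ch hch].
apply: (params_step (f := f') (ch := ch)) => //; first exact: prime_sub_m lA _ pQ _ Qf'.
  by move=> R; case: (hch R).
apply: (IH _ _ Q) => //.
  move=> Q'; elim: (s) hs => //= R s' IHs hs' /List.in_app_iff[|hQ]; last first.
    by apply: IHs => // T hT; apply: hs'; right.
  case: asboolP => // _ hQ; have [_ JR] := hs' R (or_introl erefl).
  split; first exact: pfilt_prime (hch R).1 hQ.
  by apply: subI_trans (pfilt_le (hch R).1 hQ); apply: addI_mono.
(* Every occurrence of P yields Q once, and every other R contains c, which is not in Q. *)
suff -> : cnt Q (flatten [seq (if `[< R f' >] then [::] else ch R) | R <- s]) = cnt P s by [].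
elim: (s) hc => //= R s' IHs hc'; rewrite cnt_cat IHs; last by move=> T hT; apply: hc'; right.
congr (_ + _)%N; case: (asboolP (R = P)) => [->|nR].
  case: asboolP => // _; rewrite (hch P).2 // cnt_cat (cnt_notin nQl1) /= addn0.
  by case: asboolP.
case: asboolP => // _; apply: cnt_notin => hQ; apply: nQc.
apply: (pfilt_le (hch R).1 hQ); apply: sub_addl; apply: hc' => //; by left.
Qed.
End Induction.

(** Cauchy sequences with a prescribed rate, so that the limit comes with the same rate. *)
Definition cmpl (A : comNzRingType) (m : idl A) :=
  (forall x, (forall n, expI m n x) -> x = 0) /\
  (forall u : nat -> A, (forall n, expI m n (u n.+1 - u n)) ->
     exists l, forall n, expI m n (l - u n)).

(** Algebraic closedness of A/m, expressed by polynomials over A itself. *)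
Definition kclosed (A : comNzRingType) (m : idl A) :=
  forall g : {poly A}, g \is monic -> (1 < size g)%N -> exists a, m g.[a].

(** Zorn's lemma for predicates, with unions as upper bounds; [V0] bounds the empty chain. *)
Lemma zorn_pred (T : Type) (P : (T -> Prop) -> Prop) V0 : P V0 ->
  (forall C : (T -> Prop) -> Prop, (exists V, C V) -> (forall V, C V -> P V) ->
     (forall V W, C V -> C W -> V <=I W \/ W <=I V) -> P (fun z => exists2 V, C V & V z)) ->
  exists V, P V /\ forall W, P W -> V <=I W -> W <=I V.
Proof.
move=> PV0 chain; pose U := {V | P V}; pose R (V W : U) := `[< sval V <=I sval W >].
have ext (V W : U) : R V W -> R W V -> V = W.
  case: V W => [V hV] [W hW] /asboolP h1 /asboolP h2; have e : V = W.
    by apply/funext => z; apply/propext; split; [apply: h1|apply: h2].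
  by subst W; congr exist; apply: Prop_irrelevance.
have [||//|C totC|V maxV] := @Zorn U R.
- by move=> V; apply/asboolP.
- by move=> V W X /asboolP h1 /asboolP h2; apply/asboolP => z /h1 /h2.
- have [[V1 CV1]|nC] := EM (exists V, C V); last first.
    by exists (exist _ _ PV0) => s Cs; case: nC; exists s.
  have ok : P (fun z => exists2 V, (exists2 s, C s & sval s = V) & V z).
    apply: chain; first by exists (sval V1), V1.
      by move=> _ [s _ <-]; apply: svalP.
    by move=> _ _ [s Cs <-] [t Ct <-]; case: (totC _ _ Cs Ct) => /asboolP; [left|right].
  by exists (exist _ _ ok) => s Cs; apply/asboolP => z sz; exists (sval s) => //; exists s.
exists (sval V); split; first exact: svalP.
move=> W hW VW; have /maxV e : R V (exist _ W hW) by apply/asboolP.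
by rewrite -[W]/(sval (exist P W hW)) e.
Qed.

(** * Complete one-dimensional domains *)

Section ValuationRing.
Variables (B : idomainType) (K : fieldType) (f : {rmorphism B -> K}) (x : B).
Hypotheses (f_inj : injective f) (x0 : x != 0) (nux : forall y, x * y <> 1)
  (f_frac : forall z, exists a b, b != 0 /\ z = f a / f b).

Definition Bring (V : K -> Prop) :=
  [/\ forall b, V (f b), forall y z, V y -> V z -> V (y + z) & forall y z, V y -> V z -> V (y * z)].

Lemma f_eq0 b : (f b == 0) = (b == 0).
Proof. by apply/eqP/eqP => [|->]; rewrite ?rmorph0 // => h; apply: f_inj; rewrite rmorph0. Qed.
Lemma fx0 : f x != 0. Proof. by rewrite f_eq0. Qed.

(** A subring maximal among those without 1/x is a valuation ring, by [V_val], in which x stays a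
    nonunit. *)
Lemma max_ring : exists V, [/\ Bring V, ~ V (f x)^-1
  & forall W, Bring W -> ~ W (f x)^-1 -> V <=I W -> W <=I V].
Proof.
have [||V [[h1 h2] hV]] := @zorn_pred K (fun V => Bring V /\ ~ V (f x)^-1) (fun z => exists b, z = f b).
- split; first split.
  + by move=> b; exists b.
  + by move=> _ _ [a ->] [b ->]; exists (a + b); rewrite rmorphD.
  + by move=> _ _ [a ->] [b ->]; exists (a * b); rewrite rmorphM.
  + move=> [b eb]; apply: (nux (y := b)); apply: f_inj.
    by rewrite rmorphM -eb divff ?fx0 // rmorph1.
- move=> C [V0 CV0] hC totC; split; first split.
  + by move=> b; exists V0 => //; case: (hC _ CV0) => -[h _ _] _; apply: h.
  + move=> y z [V CV Vy] [W CW Wz]; case: (totC _ _ CV CW) => h.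
      by exists W => //; case: (hC _ CW) => -[_ hD _] _; apply: hD => //; apply: h.
    by exists V => //; case: (hC _ CV) => -[_ hD _] _; apply: hD => //; apply: h.
  + move=> y z [V CV Vy] [W CW Wz]; case: (totC _ _ CV CW) => h.
      by exists W => //; case: (hC _ CW) => -[_ _ hM] _; apply: hM => //; apply: h.
    by exists V => //; case: (hC _ CV) => -[_ _ hM] _; apply: hM => //; apply: h.
  + by move=> [V CV]; case: (hC _ CV).
exists V; split=> // W hW nW; exact: hV.
Qed.

Section Fixed.
Variable V : K -> Prop.
Hypotheses (VB : Bring V) (nVx : ~ V (f x)^-1)
  (Vmax : forall W, Bring W -> ~ W (f x)^-1 -> V <=I W -> W <=I V).

Lemma Vf b : V (f b). Proof. by case: VB. Qed.
Lemma VD y z : V y -> V z -> V (y + z). Proof. by case: VB => _ h _; apply: h. Qed.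
Lemma VM y z : V y -> V z -> V (y * z). Proof. by case: VB => _ _ h; apply: h. Qed.
Lemma V0 : V 0. Proof. by rewrite -(rmorph0 f); apply: Vf. Qed.
Lemma V1 : V 1. Proof. by rewrite -(rmorph1 f); apply: Vf. Qed.
Lemma VN y : V y -> V (- y).
Proof. by move=> h; rewrite -mulN1r -(rmorph1 f) -rmorphN; apply: VM (Vf _) h. Qed.
Lemma VBs y z : V y -> V z -> V (y - z). Proof. by move=> hy /VN; apply: VD. Qed.
Lemma VX y n : V y -> V (y ^+ n).
Proof. by move=> h; elim: n => [|n IH]; [apply: V1|rewrite exprS; apply: VM]. Qed.

(** With e = 1 - xa, the ring V[1/e] still misses 1/x: since e^k = 1 - xb with b in V, a relation
    e^k/x = v would give 1/x = v + b. So maximality puts 1/e into V. *)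
Lemma V_unit a : V a -> V (1 - f x * a)^-1.
Proof.
move=> Va; set e := 1 - f x * a.
have pe k : exists b, V b /\ e ^+ k = 1 - f x * b.
  elim: k => [|k [b [Vb eb]]]; first by exists 0; rewrite mulr0 subr0; split=> //; apply: V0.
  exists (a + b - f x * a * b); split; last by rewrite exprS eb /e; ring.
  by apply: VBs; [apply: VD|do 2 apply: VM => //; apply: Vf].
pose W z := exists k v, V v /\ z * e ^+ k = v.
have e0 : e != 0.
  apply/eqP => e0; apply: nVx; suff -> : (f x)^-1 = a by [].
  by apply/esym/(mulfI fx0); rewrite divff ?fx0 //; apply/eqP; rewrite eq_sym -subr_eq0; apply/eqP.
have Ve : V e by apply: VBs; [apply: V1|apply: VM => //; apply: Vf].
apply: (Vmax (W := W)).
- split.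
  + by move=> b; exists 0%N, (f b); rewrite mulr1; split=> //; apply: Vf.
  + move=> y z [k [v [Vv ev]]] [k' [v' [Vv' ev']]]; exists (k + k')%N, (v * e ^+ k' + v' * e ^+ k).
    split; first by apply: VD; apply: VM => //; apply: VX.
    by rewrite exprD -ev -ev'; ring.
  + move=> y z [k [v [Vv ev]]] [k' [v' [Vv' ev']]]; exists (k + k')%N, (v * v').
    by split; [apply: VM|rewrite exprD -ev -ev'; ring].
- move=> [k [v [Vv ev]]]; have [b [Vb eb]] := pe k; apply: nVx.
  have -> : (f x)^-1 = v + b by rewrite -ev eb mulrBr mulr1 mulKf ?fx0 // subrK.
  exact: VD.
- by move=> z Vz; exists 0%N, z; rewrite mulr1.
- by exists 1%N, 1; rewrite expr1 mulVf //; split=> //; apply: V1.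
Qed.

(** The values at u of polynomials of size at most n over V, in Horner form. *)
Fixpoint hp (u : K) n (z : K) : Prop :=
  if n is n'.+1 then exists c y, [/\ V c, hp u n' y & z = c + u * y] else z = 0.

Lemma hp0 u n : hp u n 0.
Proof. by elim: n => //= n IH; exists 0, 0; rewrite mulr0 addr0; split=> //; apply: V0. Qed.
Lemma hpD u n y z : hp u n y -> hp u n z -> hp u n (y + z).
Proof.
elim: n y z => [|n IH] y z /=; first by move=> -> ->; rewrite addr0.
move=> [c [y' [hc hy ->]]] [d [z' [hd hz ->]]]; exists (c + d), (y' + z').
by split; [apply: VD|apply: IH|ring].
Qed.
Lemma hpZ u n a z : V a -> hp u n z -> hp u n (a * z).
Proof.
move=> Va; elim: n z => [|n IH] z /=; first by move=> ->; rewrite mulr0.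
move=> [c [y' [hc hy ->]]]; exists (a * c), (a * y').
by split; [apply: VM|apply: IH|ring].
Qed.
Lemma hpS u n z : hp u n z -> hp u n.+1 z.
Proof.
elim: n z => [|n IH] z /=; first by move=> ->; exists 0, 0; rewrite mulr0 addr0; split=> //; apply: V0.
by move=> [c [y [hc /IH hy ->]]]; exists c, y.
Qed.
Lemma hp_le u m n z : (m <= n)%N -> hp u m z -> hp u n z.
Proof. by move=> /subnK <-; elim: (n - m)%N => // k IH /IH; apply: hpS. Qed.
Lemma hpu u n z : hp u n z -> hp u n.+1 (u * z).
Proof. by move=> h; exists 0, z; rewrite add0r; split=> //; apply: V0. Qed.
Lemma hpX u n a : V a -> hp u n.+1 (a * u ^+ n).
Proof.
move=> Va; elim: n => [|n IH]; last by rewrite exprS mulrCA; apply: hpu.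
by exists a, 0; rewrite mulr0 addr0 expr0 mulr1.
Qed.
Lemma hp_top u n z : hp u n.+1 z -> exists c y, [/\ V c, hp u n y & z = y + c * u ^+ n].
Proof.
elim: n z => [|n IH] z.
  by move=> [c [y [Vc -> ->]]]; exists c, 0; rewrite mulr0 addr0 add0r mulr1.
move=> [c [y [Vc /IH[d [y' [Vd hy' ->]]] ->]]]; exists d, (c + u * y').
by split=> //; [exists c, y'|rewrite exprS; ring].
Qed.
Lemma hp_flip u w m n y : w * u = 1 -> (m <= n)%N -> hp w m y -> hp u n (u ^+ n.-1 * y).
Proof.
move=> wu; elim: m n y => [|m IH] n y; first by move=> _ ->; rewrite mulr0; apply: hp0.
case: n => // n mn [c [y' [Vc hy ->]]]; rewrite succnK mulrDr mulrC; apply: hpD; first exact: hpX.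
case: n mn => [|n] mn.
  by move: mn hy; case: (m) => // _ ->; rewrite !mulr0; apply: hp0.
apply: hpS; have -> : u ^+ n.+1 * (w * y') = u ^+ n * y' by rewrite exprSr -mulrA [u * (w * _)]mulrA [u * w]mulrC wu mul1r.
exact: (IH n.+1).
Qed.

Lemma hp_ring u : Bring (fun z => exists n, hp u n z).
Proof.
split=> [b|y z [m hm] [n hn]|y z [m hm] [n hn]].
- by exists 1%N, (f b), 0; rewrite mulr0 addr0; split=> //; apply: Vf.
- exists (maxn m n); apply: hpD; [apply: hp_le hm|apply: hp_le hn]; by rewrite ?leq_maxl ?leq_maxr.
- elim: m y hm => [|m IH] y /=; first by move=> ->; exists 0%N; rewrite mul0r.
  move=> [c [y' [Vc /IH[k hk] ->]]]; exists (maxn n k.+1).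
  rewrite mulrDl; apply: hpD; first by apply: hp_le (hpZ Vc hn); rewrite leq_maxl.
  by rewrite -mulrA; apply: hp_le (hpu hk); rewrite leq_maxr.
Qed.

(** If u and 1/u are both outside V, maximality makes 1/x a polynomial value at each of them. Of two
    such expressions of least size, the shorter one serves to lower the size of the longer. *)
Lemma V_val u : u != 0 -> V u \/ V u^-1.
Proof.
move=> u0; apply: contrapT => /not_orP[nu nw].
have ex t : ~ V t -> exists n, `[< hp t n (f x)^-1 >].
  move=> nt; apply: contrapT => hn; apply: nt; apply: (Vmax (hp_ring t)).
  - by move=> [n hn']; apply: hn; exists n; apply/asboolP.
  - by move=> z Vz; exists 1%N, z, 0; rewrite mulr0 addr0.
  - by exists 2%N, 0, 1; split; [apply: V0|exists 1, 0; rewrite mulr0 addr0; split=> //; apply: V1|rewrite mulr1 add0r].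
pose deg t n := hp t n (f x)^-1 /\ forall k, hp t k (f x)^-1 -> (n <= k)%N.
have exd t : ~ V t -> exists n, deg t n.+2.
  move=> nt; case: (ex_minnP (ex t nt)) => -[|[|n]] /asboolP h1 h2.
  - by move/eqP: h1; rewrite invr_eq0 (negPf fx0).
  - by case: nVx; case: h1 => c [y [Vc -> ->]]; rewrite mulr0 addr0.
  - by exists n; split=> // k hk; apply: h2; apply/asboolP.
suff main t w : t * w = 1 -> w * t = 1 -> forall m n, (m <= n)%N -> deg t n.+2 -> deg w m.+2 -> False.
  have [n hn] := exd _ nu; have [k hk] := exd _ nw.
  have e1 : u * u^-1 = 1 by rewrite divff.
  have e2 : u^-1 * u = 1 by rewrite mulVf.
  by case/orP: (leq_total k n) => h; [apply: (main _ _ e1 e2 _ _ h hn hk)|apply: (main _ _ e2 e1 _ _ h hk hn)].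
move=> tw wt m n mn [hn nmin] [[b [y [Vb hy e]]] _].
have [c [z [Vc hz ez]]] := hp_top hn.
(* [V_unit] clears the constant term of the expression in w. Multiplying the top term of the
   expression in t by 1 = x w y' then lowers its degree, as t w = 1. *)
have key : exists2 y', hp w m.+1 y' & 1 = f x * w * y'.
  exists ((1 - f x * b)^-1 * y); first by apply: hpZ => //; apply: V_unit.
  have eq1 : 1 - f x * b = f x * w * y.
    by rewrite -[1](mulVf fx0) mulrC e; ring.
  rewrite mulrCA -eq1 mulVf //; apply/eqP => /subr0_eq e0; apply: nVx.
  by have -> : (f x)^-1 = b by apply: (mulfI fx0); rewrite divff ?fx0.
have [y' hy' e'] := key.
have := nmin n.+1; have : hp t n.+1 (f x)^-1; last by move=> h /(_ h); rewrite ltnn.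
rewrite ez; apply: hpD hz _.
have -> : c * t ^+ n.+1 = (t * w) * ((c * f x) * (t ^+ n * y')).
  by rewrite -[LHS]mulr1 e' exprS; ring.
rewrite tw mul1r.
apply: hpZ; first by apply: VM => //; apply: Vf.
exact: (hp_flip (n := n.+1)) wt _ hy'.
Qed.
End Fixed.
End ValuationRing.

Section OneDim.
Variables (B : idomainType) (K : fieldType) (f : {rmorphism B -> K}) (m : idl B) (x : B).
Hypotheses (f_inj : injective f) (nB : noeth B) (lB : locl m) (cB : cmpl m) (kB : kclosed m)
  (fB : forall b : B, b != 0 -> fin (genI [:: b])) (x0 : x != 0) (mx : m x)
  (f_frac : forall z, exists a b, b != 0 /\ z = f a / f b).

Variable V : K -> Prop.
Hypotheses (VB : Bring f V) (nVx : ~ V (f x)^-1) (Vval : forall u, u != 0 -> V u \/ V u^-1).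

Let Vf b : V (f b). Proof. by case: VB. Qed.
Let VD y z : V y -> V z -> V (y + z). Proof. by case: VB => _ h _; apply: h. Qed.
Let VM y z : V y -> V z -> V (y * z). Proof. by case: VB => _ _ h; apply: h. Qed.
Let fE (b : B) : (f b == 0) = (b == 0). Proof. exact: f_eq0. Qed.

Definition bmod (N : K -> Prop) :=
  [/\ N 0, forall y z, N y -> N z -> N (y + z) & forall b y, N y -> N (f b * y)].

Fixpoint kch r (N : K -> Prop) : Prop :=
  if r is r'.+1 then exists N' y, [/\ bmod N', N <=I N', N' <=I V, N' y /\ ~ N y & kch r' N'] else True.

Lemma preI_ax N a : bmod N -> a != 0 -> [/\ N (f 0 / f a),
  forall y z, N (f y / f a) -> N (f z / f a) -> N (f (y + z) / f a)
  & forall b y, N (f y / f a) -> N (f (b * y) / f a)].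
Proof.
move=> [N0 ND NM] a0; split=> [|y z hy hz|b y hy]; first by rewrite rmorph0 mul0r.
  by rewrite rmorphD mulrDl; apply: ND.
by rewrite rmorphM -mulrA; apply: NM.
Qed.
Definition preI N a (hN : bmod N) (a0 : a != 0) := Idl (preI_ax hN a0).

(** A chain above N is witnessed by finitely many elements of V. Once their multiples by a lie in J,
    the chain restricts to a strict chain of ideals inside J. *)
Lemma kch_collect r N (hN : bmod N) : kch r N -> exists ys : seq K, (forall y, y \in ys -> V y) /\
  forall a (a0 : a != 0) (J : idl B), (forall y, y \in ys -> exists2 z, J z & f z = f a * y) ->
    rch r (capI J (preI hN a0)) J.
Proof.
elim: r N hN => [|r IH] N hN; first by exists [::]; split=> // a a0 J _ x' [].
move=> [N' [y [hN' NN' N'V [N'y nNy] /(IH _ hN')[ys [ysV h]]]]].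
exists (y :: ys); split.
  by move=> z; rewrite inE => /predU1P[->|/ysV//]; apply: N'V.
move=> a a0 J hJ; exists (capI J (preI hN' a0)); split.
- by move=> z [h1 h2]; split=> //; apply: NN'.
- have [z Jz ez] := hJ y (mem_head _ _); move=> e.
  have ey : f z / f a = y by rewrite ez mulrC mulKf // fE.
  have : capI J (preI hN' a0) z by split=> //; rewrite /= /idl_set /= ey.
  by rewrite e => -[_]; rewrite /idl_set /= ey.
- by apply: h => w hw; apply: hJ; rewrite inE hw orbT.
Qed.

Lemma common_den (ys : seq K) : exists2 a : B, a != 0 & forall y, y \in ys -> exists z, f z = f a * y.
Proof.
elim: ys => [|y ys [a a0 h]]; first by exists 1; rewrite ?oner_neq0.
have [b [c [c0 ->]]] := f_frac y; exists (a * c); first by rewrite mulf_neq0.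
move=> z; rewrite inE => /predU1P[->|/h[w ew]].
  by exists (a * b); rewrite !rmorphM -mulrA; congr (_ * _); rewrite mulrC divfK // fE.
by exists (c * w); rewrite !rmorphM ew mulrCA mulrA.
Qed.

Lemma lam_mulI h (J : idl B) : h != 0 -> fin (mulI h J) ->
  lam (mulI h J) = (lam (genI [:: h]) + lam J)%N.
Proof.
move=> h0 fJ; rewrite (lam_col h fJ).
have -> : addI (mulI h J) (genI [:: h]) = genI [:: h].
  by rewrite addIC addI_idr // => _ [y _ ->]; apply/idlMr/mem_gen1.
suff -> : colI (mulI h J) h = J by [].
apply: idl_eq => y; rewrite colP; split=> [[z Jz /(mulfI h0) ->]//|Jy]; by exists y.
Qed.

Lemma fin_neq0 (J : idl B) a : J a -> a != 0 -> fin J.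
Proof. by move=> Ja /fB; apply: fin_sub; apply: gen1_min. Qed.

(** Krull-Akizuki: V/bV has length at most that of B/bB. A chain restricts to J/bJ for a finitely
    generated J, and J/bJ has the length of B/bB because lam(bJ) = lam(b) + lam(J). *)
Lemma krull_akizuki b N r : b != 0 -> bmod N -> (forall v, V v -> N (f b * v)) -> kch r N ->
  (r <= lam (genI [:: b]))%N.
Proof.
move=> b0 hN bN /(kch_collect hN)[ys [ysV h]].
have [a a0 ha] := common_den ys.
have [g hg] : exists g : K -> B, forall y, y \in ys -> f (g y) = f a * y.
  have : forall y, exists z, y \in ys -> f z = f a * y.
    by move=> y; have [/ha[z hz]|nh] := boolP (y \in ys); [exists z|exists 0].
  by move=> /choice[g hg]; exists g => y; apply: hg.
pose J := genI (a :: map g ys).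
have Ja : J a by apply: mem_genI; rewrite mem_head.
have Vb : bmod V by split=> // [|c y Vy]; [rewrite -(rmorph0 f)|apply: VM].
have JV z : J z -> V (f z / f a).
  suff : J <=I preI Vb a0 by move=> h' /h'.
    apply: genI_min => w; rewrite inE => /predU1P[->|/mapP[y hy ->]].
      by rewrite /idl_set /= divff ?fE // -(rmorph1 f).
    by rewrite /idl_set /= hg // mulrC mulKf ?fE //; apply: ysV.
have hr : rch r (capI J (preI hN a0)) J.
  apply: h => y hy; exists (g y); last exact: hg.
  by apply: mem_genI; rewrite inE map_f ?orbT.
have bJ : mulI b J <=I capI J (preI hN a0).
  move=> _ [z Jz ->]; split; first exact: idlM.
  by rewrite /idl_set /= rmorphM -mulrA; apply/bN/JV.
have fbJ : fin (mulI b J).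
  by apply: (@fin_neq0 _ (b * a)); [exists a|rewrite mulf_neq0].
have [l [hl hl'] el] := ilen_rest (fun z (h : mulI b J z) => proj1 (bJ z h)) fbJ.
by have := hl' _ (rch_subl bJ hr); move: el; rewrite lam_mulI //; move=> /addIn -> .
Qed.

Definition xV (t : K) (z : K) := exists2 v, V v & z = t * v.
Lemma xV_mod t : bmod (xV t).
Proof.
split; first by exists 0; rewrite ?mulr0 // -(rmorph0 f).
  by move=> _ _ [v hv ->] [w hw ->]; exists (v + w); [apply: VD|rewrite mulrDr].
by move=> b _ [v hv ->]; exists (f b * v); [apply: VM|rewrite mulrCA].
Qed.
Lemma xV_sub t : V t -> xV t <=I V.
Proof. by move=> Vt _ [v hv ->]; apply: VM. Qed.

Definition adj (N : K -> Prop) (y z : K) := exists b w, N w /\ z = f b * y + w.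
Lemma adj_mod N y : bmod N -> bmod (adj N y).
Proof.
move=> [N0 ND NM]; split.
- by exists 0, 0; rewrite rmorph0 mul0r addr0.
- move=> _ _ [b [w [hw ->]]] [c [u [hu ->]]]; exists (b + c), (w + u).
  by split; [apply: ND|rewrite rmorphD mulrDl addrACA].
- move=> c _ [b [w [hw ->]]]; exists (c * b), (f c * w); split; first exact: NM.
  by rewrite rmorphM mulrDr mulrA.
Qed.
Lemma adj_in N y : bmod N -> adj N y y.
Proof. by move=> [N0 _ _]; exists 1, 0; rewrite rmorph1 mul1r addr0. Qed.
Lemma adj_sub N y : N <=I adj N y.
Proof. by move=> z hz; exists 0, z; rewrite rmorph0 mul0r add0r. Qed.
Lemma adj_V N y : N <=I V -> V y -> adj N y <=I V.
Proof. by move=> h Vy _ [b [w [/h hw ->]]]; apply: VD => //; apply: VM. Qed.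

Fixpoint sp (t : K) ys : K -> Prop := if ys is y :: ys' then adj (sp t ys') y else xV t.
Lemma sp_mod t ys : bmod (sp t ys).
Proof. elim: ys => [|y ys IH]; [exact: xV_mod|exact: adj_mod]. Qed.
Lemma sp_V t ys : V t -> (forall y, y \in ys -> V y) -> sp t ys <=I V.
Proof.
move=> Vt; elim: ys => [|y ys IH] h; first exact: xV_sub.
by apply: adj_V; [apply: IH => z hz; apply: h; rewrite inE hz orbT|apply: h; rewrite mem_head].
Qed.

Lemma V_fg : exists ys : seq K, (forall y, y \in ys -> V y) /\ V <=I sp (f x) ys.
Proof.
apply: contrapT => hn.
have chain r ys : (forall y, y \in ys -> V y) -> kch r (sp (f x) ys).
  elim: r ys => //= r IH ys hys.
  have [y Vy ny] : exists2 y, V y & ~ sp (f x) ys y.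
    by apply: contrapT => hn'; apply: hn; exists ys; split=> // y Vy; apply: contrapT => ny; apply: hn'; exists y.
  have hys' : forall z, z \in y :: ys -> V z by move=> z; rewrite inE => /predU1P[->|/hys].
  exists (sp (f x) (y :: ys)), y; split.
  - exact: sp_mod.
  - exact: adj_sub.
  - exact: sp_V.
  - by split=> //; apply: adj_in; apply: sp_mod.
  - exact: IH.
have := @krull_akizuki x _ (lam (genI [:: x])).+1 x0 (sp_mod (f x) [::]) _ (chain _ [::] _).
rewrite ltnn => h; suff : false by []; apply: h => // v Vv; by exists v.
Qed.

Definition nonunit t := [/\ V t, t != 0 & ~ V t^-1].

Lemma nonunit_x : nonunit (f x).
Proof. by split=> //; rewrite fE. Qed.

Lemma kch_pow n : kch n (xV (f x ^+ n)).
Proof.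
have VX k : V (f x ^+ k) by rewrite -rmorphXn.
have fx0' : f x != 0 by rewrite fE.
elim: n => //= n IH; exists (xV (f x ^+ n)), (f x ^+ n); split=> //.
- exact: xV_mod.
- by move=> _ [v Vv ->]; exists (f x * v); [apply: VM|rewrite exprSr mulrA].
- exact: xV_sub.
split; first by exists 1; rewrite ?mulr1 // -(rmorph1 f).
move=> [v Vv e]; apply: nVx; suff -> : (f x)^-1 = v by [].
apply: (mulfI fx0'); rewrite divff //; apply: (mulfI (expf_neq0 n fx0')).
by rewrite mulr1 {1}e exprSr mulrA.
Qed.

(** If z = a/b lies in all x^n V, then aV lies in x^n V, and V/aV would contain chains of every
    length n. *)
Lemma V_separated z : (forall n, xV (f x ^+ n) z) -> z = 0.
Proof.
move=> h; apply/eqP; apply: contrapT => /negP z0.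
have [a [b [b0 ez]]] := f_frac z.
have a0 : a != 0 by apply: contraNneq z0 => a0; rewrite ez a0 rmorph0 mul0r.
have := @krull_akizuki a (xV (f x ^+ (lam (genI [:: a])).+1)) _ a0 (xV_mod _) _ (kch_pow _).
rewrite ltnn => h'; suff : false by []; apply: h' => v Vv.
have [w Vw ew] := h (lam (genI [:: a])).+1; exists (f b * w * v); first by do 2 apply: VM => //.
have -> : f a = f b * z by rewrite ez mulrC divfK // fE.
by rewrite {1}ew; ring.
Qed.

(** A uniformizer: otherwise the ideals tV with t a nonunit would give arbitrarily long chains above
    xV. *)
Lemma max_nonunit : exists2 t, nonunit t & forall s, nonunit s -> V (s / t).
Proof.
apply: contrapT => hn.
have step t : nonunit t -> exists s, nonunit s /\ ~ V (s / t).
  move=> ht; apply: contrapT => hs; apply: hn; exists t => // s hs'.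
  by apply: contrapT => hv; apply: hs; exists s.
have chain r t : nonunit t -> kch r (xV t).
  elim: r t => //= r IH t ht; have [s [hs nv]] := step t ht; have [Vs s0 _] := hs; have [Vt t0 _] := ht.
  have Vts : V (t / s).
    case: (Vval (u := s / t)) => //; first by rewrite mulf_neq0 // invr_neq0.
    by rewrite invf_div.
  exists (xV s), s; split.
  - exact: xV_mod.
  - by move=> _ [v Vv ->]; exists (t / s * v); [apply: VM|rewrite mulrA mulrCA divff // mulr1].
  - exact: xV_sub.
  - split; first by exists 1; rewrite ?mulr1 // -(rmorph1 f).
    by move=> [v Vv e]; apply: nv; rewrite e mulrAC divff // mul1r.
  - exact: IH.
have := @krull_akizuki x _ (lam (genI [:: x])).+1 x0 (xV_mod (f x)) _ (chain _ _ nonunit_x).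
rewrite ltnn => h; suff : false by []; apply: h => // v Vv; by exists v.
Qed.

Lemma sum_sp ys z : sp (f x) ys z -> exists (c : nat -> B) v, V v /\
  z = \sum_(i < size ys) f (c i) * ys`_i + f x * v.
Proof.
elim: ys z => [|y ys IH] z /=.
  by move=> [v Vv ->]; exists (fun=> 0), v; rewrite big_ord0 add0r.
move=> [b [w [/IH[c [v [Vv ->]]] ->]]].
exists (fun i => if i is i'.+1 then c i' else b), v; split=> //.
by rewrite big_ord_recl /= addrA.
Qed.

Lemma expm_sub_x : exists k, forall n, expI m (k.+1 * n) <=I genI [:: x ^+ n].
Proof.
have [k hk] := fin_pow_ex nB lB (fB x0); exists k => n.
have {}hk : expI m k.+1 <=I genI [:: x] := subI_trans (expI_le (leqnSn k)) hk.
rewrite -expI_expI; apply: (subI_trans (@expI_mono _ _ _ n hk)).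
elim: n => [|n IH]; first by rewrite expr0 genI_one.
apply: prodI_min => y z /genI1P[c ->] /IH /genI1P[d ->]; apply/genI1P.
by exists (c * d); rewrite exprS; ring.
Qed.

(** V is finitely generated modulo xV. Iterating this expansion, the coefficients converge in B by
    completeness and the remainders vanish by [V_separated], so V is finite over B. *)
Lemma V_denom : exists2 a, a != 0 & forall v, V v -> exists b, f b = f a * v.
Proof.
have [ys [ysV hys]] := V_fg.
have [a a0 ha] := common_den ys; exists a => // v Vv.
suff [l el] : exists l : nat -> B, v = \sum_(i < size ys) f (l i) * ys`_i.
  have hz (i : 'I_(size ys)) : exists z, f z = f a * ys`_i by apply/ha/mem_nth.
  have [g hg] := choice hz.
  exists (\sum_(i < size ys) l i * g i); rewrite el rmorph_sum mulr_sumr.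
  by apply: eq_bigr => i _; rewrite rmorphM hg mulrCA.
have step w : exists cv : (nat -> B) * K, V w -> V cv.2 /\
    w = \sum_(i < size ys) f (cv.1 i) * ys`_i + f x * cv.2.
  have [Vw|nVw] := EM (V w); last by exists (fun=> 0, 0).
  by have [c [u h]] := sum_sp (hys _ Vw); exists (c, u).
have [g hg] := choice step.
pose w n := iter n (fun z => (g z).2) v.
have Vw n : V (w n) by elim: n => //= n IH; case: (hg _ IH).
pose S i n := \sum_(k < n) x ^+ k * (g (w k)).1 i.
have Sv n : v = \sum_(i < size ys) f (S i n) * ys`_i + f x ^+ n * w n.
  elim: n => [|n IH].
    by rewrite expr0 mul1r big1 ?add0r // => i _; rewrite /S big_ord0 rmorph0 mul0r.
  rewrite {1}IH; have [_ {1}->] := hg _ (Vw n); rewrite mulrDr mulr_sumr addrA -big_split /=.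
  congr (_ + _); last by rewrite exprSr mulrA.
  apply: eq_bigr => i _; rewrite /S big_ord_recr rmorphD rmorphM rmorphXn /= mulrDl mulrA //.
have Sc i : exists l, forall n, expI m n (l - S i n).
  apply: cB.2 => n; rewrite /S big_ord_recr /= addrAC subrr add0r.
  by apply/idlMr/expI_mem.
have [l hl] := choice Sc; exists l; apply/eqP; rewrite -subr_eq0; apply/eqP.
apply: V_separated => n; have [k hk] := expm_sub_x.
rewrite {1}(Sv (k.+1 * n)%N) addrAC -sumrB.
have h1 : bmod (xV (f x ^+ n)) by apply: xV_mod.
have [X0 XD XM] := h1; apply: (XD).
  apply: (big_ind (xV (f x ^+ n))) => // i _; rewrite -mulrBl.
  have : genI [:: x ^+ n] (S i (k.+1 * n)%N - l i).
    by apply: idlNr; rewrite opprB; apply: hk.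
  move=> /genI1P[c ec]; rewrite -rmorphB ec rmorphM rmorphXn -mulrA.
  apply: XM; exists (ys`_i) => //; apply: ysV; exact: mem_nth.
rewrite mulSn exprD -mulrA; exists (f x ^+ (k * n) * w (n + k * n)%N) => //.
by apply: VM => //; rewrite -rmorphXn.
Qed.

Lemma nonunit_m y : m y -> y != 0 -> nonunit (f y).
Proof.
move=> my y0; split=> //; first by rewrite fE.
move=> Vy; apply: nVx; have [k hk] := expm_sub_x.
have /genI1P[c ec] := hk 1%N _ (expI_mem (k.+1 * 1) my).
have fy0 : f y != 0 by rewrite fE.
have -> : (f x)^-1 = f c * (f y)^-1 ^+ (k.+1 * 1).
  apply: (mulfI (x := f x)); first by rewrite fE.
  rewrite divff ?fE // mulrA -rmorphM mulrC [x * c]mulrC -[x in c * x]expr1 -ec rmorphXn.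
  by rewrite -exprMn mulVf // expr1n.
apply: VM => //; elim: (_ * _)%N => [|n IH]; first by rewrite expr0 -(rmorph1 f).
by rewrite exprS; apply: VM.
Qed.

Section Uniformizer.
Variable t : K.
Hypotheses (ht : nonunit t) (tmax : forall s, nonunit s -> V (s / t)).

Let t0 : t != 0. Proof. by case: ht. Qed.
Let nVt : ~ V t^-1. Proof. by case: ht. Qed.
Let Vt : V t. Proof. by case: ht. Qed.
Let V0' : V 0. Proof. by rewrite -(rmorph0 f). Qed.
Let V1' : V 1. Proof. by rewrite -(rmorph1 f). Qed.

Lemma m_tV y : m y -> V (f y / t).
Proof.
move=> my; have [->|y0] := eqVneq y 0; first by rewrite rmorph0 mul0r.
by apply: tmax; apply: nonunit_m.
Qed.

Lemma tV_prime a b : V a -> V b -> V (a * b / t) -> V (a / t) \/ V (b / t).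
Proof.
move=> Va Vb Vab; have [->|a0] := eqVneq a 0; first by left; rewrite mul0r.
have [Va'|nVa'] := EM (V a^-1); last by left; apply: tmax.
by right; rewrite -(mulKf a0 b) -mulrA; apply: VM.
Qed.

Fixpoint pows (v : K) n := if n is n'.+1 then v ^+ n' :: pows v n' else [::].

Lemma sp_pows v n z : sp t (pows v n) z -> exists h : {poly B}, (size h <= n)%N /\
  V ((z - (map_poly f h).[v]) / t).
Proof.
elim: n z => [|n IH] z /=.
  by move=> [w Vw ->]; exists 0; rewrite size_poly0 rmorph0 horner0 subr0 mulrC mulKf.
move=> [b [w [/IH[h [sh Vh]] ->]]]; exists (b *: 'X^n + h); split.
  rewrite (leq_trans (size_polyD _ _)) // geq_max (leq_trans sh) // andbT.
  by rewrite (leq_trans (size_scale_leq _ _)) // size_polyXn.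
rewrite rmorphD /= map_polyZ map_polyXn hornerD hornerZ hornerXn.
set y := (map_poly f h).[v] in Vh *; rewrite (_ : f b * v ^+ n + w - _ = w - y) //; ring.
Qed.

(** The modules tV + (1, v, ..., v^(n-1)) cannot grow forever, because V/xV has finite length. *)
Lemma monic_rel v : V v -> exists g : {poly B}, [/\ g \is monic, (1 < size g)%N & V ((map_poly f g).[v] / t)].
Proof.
move=> Vv; have VX n : V (v ^+ n) by elim: n => [//|n IH]; rewrite exprS; apply: VM.
have [[n hn]|nex] := EM (exists n, sp t (pows v n) (v ^+ n)).
  have [h [sh Vh]] := sp_pows hn; exists ('X^n - h).
  have sg : size ('X^n - h : {poly B}) = n.+1 by rewrite size_polyDl size_polyXn // size_polyN ltnS.
  split.
  - by rewrite monicE lead_coefDl ?lead_coefXn // size_polyN size_polyXn ltnS.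
  - rewrite sg ltnS lt0n; apply/negP => /eqP n0; subst n; apply: nVt.
    by case: hn => w Vw; rewrite expr0 => e; rewrite -[t^-1]mulr1 e mulKf.
  - by rewrite rmorphB /= map_polyXn hornerD hornerN hornerXn.
have Vpows n y : y \in pows v n -> V y.
  by elim: n => //= n IH; rewrite inE => /predU1P[->|/IH].
have chain r n : kch r (sp t (pows v n)).
  elim: r n => //= r IH n; exists (sp t (pows v n.+1)), (v ^+ n); split.
  - exact: sp_mod.
  - exact: adj_sub.
  - by apply: sp_V => // y; apply: (Vpows n.+1).
  - by split; [apply: adj_in; apply: sp_mod|move=> h; apply: nex; exists n].
  - exact: IH.
have := @krull_akizuki x _ (lam (genI [:: x])).+1 x0 (sp_mod t (pows v 0)) _ (chain _ _).
rewrite ltnn => h; suff : false by []; apply: h => // w Vw; exists (f x / t * w); last by field.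
by apply: VM => //; apply: m_tV.
Qed.

(** V/tV equals the residue field of B. A monic relation of least size for v has a root a modulo m;
    as tV is prime, either v - a is in tV or the other factor is a smaller relation, or is 1. *)
Lemma residue v : V v -> exists b, V ((v - f b) / t).
Proof.
move=> Vv; have [g0 [mg0 sg0 hg0]] := monic_rel Vv.
pose Q n := `[< exists g : {poly B}, [/\ g \is monic, (1 < size g)%N, V ((map_poly f g).[v] / t) & size g = n] >].
have exQ : exists n, Q n by exists (size g0); apply/asboolP; exists g0.
case: (ex_minnP exQ) => n /asboolP[g [mg sg hg sn]] nmin.
have [a ma] := kB mg sg.
have : root (g - g.[a]%:P) a by rewrite /root hornerD hornerN hornerC subrr.
move=> /factor_theorem[q eq].
have gE : g = q * ('X - a%:P) + g.[a]%:P by rewrite -eq subrK.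
have sg' : (size (g.[a]%:P : {poly B}) < size g)%N by rewrite (leq_ltn_trans (size_polyC_leq1 _)).
have mq : q \is monic.
  rewrite -(monicMr _ (monicXsubC a)) -eq monicE lead_coefDl; last by rewrite size_polyN.
  exact/eqP/monicP.
have sq : size g = (size q).+1.
  have := size_Mmonic (monic_neq0 mq) (monicXsubC a).
  by rewrite -eq size_polyDl ?size_polyN // size_XsubC addn2 => ->.
have : V ((map_poly f q).[v] * (v - f a) / t).
  have -> : (map_poly f q).[v] * (v - f a) = (map_poly f g).[v] - f g.[a].
    rewrite {1}gE rmorphD rmorphM rmorphB /= map_polyX !map_polyC hornerD hornerM hornerD hornerN.
    by rewrite hornerX !hornerC addrK.
  rewrite mulrBl; apply: VD => //; rewrite -mulN1r -(rmorph1 f) -rmorphN; apply: VM => //; exact: m_tV.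
have Vq : V (map_poly f q).[v].
  rewrite horner_coef; apply: (big_ind V) => // i _; rewrite coef_map; apply: VM; first exact: Vf.
  elim: (nat_of_ord i) => [|k IH]; first by rewrite expr0 -(rmorph1 f).
  by rewrite exprS; apply: VM.
have Vva : V (v - f a) by rewrite -rmorphN; apply: VD.
move/(tV_prime Vq Vva) => [h|]; last by exists a.
have [s1|s1] := leqP (size q) 1.
  case: nVt; have q1 : q = 1.
    by have := size1_polyC s1 => e; move: mq; rewrite e monicE lead_coefC => /eqP ->.
  by move: h; rewrite q1 rmorph1 hornerC mul1r.
have : Q (size q) by apply/asboolP; exists q.
by move/nmin; rewrite -sn sq ltnn.
Qed.
End Uniformizer.

(** Here b = at with t a uniformizer and aV inside B. In B, J = aV and J1 = bV, so J/J1 has length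
    1, and bJ = aJ1. Comparing the colengths lam(b) + lam(J) and lam(a) + lam(J1) gives the
    claim. *)
Lemma ord_surj : exists a b : B, [/\ a != 0, b != 0 & lam (genI [:: b]) = (lam (genI [:: a])).+1].
Proof.
have [t ht tmax] := max_nonunit; have [Vt t0 nVt] := ht.
have [a a0 ha] := V_denom; have [b eb] := ha t Vt.
have b0 : b != 0 by rewrite -fE eb mulf_neq0 // fE.
exists a, b; split=> //.
have Vb : bmod V by split=> // [|c y Vy]; [rewrite -(rmorph0 f)|apply: VM].
pose J := preI Vb a0; pose J1 := preI Vb b0.
have JE z : J z <-> V (f z / f a) by [].
have J1E z : J1 z <-> V (f z / f b) by [].
have fa0 : f a != 0 by rewrite fE.
have fb0 : f b != 0 by rewrite fE.
have J1J : J1 <=I J.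
  move=> z /J1E h; apply/JE; have -> : f z / f a = t * (f z / f b) by rewrite eb; field; rewrite ?fa0 ?t0 ?fb0.
  exact: VM.
have Ja : J a by apply/JE; rewrite divff // -(rmorph1 f).
have J1b : J1 b by apply/J1E; rewrite divff // -(rmorph1 f).
have fJ1 := fin_neq0 J1b b0; have fJ := fin_neq0 Ja a0.
have eJ : mulI b J = mulI a J1.
  apply: idl_anti => _ [z hz ->].
    have [w ew] := ha _ (VM Vt ((JE z).1 hz)); exists w.
      apply/J1E; have -> : f w / f b = f z / f a by rewrite ew eb; field; rewrite ?fa0 ?t0 ?fb0.
      exact/JE.
    apply: f_inj; rewrite !rmorphM ew eb; field; by rewrite ?fa0 ?t0 ?fb0.
  have [w ew] := ha _ ((J1E z).1 hz); exists w.
    apply/JE; rewrite ew mulrC mulKf //; exact/J1E.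
  by apply: f_inj; rewrite !rmorphM ew mulrCA [f b * _]mulrC divfK.
have fbJ : fin (mulI b J) by apply: (@fin_neq0 _ (b * a)); [exists a|rewrite mulf_neq0].
have := lam_mulI b0 fbJ; rewrite {1}eJ lam_mulI -?eJ //.
have lJ1 : lam J1 = (lam J).+1.
  rewrite (lam_col a fJ1) -addn1 -(lam_m lB); congr addn.
    apply: (congr1 (@lam B)); apply: idl_anti; first by apply: addI_min => //; apply: gen1_min.
    move=> z hz; have [c hc] := residue ht tmax ((JE z).1 hz).
    rewrite -[z](subrK (c * a)); apply: idlD; last by apply/sub_addr/idlM/mem_gen1.
    apply: sub_addl; apply/J1E; rewrite rmorphB rmorphM.
    suff -> : (f z - f c * f a) / f b = (f z / f a - f c) / t by [].
    by rewrite eb; field; rewrite ?fa0 ?t0 ?fb0.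
  apply: (congr1 (@lam B)); apply: idl_anti; last first.
    move=> z mz; rewrite colP; apply/J1E; rewrite rmorphM eb.
    have -> : f a * f z / (f a * t) = f z / t by field; rewrite ?fa0 ?t0 ?fb0.
    exact: m_tV.
  apply: locl_max lB _ _; rewrite colP mulr1 => /J1E; rewrite eb invfM mulrA divff // mul1r.
  exact: nVt.
by rewrite lJ1 addnS -addSn => /addIn ->.
Qed.
End OneDim.

Lemma frac_ex (R : idomainType) (z : {fraction R}) :
  exists a b : R, b != 0 /\ z = tofrac a / tofrac b.
Proof.
elim/quotW: z => u; exists u.1, u.2; have u0 := denom_ratioP u; split=> //.
have ub : tofrac u.2 != 0 by rewrite tofrac_eq0.
apply: (canRL (mulfK ub)); unlock tofrac; rewrite -[LHS]FracField.pi_mul.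
by apply/eqP; rewrite FracField.equivf_def /FracField.mulf /= !numden_Ratio ?mulf_neq0 ?oner_neq0 // !mulr1 mulrC.
Qed.

Theorem one_dim_ord (B : idomainType) (m : idl B) x p : noeth B -> locl m -> cmpl m -> kclosed m ->
  (forall b : B, b != 0 -> fin (genI [:: b])) -> x != 0 -> m x -> prime.prime p ->
  exists h : B, h != 0 /\ ~~ (p %| lam (genI [:: h]))%N.
Proof.
move=> nB lB cB kB fB x0 mx pp.
pose f : {rmorphism B -> {fraction B}} := @tofrac B.
have f_inj : injective f by move=> a b e; apply/eqP; rewrite -tofrac_eq; apply/eqP.
have f_frac z : exists a b : B, b != 0 /\ z = f a / f b.
  exact: frac_ex.
have nux y : x * y <> 1 by move=> e; apply: lB.1; rewrite -e; apply: idlMr.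
have [V [VB nVx Vmax]] := max_ring f_inj x0 nux.
have Vval := V_val f_inj x0 VB nVx Vmax.
have [a [b [a0 b0 e]]] := ord_surj f_inj nB lB cB kB fB x0 mx f_frac VB nVx Vval.
have [h|h] := boolP (p %| lam (genI [:: a]))%N; last by exists a.
exists b; split=> //; rewrite e -addn1 dvdn_addr // dvdn1; apply/eqP => p1.
by rewrite p1 in pp.
Qed.

(** * Good primes in characteristic p *)

Section CompleteSpan.
Variables (B : comNzRingType) (m : idl B).
Hypothesis cB : cmpl m.

Lemma prod_genI s (J : idl B) z : prodI (genI s) J z ->
  exists u : nat -> B, (forall j, J (u j)) /\ z = \sum_(j < size s) s`_j * u j.
Proof.
elim: s z => [|a s IH] z.
  rewrite genI_nil => h; exists (fun=> 0); split; first by move=> _; apply: idl0.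
  by rewrite big_ord0; have := prodI_subl h.
rewrite genI_cons prodIC prodID prodIC prod_gen1 prodIC.
move=> [_ [w [[v Jv ->] /IH[u [Ju ->]] ->]]].
exists (fun j => if j is j'.+1 then u j' else v); split; first by case.
by rewrite big_ord_recl.
Qed.

(* [C n] is the [n]-th step of a filtration of the coefficient ring [C 0]. *)
Lemma complete_span (C : nat -> B -> Prop) (y ys : seq B) :
  (forall j, j \in y -> m j) ->
  (forall n a b, C n a -> C n b -> C n (a + b)) -> (forall n, C n 0) ->
  (forall n a j, j \in y -> C n a -> C n.+1 (j * a)) ->
  (forall c : nat -> B, (forall n, C n (c n)) ->
     exists2 s, C 0%N s & forall N, expI m N (s - \sum_(n < N) c n)) ->
  (forall b, exists c : nat -> B, (forall i, C 0%N (c i)) /\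
     genI y (b - \sum_(i < size ys) c i * ys`_i)) ->
  forall b, exists c : nat -> B, (forall i, C 0%N (c i)) /\ b = \sum_(i < size ys) c i * ys`_i.
Proof.
move=> my CD C0 Cy Clim span b; set Y := genI y in span.
have step n r : expI Y n r -> exists e : nat -> B, (forall i, C n (e i)) /\
    expI Y n.+1 (r - \sum_(i < size ys) e i * ys`_i).
  elim: n r => [|n IH] r.
    by move=> _; have [c [h1 h2]] := span r; exists c; rewrite expI1.
  move=> /prod_genI[u [hu er]].
  have [e he] := choice (fun j => IH (u j) (hu j)).
  exists (fun i => \sum_(j < size y) y`_j * e j i); split.
    by move=> i; apply: (big_ind (C n.+1)) => //; [exact: CD|move=> j _; apply: Cy; [apply: mem_nth|case: (he j)]].
  rewrite er; under [X in _ - X]eq_bigr => i _ do rewrite mulr_suml.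
  rewrite exchange_big -sumrB /=.
  apply: (@idl_sum B (expI Y n.+2)) => j _.
  under eq_bigr => i _ do rewrite -mulrA.
  rewrite -mulr_sumr -mulrBr; apply: prodI_mem; last by case: (he j).
  by apply/mem_genI/mem_nth.
have step' nr : exists e : nat -> B, expI Y nr.1 nr.2 -> (forall i, C nr.1 (e i)) /\
    expI Y nr.1.+1 (nr.2 - \sum_(i < size ys) e i * ys`_i).
  by have [/step[e he]|nh] := EM (expI Y nr.1 nr.2); [exists e|exists (fun=> 0)].
have [g hg] := choice step'.
pose w := fix w n := if n is n'.+1 then w n' - \sum_(i < size ys) g (n', w n') i * ys`_i else b.
have Yw n : expI Y n (w n) by elim: n => //= n /(hg (n, w n))[].
have Cg n i : C n (g (n, w n) i) by have [/(_ i)] := hg (n, w n) (Yw n).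
pose gw n i := g (n, w n) i.
have /choice[s hs] (i : nat) : exists s, C 0%N s /\ forall N, expI m N (s - \sum_(n < N) gw n i).
  by have [s] := Clim (fun n => gw n i) (fun n => Cg n i); exists s.
exists s; split; first by move=> i; case: (hs i).
have bE n : b = \sum_(i < size ys) (\sum_(k < n) gw k i) * ys`_i + w n.
  elim: n => [|n IH]; first by rewrite big1 ?add0r // => i _; rewrite big_ord0 mul0r.
  rewrite {1}IH /=; under [in RHS]eq_bigr => i _ do rewrite big_ord_recr mulrDl.
  by rewrite big_split /=; ring.
apply/eqP; rewrite -subr_eq0; apply/eqP; apply: cB.1 => n.
rewrite {1}(bE n) addrAC -sumrB; apply: idlD.
  apply: idl_sum => i _; rewrite -mulrBl; apply: idlMr; rewrite -opprB; apply: idlN.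
  by case: (hs i).
by apply: (@expI_mono _ Y m n) (Yw n); apply: genI_min.
Qed.
End CompleteSpan.

Section Independent.
Variables (B : idomainType) (S : B -> Prop).
Hypotheses (S1 : S 1) (S0 : S 0) (SN : forall a, S a -> S (- a))
  (SM : forall a b, S a -> S b -> S (a * b)).

Definition indep (es : seq B) := forall c : nat -> B, (forall i, S (c i)) ->
  \sum_(i < size es) c i * es`_i = 0 -> forall i, (i < size es)%N -> c i = 0.
Definition spanned (es : seq B) b := exists c : nat -> B, (forall i, S (c i)) /\
  b = \sum_(i < size es) c i * es`_i.

Lemma spanned_cons e es b : spanned es b -> spanned (e :: es) b.
Proof.
move=> [c [hc ->]]; exists (fun i => if i is i'.+1 then c i' else 0); split; first by case.
by rewrite big_ord_recl mul0r add0r.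
Qed.
Lemma spanned_scale es a b : S a -> spanned es b -> spanned es (a * b).
Proof.
move=> Sa [c [hc ->]]; exists (fun i => a * c i); split; first by move=> i; apply: SM.
by rewrite mulr_sumr; apply: eq_bigr => i _; rewrite mulrA.
Qed.

(** A basis over the fraction field of S, with one denominator r that expresses all of [ys] in
    it. *)
Lemma max_indep (ys : seq B) : exists es r, [/\ indep es, S r, r != 0
  & forall y, y \in ys -> spanned es (r * y)].
Proof.
elim: ys => [|y ys [es [r [ind Sr r0 h]]]]; first by exists [::], 1; split; rewrite ?oner_neq0.
have [ind'|nind] := EM (indep (y :: es)).
  exists (y :: es), r; split=> // z; rewrite inE => /predU1P[->|/h]; last exact: spanned_cons.
  exists (fun i => if i is 0%N then r else 0); split; first by case.
  by rewrite big_ord_recl big1 ?addr0 // => i _; rewrite mul0r.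
have [c [hc e0 [i ilt ci]]] : exists c : nat -> B, [/\ forall i, S (c i),
    \sum_(i < size (y :: es)) c i * (y :: es)`_i = 0 & exists2 i, (i < size (y :: es))%N & c i != 0].
  apply: contrapT => hn; apply: nind => c hc e0 i ilt; apply: contrapT => ci; apply: hn.
  by exists c; split=> //; exists i => //; apply/eqP.
rewrite big_ord_recl /= in e0.
have c00 : c 0%N != 0.
  apply/eqP => c0; rewrite c0 mul0r add0r in e0.
  case: i ilt ci => [|i] /= ilt; first by rewrite c0 eqxx.
  by rewrite (ind (fun i => c i.+1)) ?eqxx.
exists es, (r * c 0%N); split=> //; [exact: SM|by rewrite mulf_neq0|].
move=> z; rewrite inE => /predU1P[->|/h hz]; last by rewrite mulrAC mulrC; apply: spanned_scale.
rewrite -mulrA; apply: spanned_scale => //.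
exists (fun i => - c i.+1); split; first by move=> j; apply: SN.
by move/eqP: e0; rewrite addr_eq0 => /eqP ->; rewrite -sumrN; apply: eq_bigr => j _; rewrite mulNr.
Qed.
End Independent.

Section DomainPrimes.
Variables (B : idomainType) (m : idl B).
Hypothesis (nB : noeth B) (lB : locl m).
Local Notation Z := (zeroI B).

Lemma zero_prime : primeI Z.
Proof.
split; first by move/eqP; rewrite oner_eq0.
by move=> x y /eqP; rewrite mulf_eq0 => /orP[/eqP|/eqP]; [left|right].
Qed.

(** If every prime of a filtration of B/(P + pi B) had coheight below d, [pfun_regular] would bound
    the function of B/P by O(n^d), against growth of degree d + 1. *)
Lemma prime_over (P : idl B) d pi s : primeI P -> coh_ge P d.+1 -> ~ P pi ->
  (forall x, x \in pi :: s -> m x) -> size s = d -> fin (addI P (genI (pi :: s))) ->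
  exists Q, [/\ primeI Q, P <=I Q, Q pi & coh_ge Q d].
Proof.
move=> pP cP nPpi ms sz fP.
have [l hl] := pfilt_ex nB (@sub_top _ (addI P (genI [:: pi]))).
have fl : fin (addI (addI P (genI [:: pi])) (genI s)) by rewrite -addIA -genI_cons.
have [Q hQ nQ] : exists2 Q, In Q l & ~ eqO d (pfun Q s) (fun=> 0%N).
  apply: contrapT => hn.
  apply: (not_large_small (pfun_large nB lB pP cP ms fP)).
  have reg := pfun_regular nB pP nPpi fP.
  apply: eqO_trans (_ : eqO _ _ (fun n => \sum_(i < n) pfun (addI P (genI [:: pi])) s i)%N) _.
    by rewrite -sz.
  apply: eqO_trans (_ : eqO _ _ (fun n => \sum_(i < n) 0)%N) _; last first.
    by apply: eqO_ext (eqO_refl _ (fun=> 0%N)) => // n; rewrite big1.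
  apply: (@eqO_sum d _ (fun=> 0%N)).
  apply: eqO_trans (_ : eqO d _ (fun n => \sum_(Q <- l) pfun Q s n)%N) _.
    by rewrite -sz; apply: pfun_pfilt.
  have : forall Q, In Q l -> eqO d (pfun Q s) (fun=> 0%N).
    by move=> Q hQ; apply: contrapT => nQ; apply: hn; exists Q.
  elim: (l) => [|Q l' IH] h.
    by apply: eqO_ext (eqO_refl _ (fun=> 0%N)) => // n; rewrite big_nil.
  have h1 := eqO_add (h Q (or_introl erefl)) (IH (fun R hR => h R (or_intror hR))).
  by apply: eqO_ext h1 => n; rewrite ?big_cons.
have PQ := pfilt_le hl hQ.
exists Q; split; [exact: pfilt_prime hl hQ|exact: subI_trans (@sub_addl _ _ _) PQ|exact/PQ/add_gen1|].
apply: contrapT => cQ; apply: nQ; apply: pfun_small nB lB _ _ _ _ _.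
  by move=> R pR QR cR; apply: cQ; apply: coh_ge_sub QR cR.
by apply: fin_sub fl; apply: addI_mono.
Qed.

(** Nakayama over B_Q with denominators cleared; the elements themselves vanish because B is a
    domain. *)
Lemma nak_prime (Q : idl B) (s : seq B) t : primeI Q -> ~ Q t ->
  (forall y, y \in s -> prodI Q (genI s) (t * y)) -> forall y, y \in s -> y = 0.
Proof.
move=> pQ; have [Q1 QM] := pQ; elim: s t => [|a s IH] t nt h y //.
have split_ z : prodI Q (genI (a :: s)) z -> exists q w, [/\ Q q, prodI Q (genI s) w & z = q * a + w].
  rewrite genI_cons prodID => -[u [w [hu hw ->]]].
  move: hu; rewrite prodIC prod_gen1 => -[q hq ->]; exists q, w; split=> //; by rewrite mulrC.
have [q [w [hq hw eq]]] := split_ _ (h a (mem_head _ _)).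
have nt1 : ~ Q (t - q) by move=> h'; apply: nt; rewrite -[t](subrK q); apply: idlD.
have e1 : (t - q) * a = w by rewrite mulrBl eq addrAC subrr add0r.
have s0 : forall z, z \in s -> z = 0.
  apply: (IH ((t - q) * t)); first by move/QM => [].
  move=> z hz; have [|q' [w' [hq' hw' eq']]] := split_ (t * z); first by apply: h; rewrite inE hz orbT.
  rewrite -mulrA eq' mulrDr mulrCA e1; apply: idlD; exact: idlM.
rewrite inE => /predU1P[->|/s0//].
have w0 : w = 0.
  have : genI s <=I Z by apply: genI_min => z /s0 ->.
  by apply; apply: prodI_subr hw.
move/eqP: e1; rewrite w0 mulf_eq0 => /orP[/eqP tq|/eqP//].
by case: nt1; rewrite tq; apply: idl0.
Qed.

(** Q B_Q is associated to x. Among the proper ideals [L y] = (x B_Q : y) a maximal one is prime; it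
    contains x and lies in Q, so it is Q. *)
Lemma assoc_local (Q : idl B) x : primeI Q -> Q x -> x != 0 ->
  (forall P, primeI P -> P x -> P <=I Q -> P = Q) ->
  exists y, forall b, Q b <-> exists s c, ~ Q s /\ s * b * y = c * x.
Proof.
move=> pQ Qx x0 Qmin; have [Q1 QM] := pQ.
have ax y : [/\ exists s c, ~ Q s /\ s * 0 * y = c * x,
   forall a b, (exists s c, ~ Q s /\ s * a * y = c * x) -> (exists s c, ~ Q s /\ s * b * y = c * x) ->
     exists s c, ~ Q s /\ s * (a + b) * y = c * x
   & forall a b, (exists s c, ~ Q s /\ s * b * y = c * x) -> exists s c, ~ Q s /\ s * (a * b) * y = c * x].
  split.
  - by exists 1, 0; split=> //; ring.
  - move=> a b [s [c [ns e]]] [s' [c' [ns' e']]]; exists (s * s'), (s' * c + s * c').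
    split; first by move/QM => [].
    have -> : s * s' * (a + b) * y = s' * (s * a * y) + s * (s' * b * y) by ring.
    by rewrite e e'; ring.
  - move=> a b [s [c [ns e]]]; exists s, (a * c); split=> //.
    have -> : s * (a * b) * y = a * (s * b * y) by ring.
    by rewrite e; ring.
pose L y := Idl (ax y).
have LQ y : ~ L y 1 -> L y <=I Q.
  move=> n1 b [s [c [ns e]]]; apply: contrapT => nb; apply: n1; exists (s * b), c.
  by rewrite mulr1; split=> //; move/QM => [].
have n1 : ~ L 1 1.
  move=> [s [c [ns]]]; rewrite !mulr1 => e; apply: ns; rewrite e; exact: idlM.
pose Phi J := exists y, J = L y /\ ~ L y 1.
have [_ [_ [y [-> ny]] ymax]] := noeth_max nB (Phi := Phi) (ex_intro _ 1 (conj erefl n1)).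
exists y => b; have e : Q = L y; last by rewrite {1}e; exact: iff_refl.
apply/esym/Qmin; [|by exists 1, y; split; rewrite ?mul1r 1?mulrC|exact: LQ].
split=> // a a' [s [c [ns e]]]; have [h|na] := EM (L y a); [by left|right].
have n1' : ~ L (a * y) 1.
  move=> [s' [c' [ns' e']]]; apply: na; exists s', c'; split=> //; by rewrite -e'; ring.
rewrite -(ymax (L (a * y))); [by exists s, c; split=> //; rewrite -e; ring| |by exists (a * y)].
by move=> z [s' [c' [ns' e']]]; exists s', (a * c'); split=> //; rewrite -[a * c' * x]mulrA -e'; ring.
Qed.

(** J is finitely generated, so one denominator outside Q serves all its elements. *)
Lemma common_mult (Q J : idl B) (F : B -> Prop) : primeI Q ->
  (forall b, J b -> exists2 t, ~ Q t & F (t * b)) ->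
  (forall a b, F a -> F b -> F (a + b)) -> (forall a b, F b -> F (a * b)) -> F 0 ->
  exists2 t, ~ Q t & forall b, J b -> F (t * b).
Proof.
move=> pQ h FD FM F0; have [Q1 QM] := pQ; have [s es] := nB J.
have {h} : forall b, b \in s -> exists2 t, ~ Q t & F (t * b).
  by move=> b hb; apply: h; rewrite es; apply: mem_genI.
rewrite {}es; elim: s => [|a s IH] h.
  by exists 1 => // b; rewrite genI_nil => ->; rewrite mulr0.
have [t nt Ft] := h a (mem_head _ _).
have [|t' nt' Ft'] := IH; first by move=> b hb; apply: h; rewrite inE hb orbT.
exists (t * t'); first by move/QM => [].
move=> b; rewrite genI_cons => -[_ [w [/genI1P[c ->] hw ->]]].
have -> : t * t' * (c * a + w) = t' * c * (t * a) + t * (t' * w) by ring.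
by apply: FD; apply: FM => //; apply: Ft'.
Qed.
Lemma resid_span (S : B -> Prop) W : (forall d, exists a, S a /\ m (d - a)) -> fin W ->
  exists ys, forall b, exists c : nat -> B, (forall i, S (c i)) /\ W (b - \sum_(i < size ys) c i * ys`_i).
Proof.
move=> hS fW; have [l hl] := pfilt_ex nB (@sub_top _ W).
have : forall Q, In Q l -> Q = m.
  move=> Q hQ; apply: (fin_prime nB lB); first exact: pfilt_prime hl hQ.
  by apply: fin_sub fW; apply: pfilt_le hl hQ.
move E : (topI B) hl => T hl; elim: hl E => [{fW}W <- _|{fW}W {}T x {}l pr hl IH e h].
  by have [a [Sa _]] := hS 0; exists [::] => b; exists (fun=> a).
have [ys hys] := IH e (fun Q hQ => h Q (or_intror hQ)).
exists (x :: ys) => b; have [c [hc [w [v [Ww /genI1P[d ->] eb]]]]] := hys b.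
have [a [Sa ma]] := hS d.
exists (fun i => if i is i'.+1 then c i' else a); split; first by case.
rewrite big_ord_recl /= opprD addrCA addrC.
have -> : b - \sum_(i < size ys) c i * ys`_i - a * x = w + x * (d - a).
  by rewrite eb; ring.
apply: idlD => //; move: ma; rewrite -(h (colI W x)) //; by left.
Qed.
End DomainPrimes.

(** * Finiteness of B over its p-th powers *)

Section FrobeniusFinite.
Variables (B : idomainType) (m : idl B) (p : nat).
Hypotheses (nB : noeth B) (lB : locl m) (cB : cmpl m) (kB : kclosed m)
  (pp : prime.prime p) (charp : p%:R = 0 :> B).
Local Notation Z := (zeroI B).

Lemma pchar_B : p \in [pchar B].
Proof. by rewrite inE pp charp eqxx. Qed.
Lemma frobD (a b : B) : (a + b) ^+ p = a ^+ p + b ^+ p.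
Proof. exact: (pFrobenius_autD_comm pchar_B (mulrC a b)). Qed.
Lemma frobN (a : B) : (- a) ^+ p = - a ^+ p.
Proof. by rewrite -![(_ ^+ p)]/(pFrobenius_aut pchar_B _) rmorphN. Qed.
Lemma frob0 : (0 : B) ^+ p = 0.
Proof. by rewrite expr0n -leqn0 leqNgt prime_gt0. Qed.
Lemma frob_sum n (F : 'I_n -> B) : (\sum_i F i) ^+ p = \sum_i (F i) ^+ p.
Proof. by apply: (big_morph (fun a : B => a ^+ p) frobD frob0). Qed.

Lemma frob_fg d : coh_ge Z d.+2 -> ~ coh_ge Z d.+3 -> exists ys, forall b, exists c : nat -> B,
  b = \sum_(i < size ys) c i ^+ p * ys`_i.
Proof.
move=> cZ ncZ.
have dZ : dim_lt Z d.+3 by move=> P pP ZP cP; apply: ncZ; apply: coh_ge_sub ZP cP.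
have [x [_ mx fx]] := params nB lB dZ.
have {}fx : fin (genI x) by rewrite addIC addI_idr in fx => //; apply: zero_sub.
pose y := [seq a ^+ p | a <- x].
have fy : fin (genI y).
  have [k hk] := fin_pow_ex nB lB fx.
  have : forall x, fin (genI [seq a ^+ p | a <- x]) \/ True by right.
  move=> _; apply/(fin_primes nB lB) => P pP yP.
  apply: (fin_prime nB lB pP); apply: fin_sub fx; apply: genI_min => a ha.
  by apply: (primeX (n := p) pP); apply: yP; apply/mem_genI/map_f.
have [|ys hys] := resid_span nB lB (S := fun b => exists a, b = a ^+ p) _ fy.
  move=> d0; have [|a ha] := kB (monicXnsubC d0 (prime_gt0 pp)).
    by rewrite size_XnsubC ?prime_gt0 // ltnS prime_gt0.
  exists (a ^+ p); split; first by exists a.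
  by rewrite -opprB; apply: idlN; move: ha; rewrite hornerD hornerN hornerC hornerXn.
exists ys.
(* The coefficient ring B^p is filtered by the p-th powers of (x)^n, which matches multiplication by
   the parameters x^p in [y]. *)
pose C n b := exists2 e, expI (genI x) n e & b = e ^+ p.
have pg := prime_gt0 pp.
have mx' : genI x <=I m by apply: genI_min.
have key := @complete_span B m cB C y ys.
have {}key : forall b, exists c : nat -> B, (forall i, C 0%N (c i)) /\ b = \sum_(i < size ys) c i * ys`_i.
  apply: key.
  - by move=> _ /mapP[a /mx ma ->]; rewrite -(prednK pg) exprS; apply: idlMr.
  - by move=> n _ _ [a ha ->] [b hb ->]; exists (a + b); [apply: idlD|rewrite frobD].
  - by move=> n; exists 0; [apply: idl0|rewrite frob0].
  - move=> n _ _ /mapP[a ha ->] [b hb ->]; exists (a * b); last by rewrite exprMn.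
    by apply: prodI_mem => //; apply: mem_genI.
  - move=> c hc; have /choice[e he] (n : nat) : exists e, expI (genI x) n e /\ c n = e ^+ p.
      by have [e] := hc n; exists e.
        have [|l hl] := cB.2 (fun n => \sum_(k < n) e k).
      move=> n; rewrite big_ord_recr /= addrAC subrr add0r.
      by apply: (expI_mono mx'); case: (he n).
    exists (l ^+ p); first by exists l.
    move=> N; have -> : \sum_(n < N) c n = (\sum_(n < N) e n) ^+ p.
      by rewrite frob_sum; apply: eq_bigr => n _; case: (he n).
    rewrite -frobN -frobD -(prednK pg) exprS mulrC; exact: idlM.
  - move=> b; have [c [hc eb]] := hys b; exists c; split=> // i.
    by have [a ->] := hc i; exists a.
move=> b; have [c [hc eb]] := key b.
have /choice[e he] (i : nat) : exists e, c i = e ^+ p by have [e] := hc i; exists e.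
by exists e; rewrite eb; apply: eq_bigr => i _; rewrite he.
Qed.
End FrobeniusFinite.

Section GoodPrimes.
Variables (B : idomainType) (m : idl B).
Hypothesis (nB : noeth B) (lB : locl m).
Local Notation Z := (zeroI B).

Definition good_at (c : B) d := exists (Q : idl B) f t, [/\ primeI Q, Q f /\ f != 0,
  ~ Q t /\ ~ Q c, coh_ge Q d.+1 & forall b, Q b -> exists y, t * b = y * f].

Lemma zero_addI (J : idl B) : addI Z J = J.
Proof. by rewrite addIC addI_idr //; apply: zero_sub. Qed.

Lemma dim_lt_gen1 n (x : B) : ~ coh_ge Z n.+1 -> x != 0 -> dim_lt (genI [:: x]) n.
Proof.
move=> ncZ x0; rewrite -(zero_addI (genI _)); apply: dim_lt_prime_add ncZ _ => //.
  exact: zero_prime.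
by move=> /eqP; rewrite (negPf x0).
Qed.

Lemma m_gt (P : idl B) n : primeI P -> coh_ge P n.+1 -> ~ (m <=I P).
Proof.
move=> pP cP mP; have e : P = m by apply: idl_anti => //; apply: prime_sub_m.
by apply: (@coh_m _ _ lB); rewrite -e; apply: coh_ge_le cP.
Qed.

(** x is chosen outside the primes over D of coheight d + 1. A prime Q of that coheight containing
    both x and D would be one of them. *)
Lemma exists_param d (D : B) : D != 0 -> coh_ge Z d.+2 -> ~ coh_ge Z d.+3 ->
  exists x Q, [/\ primeI Q, Q x /\ x != 0, ~ Q D, coh_ge Q d.+1
   & forall P, primeI P -> P x -> P <=I Q -> P = Q].
Proof.
move=> D0 cZ ncZ; have dD := dim_lt_gen1 ncZ D0.
have [l hl] := pfilt_ex nB (@sub_top _ (genI [:: D])).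
pose ps := Z :: List.filter (fun Q => `[< coh_ge Q d.+1 >]) l.
have [|x mx hx] := @avoid _ ps m.
  move=> P [<-|/List.filter_In[hP /asboolP cP]].
    by split; [exact: zero_prime|apply: m_gt cZ; exact: zero_prime].
  by have pP := pfilt_prime hl hP; split=> //; apply: m_gt cP.
have x0 : x != 0 by apply/eqP => e; apply: (hx Z); [left|].
have dx := dim_lt_gen1 ncZ x0.
have [s [szs ms fs]] := params nB lB dx; rewrite -genI_cons in fs.
have [|||Q [pQ _ Qx cQ]] := prime_over nB lB (@zero_prime B) cZ (pi := x) (s := s) _ _ szs.
- by move/eqP; rewrite (negPf x0).
- by move=> z; rewrite inE => /predU1P[->|/ms].
- by rewrite zero_addI.
exists x, Q; split=> //.
- move=> QD; have DQ : genI [:: D] <=I Q by apply: gen1_min.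
  have [P hP PQ] := pfilt_min hl pQ DQ.
  have e := dim_lt_eq dD (pfilt_prime hl hP) (pfilt_le hl hP) PQ pQ cQ.
  apply: (hx P); last by rewrite -e.
  by right; apply/List.filter_In; split=> //; apply/asboolP; apply: coh_ge_sub PQ cQ.
- by move=> P pP Px PQ; apply/esym; apply: (dim_lt_eq dx) => //; apply: gen1_min.
Qed.

Variable p : nat.
Hypotheses (cB : cmpl m) (kB : kclosed m) (pp : prime.prime p) (charp : p%:R = 0 :> B).

Lemma good_charp c d : c != 0 -> coh_ge Z d.+2 -> ~ coh_ge Z d.+3 -> good_at c d.
Proof.
move=> c0 cZ ncZ; have [ys hys] := frob_fg nB lB cB kB pp charp cZ ncZ.
pose S b := exists a : B, b = a ^+ p.
have S1 : S 1 by exists 1; rewrite expr1n.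
have S0 : S 0 by exists 0; rewrite frob0.
have SN a : S a -> S (- a) by move=> [b ->]; exists (- b); rewrite (frobN pp charp).
have SM a b : S a -> S b -> S (a * b) by move=> [u ->] [v ->]; exists (u * v); rewrite exprMn.
have SD a b : S a -> S b -> S (a + b) by move=> [u ->] [v ->]; exists (u + v); rewrite (frobD pp charp).
have [es [r [ind _ r0 hr]]] := max_indep S1 S0 SN SM ys.
have spn b : exists a : nat -> B, r * b = \sum_(i < size es) a i ^+ p * es`_i.
  have [e ->] := hys b.
  have : spanned S es (r * \sum_(i < size ys) e i ^+ p * ys`_i).
    rewrite mulr_sumr; apply: big_ind.
    - by exists (fun=> 0); split=> //; rewrite big1 // => i _; rewrite mul0r.
    - move=> _ _ [u [hu ->]] [v [hv ->]]; exists (fun i => u i + v i); split; first by move=> i; apply: SD.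
      by rewrite -big_split; apply: eq_bigr => i _; rewrite mulrDl.
    - move=> i _; rewrite mulrCA; apply: spanned_scale => //; first by exists (e i).
      by apply: hr; apply: mem_nth.
  by move=> [c' [/choice[a ha] ->]]; exists a; apply: eq_bigr => i _; rewrite ha.
have cr0 : c * r != 0 by rewrite mulf_neq0.
(* Outside r the elements [es] give coordinates over B^p locally at Q. *)
have [x [Q [pQ [Qx x0] nQcr cQ Qmin]]] := exists_param cr0 cZ ncZ.
have [Q1 QM] := pQ.
have nQc : ~ Q c by move=> h; apply: nQcr; apply: idlMr.
have nQr : ~ Q r by move=> h; apply: nQcr; apply: idlM.
have [y hy] := assoc_local nB pQ Qx x0 Qmin.
(* In the first case b generates Q locally: up to units, b' y = c' x and b y = u x give u b' = c'
   b. *)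
have [[b [s [u [Qb [ns [nu e]]]]]]|bad] := EM (exists b s u, Q b /\ ~ Q s /\ ~ Q u /\ s * b * y = u * x).
  have ux0 : u * x != 0 by rewrite mulf_neq0 //; apply/eqP => e0; apply: nu; rewrite e0; apply: idl0.
  have y0 : y != 0 by apply: contraNneq ux0 => y0; rewrite -e y0 mulr0.
  have b0 : b != 0 by apply: contraNneq ux0 => b0; rewrite -e b0 mulr0 mul0r.
  have [||||t nt ht] := @common_mult _ nB Q Q (fun z => exists v, z = v * b) pQ.
  - move=> b' /hy[s' [c' [ns' e']]]; exists (s' * u); first by move/QM => [].
    exists (c' * s); apply: (mulfI (mulf_neq0 x0 y0)).
    have -> : x * y * (s' * u * b') = (s' * b' * y) * (u * x) by ring.
    by rewrite e' -e; ring.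
  - by move=> _ _ [v ->] [w ->]; exists (v + w); rewrite mulrDl.
  - by move=> a _ [v ->]; exists (a * v); rewrite mulrA.
  - by exists 0; rewrite mul0r.
  - by exists Q, b, t; split.
(* In the second case multiplication by y/x maps Q B_Q into itself, and this is iterated. *)
have it b l : Q b -> exists s u, [/\ ~ Q s, Q u & s * b * y ^+ l = x ^+ l * u].
  move=> Qb; elim: l => [|l [s [u [ns Qu e]]]]; first by exists 1, b; rewrite !expr0; split=> //; ring.
  have [s' [c' [ns' e']]] := (hy u).1 Qu.
  have Qc' : Q c' by apply: contrapT => nc'; apply: bad; exists u, s', c'.
  exists (s * s'), c'; split=> //; first by move/QM => [].
  have -> : s * s' * b * y ^+ l.+1 = s' * y * (s * b * y ^+ l) by rewrite exprS; ring.
  have -> : s' * y * (s * b * y ^+ l) = x ^+ l * (s' * u * y) by rewrite e; ring.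
  by rewrite e' exprS; ring.
have [||||t nt ht] := @common_mult _ nB Q Q (prodI Q Q) pQ.
- move=> b Qb; have [s [u [ns Qu e]]] := it b p Qb.
  exists (r * s); first by move/QM => [].
  have [a ea] := spn (s * b); have [v ev] := spn u.
  (* Independence over B^p makes each coordinate (y a_i - x v_i)^p vanish, so y a_i = x v_i and a_i
     is in Q. Then a_i^p is in Q^2, since p >= 2. *)
  have h0 : \sum_(i < size es) (y * a i - x * v i) ^+ p * es`_i = 0.
    transitivity (y ^+ p * (r * (s * b)) - x ^+ p * (r * u)); last first.
      have -> : y ^+ p * (r * (s * b)) = r * (s * b * y ^+ p) by ring.
      by rewrite e; ring.
    rewrite ea ev !mulr_sumr -sumrB; apply: eq_bigr => i _.
    by rewrite (frobD pp charp) (frobN pp charp) !exprMn; ring.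
  have Sd i : S ((y * a i - x * v i) ^+ p) by exists (y * a i - x * v i).
  rewrite -mulrA ea; apply: idl_sum => i _.
  have /eqP := ind _ Sd h0 i (ltn_ord i).
  rewrite expf_eq0 subr_eq0 => /andP[_ /eqP e1].
  have Qa : Q (a i) by apply/hy; exists 1, (v i); split=> //; rewrite mul1r mulrC e1 mulrC.
  apply: idlMr; case: (p) (prime_gt1 pp) => [|[|p']] // _.
  by rewrite exprS; apply: prodI_mem => //; rewrite exprS; apply: idlMr.
- exact: idlD.
- by move=> a b; apply: idlM.
- exact: idl0.
have [gs eQ] := nB Q.
have := @nak_prime _ Q gs t pQ nt; rewrite -eQ => h.
have g0 : forall z, z \in gs -> z = 0.
  by apply: h => z hz; apply: ht; rewrite eQ; apply: mem_genI.
case/eqP: x0; have : genI gs <=I Z by apply: genI_min => z /g0 ->.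
by apply; rewrite -eQ.
Qed.
End GoodPrimes.

(** * Good primes in characteristic 0 *)

Section Subrings.
Variable B : comNzRingType.
Implicit Type S : B -> Prop.

Definition subr S := [/\ S 1, forall a b, S a -> S b -> S (a - b) &
  forall a b, S a -> S b -> S (a * b)].

Section Closure.
Variable S : B -> Prop.
Hypothesis hS : subr S.
Lemma subr1 : S 1. Proof. by case: hS. Qed.
Lemma subrB a b : S a -> S b -> S (a - b). Proof. by case: hS => _ h _; apply: h. Qed.
Lemma subrM a b : S a -> S b -> S (a * b). Proof. by case: hS => _ _; apply. Qed.
Lemma subr0' : S 0. Proof. by rewrite -(subrr 1); apply: subrB subr1 subr1. Qed.
Lemma subrN a : S a -> S (- a). Proof. by rewrite -sub0r; apply: subrB; exact: subr0'. Qed.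
Lemma subrD a b : S a -> S b -> S (a + b).
Proof. by move=> ha hb; rewrite -[b]opprK; apply: subrB => //; apply: subrN. Qed.
Lemma subr_sum (T : Type) (r : seq T) (P : pred T) (F : T -> B) :
  (forall i, P i -> S (F i)) -> S (\sum_(i <- r | P i) F i).
Proof. by move=> h; apply: big_ind => //; [exact: subr0'|exact: subrD]. Qed.
Lemma subrX a n : S a -> S (a ^+ n).
Proof. by move=> ha; elim: n => [|n IH]; rewrite ?expr0 ?exprS; [exact: subr1|exact: subrM]. Qed.
Lemma subr_nat n : S n%:R.
Proof. by elim: n => [|n IH]; [exact: subr0'|rewrite mulrS; apply: subrD => //; exact: subr1]. Qed.

Definition pover (f : {poly B}) := forall i, S f`_i.
Lemma pover0 : pover 0. Proof. by move=> i; rewrite coef0; apply: subr0'. Qed.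
Lemma poverC a : S a -> pover a%:P.
Proof. by move=> ha i; rewrite coefC; case: eqP => // _; apply: subr0'. Qed.
Lemma poverXn n : pover 'X^n.
Proof. by move=> i; rewrite coefXn; case: eqP => // _; [apply: subr1|apply: subr0']. Qed.
Lemma poverD f g : pover f -> pover g -> pover (f + g).
Proof. by move=> hf hg i; rewrite coefD; apply: subrD. Qed.
Lemma poverB f g : pover f -> pover g -> pover (f - g).
Proof. by move=> hf hg i; rewrite coefB; apply: subrB. Qed.
Lemma poverM f g : pover f -> pover g -> pover (f * g).
Proof. by move=> hf hg i; rewrite coefM; apply: subr_sum => j _; apply: subrM. Qed.
Lemma poverZ a f : S a -> pover f -> pover (a *: f).
Proof. by move=> ha hf i; rewrite coefZ; apply: subrM. Qed.
Lemma pover_deriv f : pover f -> pover f^`().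
Proof. by move=> hf i; rewrite coef_deriv -mulr_natr; apply: subrM => //; apply: subr_nat. Qed.
Lemma pover_lead f : pover f -> S (lead_coef f). Proof. by move=> hf; apply: hf. Qed.

Lemma pover_pdiv h g : pover h -> pover g -> (0 < size h)%N ->
  exists k q r, [/\ pover q, pover r, (size r < size h)%N & lead_coef h ^+ k *: g = q * h + r].
Proof.
move=> hh hg h0; have [n] := ubnP (size g); elim: n g hg => // n IH g hg; rewrite ltnS => gn.
have [lt|le] := ltnP (size g) (size h).
  by exists 0%N, 0, g; rewrite expr0 scale1r mul0r add0r; split=> //; apply: pover0.
pose a := (lead_coef g *: 'X^(size g - size h)); pose g1 := lead_coef h *: g - a * h.
have ha : pover a by apply: poverZ; [exact: pover_lead|exact: poverXn].
have hg1 : pover g1.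
  by apply: poverB; [apply: poverZ => //; exact: pover_lead|exact: poverM].
have [|k [q [r [hq hr lr e]]]] := IH g1 hg1.
  apply: leq_trans gn; have g0 : (0 < size g)%N by apply: leq_trans le.
  rewrite -(prednK g0) ltnS; apply/leq_sizeP => j hj.
  rewrite coefB coefZ /a -scalerAl coefZ coefXnM.
  have -> : (j < size g - size h)%N = false by apply/negbTE; rewrite -leqNgt; lia.
  have [->|nj] := eqVneq j (size g).-1.
    have -> : ((size g).-1 - (size g - size h) = (size h).-1)%N by lia.
    by rewrite -!lead_coefE mulrC subrr.
  rewrite (leq_sizeP g (size g) (leqnn _)) ?(leq_sizeP h (size h) (leqnn _)) ?mulr0 ?subrr //; lia.
exists k.+1, (q + lead_coef h ^+ k *: a), r; split=> //.
  by apply: poverD => //; apply: poverZ => //; apply/subrX/pover_lead.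
rewrite exprSr -scalerA -[lead_coef h *: g](subrK (a * h)) -/g1 scalerDr e scalerAl mulrDl addrAC; reflexivity.
Qed.

Lemma pover_det n (M : 'M[{poly B}]_n) : (forall i j, pover (M i j)) -> pover (\det M).
Proof.
move=> hM; rewrite /determinant; apply: big_ind; [exact: pover0|exact: poverD|move=> s _].
apply: poverM; last first.
  apply: big_ind; [by rewrite -polyC1; apply/poverC/subr1|exact: poverM|by move=> i _].
have sgP (k : nat) : (-1) ^+ k = ((-1) ^+ k)%:P :> {poly B} by rewrite polyC_exp polyCN.
by rewrite sgP; apply/poverC/subrX/subrN; exact: subr1.
Qed.

Definition polyext t : B -> Prop := fun b => exists2 g, pover g & b = g.[t].
Lemma polyext_in t a : S a -> polyext t a.
Proof. by move=> ha; exists a%:P; [exact: poverC|rewrite hornerC]. Qed.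
Lemma polyext_gen t : polyext t t.
Proof. by exists 'X; [rewrite -['X]expr1; apply: poverXn|rewrite hornerX]. Qed.
Lemma polyext_subr t : subr (polyext t).
Proof.
split; first exact/polyext_in/subr1.
- by move=> _ _ [f hf ->] [g hg ->]; exists (f - g); [exact: poverB|rewrite hornerD hornerN].
- by move=> _ _ [f hf ->] [g hg ->]; exists (f * g); [exact: poverM|rewrite hornerM].
Qed.

(** Determinant trick: y acts on the generators by a matrix over S, whose characteristic polynomial
    at y kills them and hence 1. *)
Lemma integral_poly (ys : seq B) y : 
  (forall b, exists c : nat -> B, (forall i, S (c i)) /\ b = \sum_(i < size ys) c i * ys`_i) ->
  exists g, [/\ pover g, g \is monic & g.[y] = 0].
Proof.
move=> span; have [M hM] := choice (fun j => span (y * ys`_j)).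
pose A : 'M[B]_(size ys) := \matrix_(i, j) M i j.
exists (char_poly A); split; last 1 first.
- have e : (char_poly A).[y] = \det (y%:M - A).
    rewrite -[LHS]/(horner_eval y _) -det_map_mx; congr determinant.
    apply/matrixP => i j; rewrite !mxE rmorphB rmorphMn /= /horner_eval hornerC hornerX.
    by [].
  have k i : (i < size ys)%N -> (char_poly A).[y] * ys`_i = 0.
    move=> hi; pose v : 'cV[B]_(size ys) := \col_j ys`_j.
    have v0 : (y%:M - A) *m v = 0.
      apply/matrixP => a b; rewrite mulmxBl mul_scalar_mx !mxE (hM a).2; apply/eqP; rewrite subr_eq0; apply/eqP.
      by apply: eq_bigr => j _; rewrite !mxE.
    have : \adj (y%:M - A) *m ((y%:M - A) *m v) = 0 by rewrite v0 mulmx0.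
    rewrite mulmxA mul_adj_mx mul_scalar_mx -e => /matrixP /(_ (Ordinal hi) 0).
    by rewrite !mxE.
  have [c [_ e1]] := span 1; rewrite -[LHS]mulr1 e1 mulr_sumr big1 // => i _.
  by rewrite mulrCA k ?mulr0.
- apply: pover_det => i j; rewrite !mxE; apply: poverB; last exact/poverC/((hM i).1 j).
  by case: (i == j); rewrite ?mulr1n ?mulr0n; [rewrite -['X]expr1; apply: poverXn|apply: pover0].
- exact: char_poly_monic.
Qed.
End Closure.
End Subrings.

Section SeparableStep.
Variables (B : idomainType) (Q : idl B) (f : B).
Hypothesis pQ : primeI Q.

(** b lies in f B_Q, with denominators cleared. *)
Definition loc b := exists2 t, ~ Q t & exists v, t * b = v * f.
Let Q1 : ~ Q 1 := pQ.1.
Let QM a b : ~ Q a -> ~ Q b -> ~ Q (a * b).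
Proof. by move=> ha hb /pQ.2[]. Qed.

Lemma locD a b : loc a -> loc b -> loc (a + b).
Proof.
move=> [t nt [v e]] [s ns [w e']]; exists (t * s); first exact: QM.
by exists (s * v + t * w); rewrite mulrDl -!mulrA -e -e'; ring.
Qed.
Lemma locM a b : loc b -> loc (a * b).
Proof. by move=> [t nt [v e]]; exists t => //; exists (a * v); rewrite mulrCA e mulrA. Qed.
Lemma locX a b : ~ Q a -> loc (a * b) -> loc b.
Proof. by move=> na [t nt [v e]]; exists (t * a); [exact: QM|exists v; rewrite -mulrA]. Qed.
Lemma loc0 : loc 0.
Proof. by exists 1 => //; exists 0; rewrite mul0r mulr0. Qed.
Lemma loc_gen b : loc (b * f).
Proof. by exists 1 => //; exists b; rewrite mul1r. Qed.

Variable S : B -> Prop.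
Hypotheses (hS : subr S) (locS : forall b, S b -> Q b -> loc b).

(* The key polynomial [h] has least size among those with [h.[t]] in [Q] but not
   all coefficients in [Q]. Differentiating [c *: F = q * h + r] shows that
   [q.[t]] is not in [Q], which makes [h.[t]] a local multiple of [f]. *)
Lemma loc_polyext t F : pover S F -> F.[t] = 0 -> ~ Q F^`().[t] ->
  forall b, polyext S t b -> Q b -> loc b.
Proof.
move=> hF F0 F'0.
have Qh (g : {poly B}) : (forall i, Q g`_i) -> Q g.[t].
  by move=> hg; rewrite horner_coef; apply: idl_sum => i _; apply: idlMr.
pose H h := [/\ pover S h, Q h.[t] & exists i, ~ Q h`_i].
have [h [hh Qht nh] hmin] : exists2 h, H h & forall g, H g -> (size h <= size g)%N.
  have exH : exists n, `[< exists2 h, H h & size h = n >].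
    exists (size F); apply/asboolP; exists F => //; split; rewrite ?F0 //; first exact: idl0.
    apply: contrapT => hQ; apply: F'0; apply: Qh => i; rewrite coef_deriv -mulr_natl; apply: idlM.
    by apply: contrapT => hi; apply: hQ; exists i.+1.
  case: (ex_minnP exH) => n /asboolP[h Hh <-] hn.
  by exists h => // g Hg; apply: hn; apply/asboolP; exists g.
have small (r : {poly B}) : pover S r -> Q r.[t] -> (size r < size h)%N -> forall i, Q r`_i.
  move=> hr Qr lr i; apply: contrapT => nr; have : H r by split=> //; exists i.
  by move/hmin; rewrite leqNgt lr.
have sh : (0 < size h)%N.
  by rewrite lt0n; apply/negP; rewrite size_poly_eq0 => /eqP e; case: nh => i; apply; rewrite e coef0; apply: idl0.
have nlead : ~ Q (lead_coef h).
  move=> ql; pose r := h - (lead_coef h *: 'X^((size h).-1)).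
  have hr : pover S r by apply: poverB => //; apply: poverZ => //; [exact: pover_lead|exact: poverXn].
  have Qr : Q r.[t].
    by rewrite hornerD hornerN hornerZ; apply: idlB => //; apply: idlMr.
  have lr : (size r < size h)%N.
    rewrite -(prednK sh) ltnS; apply/leq_sizeP => j hj; rewrite coefB coefZ coefXn.
    have [->|nj] := eqVneq j (size h).-1; first by rewrite mulr1 -lead_coefE subrr.
    rewrite mulr0 subr0 (leq_sizeP h (size h) (leqnn _)) //; lia.
  have := small _ hr Qr lr; case: nh => i ni /(_ i); rewrite coefB coefZ => hi; apply: ni.
  by rewrite -[h`_i](subrK (lead_coef h * 'X^((size h).-1)`_i)); apply: idlD => //; apply: idlMr.
have nlX k : ~ Q (lead_coef h ^+ k) by move/(primeX pQ).
have loc_small (r : {poly B}) : pover S r -> Q r.[t] -> (size r < size h)%N -> loc r.[t].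
  move=> hr Qr lr; rewrite horner_coef; apply: big_ind; [exact: loc0|exact: locD|].
  by move=> i _; rewrite mulrC; apply: locM; apply: locS => //; apply: small.
have divQ (g : {poly B}) : pover S g -> Q g.[t] -> exists k q r, [/\ pover S r, (size r < size h)%N, Q r.[t],
    lead_coef h ^+ k *: g = q * h + r & loc r.[t]].
  move=> hg Qg; have [k [q [r [hq hr lr e]]]] := pover_pdiv hS hh hg sh.
  have Qr : Q r.[t].
    have -> : r.[t] = lead_coef h ^+ k * g.[t] - q.[t] * h.[t].
      by have := congr1 (horner^~ t) e; rewrite /= hornerZ hornerD hornerM => ->; ring.
    by apply: idlB; apply: idlM.
  by exists k, q, r; split=> //; apply: loc_small.
have lh : loc h.[t].
  have [|k [q [r [hr lr Qr e lcr]]]] := divQ F hF; first by rewrite F0; apply: idl0.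
  have nq : ~ Q q.[t].
    move=> Qq; suff : Q (lead_coef h ^+ k * F^`().[t]) by case/pQ.2 => [/nlX|].
    have := congr1 (fun g => g^`().[t]) e; rewrite /= derivZ hornerZ derivD derivM !(hornerD, hornerM) => ->.
    apply: idlD; first by apply: idlD; [exact: idlM|exact: idlMr].
    by apply: Qh => i; rewrite coef_deriv -mulr_natl; apply: idlM; apply: small.
  apply: (locX nq); have -> : q.[t] * h.[t] = - 1 * r.[t].
    have /(congr1 (horner^~ t)) /eqP := e; rewrite hornerZ F0 mulr0 hornerD hornerM eq_sym addr_eq0.
    by move=> /eqP ->; rewrite mulN1r.
  exact: locM.
move=> _ [g hg ->] Qg; have [k [q [r [_ _ _ e lcr]]]] := divQ g hg Qg.
apply: (locX (nlX k)); have := congr1 (horner^~ t) e.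
by rewrite /= hornerZ hornerD hornerM => ->; apply: locD => //; apply: locM.
Qed.
End SeparableStep.

Lemma loc_span (B : idomainType) (Q : idl B) (f : B) (ys : seq B) (S : B -> Prop) : primeI Q -> subr S ->
  (forall b, S b -> Q b -> loc Q f b) ->
  (forall y, y \in ys -> exists F, [/\ pover S F, F.[y] = 0 & ~ Q F^`().[y]]) ->
  forall b, (exists a (c : nat -> B), [/\ S a, forall i, S (c i) & b = a + \sum_(i < size ys) c i * ys`_i]) ->
  Q b -> loc Q f b.
Proof.
move=> pQ; elim: ys S => [|y ys IH] S hS lS hys b [a [c [Sa Sc ->]]].
  by rewrite big_ord0 addr0; apply: lS.
have [F [hF F0 F'0]] := hys y (mem_head _ _).
apply: (IH (polyext S y)); first exact: polyext_subr.
- exact: loc_polyext hF F0 F'0.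
- move=> z hz; have [|G [hG G0 G'0]] := hys z; first by rewrite inE hz orbT.
  by exists G; split=> // i; apply: polyext_in.
- exists (a + c 0%N * y), (fun i => c i.+1); split.
  + apply: subrD; [exact: polyext_subr|exact: polyext_in|apply: subrM; [exact: polyext_subr|exact: polyext_in|exact: polyext_gen]].
  + by move=> i; apply: polyext_in.
  + by rewrite big_ord_recl /= addrA.
Qed.

(** * Subrings of power series in a complete ring *)

Section Series.
Variables (B : comNzRingType) (m : idl B).
Hypothesis (nB : noeth B) (lB : locl m) (cB : cmpl m).
Implicit Type S : B -> Prop.

Definition slim (u : nat -> B) l := forall N, expI m N (l - \sum_(n < N) u n).
Definition pser (a : nat -> B) x n := a n * x ^+ n.

Lemma expm_pser a x n : m x -> expI m n (pser a x n).
Proof. by move=> mx; apply: idlM; apply: expI_mem. Qed.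

Lemma slim_ex u : (forall n, expI m n (u n)) -> exists l, slim u l.
Proof.
move=> hu; have [|l hl] := cB.2 (fun N => \sum_(n < N) u n); last by exists l.
by move=> n; rewrite big_ord_recr /= addrAC subrr add0r.
Qed.

Lemma slimB u v l l' : slim u l -> slim v l' -> slim (fun n => u n - v n) (l - l').
Proof.
move=> h h' N; rewrite sumrB.
have -> : l - l' - (\sum_(i < N) u i - \sum_(i < N) v i) = (l - \sum_(i < N) u i) - (l' - \sum_(i < N) v i) by ring.
exact: idlB.
Qed.

(* The subring S[[x]] of the complete ring. *)
Definition psr S x l := exists2 a, forall n, S (a n) & slim (pser a x) l.

Lemma poly_tail (g : {poly B}) x N : m x -> expI m N (g.[x] - \sum_(n < N) g`_n * x ^+ n).
Proof.
move=> mx; rewrite (@horner_coef_wide _ (N + size g)) ?leq_addl // big_split_ord /=.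
rewrite addrAC subrr add0r; apply: idl_sum => i _; apply: idlM.
by apply: (expI_le (leq_addr i N)); apply: expI_mem.
Qed.

Lemma psr_subr S x : subr S -> m x -> subr (psr S x).
Proof.
move=> hS mx; have S0 := subr0' hS; split.
- exists (fun n => if n is 0%N then 1 else 0); first by case=> [|n]; [exact: subr1|].
  rewrite /slim; elim=> [|N _] //=; rewrite big_ord_recl big1 => [|i _]; last by rewrite /pser mul0r.
  by rewrite /pser mulr1 addr0 subrr; apply: idl0.
- move=> l l' [a Sa ha] [b Sb hb]; exists (fun n => a n - b n); first by move=> n; apply: subrB.
  move=> N; have := slimB ha hb N; congr (expI m N (_ - _)); apply: eq_bigr => i _.
  by rewrite /pser mulrBl.
- move=> l l' [a Sa ha] [b Sb hb].
  pose c n := \sum_(i < n.+1) a i * b (n - i)%N; exists c.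
    by move=> n; apply: subr_sum => // i _; apply: subrM.
  move=> N; pose f := \poly_(i < N) a i; pose g := \poly_(i < N) b i.
  have ef : f.[x] = \sum_(i < N) pser a x i by rewrite horner_poly.
  have eg : g.[x] = \sum_(i < N) pser b x i by rewrite horner_poly.
  have ec : \sum_(n < N) pser c x n = \sum_(n < N) (f * g)`_n * x ^+ n.
    apply: eq_bigr => n _; rewrite /pser coefM; congr (_ * _); apply: eq_bigr => i _.
    by rewrite !coef_poly !(leq_ltn_trans _ (ltn_ord n)) // ?leq_subr // -ltnS.
  have -> : l * l' - \sum_(n < N) pser c x n = (l - f.[x]) * l' + f.[x] * (l' - g.[x])
     + ((f * g).[x] - \sum_(n < N) (f * g)`_n * x ^+ n) by rewrite ec hornerM; ring.
  apply: idlD; last exact: poly_tail.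
  by apply: idlD; [apply: idlMr; rewrite ef|apply: idlM; rewrite eg].
Qed.

Lemma psr_in S x b : subr S -> S b -> psr S x b.
Proof.
move=> hS Sb; exists (fun n => if n is 0%N then b else 0); first by case=> [|n] //; apply: subr0'.
rewrite /slim; elim=> [|N _] //=; rewrite big_ord_recl big1 => [|i _]; last by rewrite /pser mul0r.
by rewrite /pser mulr1 addr0 subrr; apply: idl0.
Qed.

Definition serclosed S z := forall w l, (forall n, S (w n)) -> slim (pser w z) l -> S l.

(** Interchange of summation in the double series of a_nj x^j z^n. *)
Lemma psr_serclosed S x z : m x -> m z -> serclosed S z -> serclosed (psr S x) z.
Proof.
move=> mx mz cS w l hw hl.
have /choice[a ha] n : exists a : nat -> B, (forall j, S (a j)) /\ slim (pser a x) (w n).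
  by have [a] := hw n; exists a.
have /choice[s hs] j : exists s, slim (pser (a^~ j) z) s.
  by apply: slim_ex => n; apply: expm_pser.
exists s => [j|N]; first by apply: cS (hs j) => n; apply: (ha n).1.
have -> : l - \sum_(j < N) pser s x j = (l - \sum_(n < N) pser w z n)
   + \sum_(n < N) (w n - \sum_(j < N) pser (a n) x j) * z ^+ n
   - \sum_(j < N) (s j - \sum_(n < N) pser (a^~ j) z n) * x ^+ j.
  have -> : \sum_(n < N) (w n - \sum_(j < N) pser (a n) x j) * z ^+ n =
      \sum_(n < N) pser w z n - \sum_(n < N) \sum_(j < N) a n j * x ^+ j * z ^+ n.
    by rewrite -sumrB; apply: eq_bigr => n _; rewrite mulrBl mulr_suml.
  have -> : \sum_(j < N) (s j - \sum_(n < N) pser (a^~ j) z n) * x ^+ j =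
      \sum_(j < N) pser s x j - \sum_(n < N) \sum_(j < N) a n j * x ^+ j * z ^+ n.
    rewrite exchange_big -sumrB; apply: eq_bigr => j _; rewrite mulrBl mulr_suml.
    by congr (_ - _); apply: eq_bigr => n _; rewrite mulrAC.
  by ring.
apply: idlB; first apply: idlD => //; apply: idl_sum => i _; apply: idlMr.
  exact: (ha i).2.
exact: hs.
Qed.

Definition fgen S (X : idl B) ys := forall b, exists c : nat -> B,
  (forall i, S (c i)) /\ X (b - \sum_(i < size ys) c i * ys`_i).

(** Generators over S modulo X + xB become generators modulo X: the remainder is divided by x and
    expanded again, so the coefficients are power series in x over S. [S'] is S itself or S[[x]]. *)
Lemma fgen_lim S S' X x ys : m x ->
  (forall w l, (forall n, S (w n)) -> slim (pser w x) l -> S' l) ->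
  fgen S (addI X (genI [:: x])) ys -> fgen S' X ys.
Proof.
move=> mx lS fS b.
have /choice[g hg] d : exists g : (nat -> B) * B,
    (forall i, S (g.1 i)) /\ X (d - \sum_(i < size ys) g.1 i * ys`_i - g.2 * x).
  have [c [hc [u [_ [Xu /genI1P[b' ->] e]]]]] := fS d.
  by exists (c, b'); split=> //=; rewrite e addrK.
pose w n := iter n (fun b => (g b).2) b.
have /choice[s hs] i : exists s, slim (pser (fun n => (g (w n)).1 i) x) s.
  by apply: slim_ex => n; apply: expm_pser.
exists s; split; first by move=> i; apply: lS (hs i) => n; apply: (hg (w n)).1.
apply: (krull nB lB) => N.
have hX : X (b - \sum_(i < size ys) (\sum_(n < N) pser (fun n => (g (w n)).1 i) x n) * ys`_i - w N * x ^+ N).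
  elim: N => [|N IH].
    by rewrite big1 => [|i _]; rewrite ?big_ord0 ?mul0r // subr0 mulr1 subrr; apply: idl0.
  under eq_bigr => i _ do rewrite big_ord_recr mulrDl /=.
  rewrite big_split /=; set U := \sum_(i < size ys) _ in IH *.
  have := idlMr (x ^+ N) (hg (w N)).2; move/(idlD IH); congr (idl_set X _).
  rewrite !mulrBl mulr_suml exprS; under eq_bigr => i _ do rewrite mulrAC.
  rewrite /pser /=; ring.
set V := \sum_(i < size ys) _ in hX.
have -> : b - \sum_(i < size ys) s i * ys`_i = (b - V - w N * x ^+ N) + (w N * x ^+ N - (\sum_(i < size ys) s i * ys`_i - V)) by ring.
apply: idlD; first exact: sub_addl.
apply: sub_addr; apply: idlB; first by apply: idlM; apply: expI_mem.
by rewrite -sumrB; apply: idl_sum => i _; rewrite -mulrBl; apply: idlMr; apply: hs.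
Qed.

Definition tower S xs := foldr (fun x S' => psr S' x) S xs.

Lemma tower_subr S xs : subr S -> (forall x, x \in xs -> m x) -> subr (tower S xs).
Proof.
move=> hS; elim: xs => //= x xs IH h; apply: psr_subr; last by apply/h/mem_head.
by apply: IH => y hy; apply: h; rewrite inE hy orbT.
Qed.
Lemma tower_in S xs b : subr S -> (forall x, x \in xs -> m x) -> S b -> tower S xs b.
Proof.
move=> hS; elim: xs => //= x xs IH h Sb; have h' : forall x, x \in xs -> m x.
  by move=> y hy; apply: h; rewrite inE hy orbT.
by apply: psr_in; [exact: tower_subr|exact: IH].
Qed.
Lemma tower_serclosed S xs z : m z -> (forall x, x \in xs -> m x) -> serclosed S z -> serclosed (tower S xs) z.
Proof.
move=> mz; elim: xs => //= x xs IH h cS; apply: psr_serclosed => //; first by apply/h/mem_head.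
by apply: IH => // y hy; apply: h; rewrite inE hy orbT.
Qed.
Lemma tower_fgen S xs X ys : (forall x, x \in xs -> m x) ->
  fgen S (addI X (genI xs)) ys -> fgen (tower S xs) X ys.
Proof.
elim: xs X => [|x xs IH] X h; first by rewrite genI_nil addI_idr //; apply: zero_sub.
rewrite genI_cons addIA => fS; apply: (@fgen_lim (tower S xs)) => //.
- by apply/h/mem_head.
- by move=> w l hw hl; exists w.
by apply: IH => // y hy; apply: h; rewrite inE hy orbT.
Qed.
End Series.

Lemma pigeon (T : Type) (f : nat -> T) l : (forall k, In (f k) l) -> exists i j, (i < j)%N /\ f i = f j.
Proof.
move=> h; have /choice[g hg] k : exists i : 'I_(length l), List.nth i l (f 0%N) = f k.
  by have [i [/ltP hi e]] := List.In_nth _ _ (f 0%N) (h k); exists (Ordinal hi).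
apply: contrapT => hn; have ginj : injective (fun k : 'I_(length l).+1 => g k).
  move=> i j e; have e' : f i = f j by rewrite -(hg i) -(hg j) e.
  by apply: val_inj; case: (ltngtP i j) => // lt; case: hn; [exists i, j|exists j, i].
by have := leq_card _ ginj; rewrite !card_ord ltnn.
Qed.

Section CharZero.
Variables (B : idomainType) (m : idl B).
Hypothesis (nB : noeth B) (lB : locl m) (cB : cmpl m).
Local Notation Z := (zeroI B).

Lemma coh_params (P : idl B) d s : primeI P -> coh_ge P d -> (forall x, x \in s -> m x) ->
  fin (addI P (genI s)) -> (d <= size s)%N.
Proof.
move=> pP cP ms fP; rewrite leqNgt; apply/negP => lt.
apply: (not_large_small (pfun_large nB lB pP cP ms fP)).
have := pfun_bound fP; rewrite -(subnKC lt); elim: (d - _)%N => [|k IH]; first by rewrite addn0.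
by move/IH; rewrite addnS; apply: eqO_S.
Qed.

Variables (W : B -> Prop) (z : B).
Hypotheses (hW : subr W) (Wz : W z) (mz : m z) (z0 : z != 0)
  (Wm : forall a, W a -> m a -> exists2 w, W w & a = w * z)
  (cW : serclosed m W z) (Wres : forall b, exists w, W w /\ m (b - w)).

Lemma mP (P : idl B) : primeI P -> P <=I m. Proof. exact: prime_sub_m. Qed.

(** W[[xs]] meets Q in 0. For a series in Q with lowest coefficient u_n, x^n can be cancelled;
    modulo a prime over Q + xB of coheight one less, u_n is then zero, so u_n = 0 by induction on
    [xs]. *)
Lemma tower_zero xs (Q : idl B) a : primeI Q -> (forall x, x \in xs -> m x) -> coh_ge Q (size xs).+1 ->
  fin (addI Q (genI (rcons xs z))) -> tower m W xs a -> Q a -> a = 0.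
Proof.
elim: xs Q a => [|x xs IH] Q a pQ ms cQ fQ /=.
  have nQz : ~ Q z.
    move=> Qz; have : fin Q by move: fQ; rewrite addI_idr //; apply: gen1_min.
    move/(fin_prime nB lB pQ) => e; apply: (@coh_m _ _ lB); by rewrite -e.
  (* Without variables, an element of W in Q is divisible by z, and the quotient is again in W and
     in Q; so it lies in every m^n. *)
  move=> Wa Qa; apply: cB.1 => n; elim: n a Wa Qa => // n IHn a Wa Qa.
  have [w Ww e] := Wm Wa (prime_sub_m lB pQ Qa); rewrite e mulrC; apply: prodI_mem => //.
  by apply: IHn => //; move: Qa; rewrite e => /pQ.2[].
have mx : m x by apply/ms/mem_head.
have ms' y : y \in xs -> m y by move=> hy; apply: ms; rewrite inE hy orbT.
have mxz y : y \in rcons xs z -> m y by rewrite mem_rcons inE => /predU1P[->|/ms'].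
have nQx : ~ Q x.
  move=> Qx; have h := @coh_params Q _ (rcons xs z) pQ cQ mxz.
  rewrite size_rcons ltnn in h.
  suff : false by []; apply: h; move: fQ; rewrite rcons_cons genI_cons addIA.
  by rewrite (@addI_idr _ Q (genI [:: x])) //; apply: gen1_min.
move=> [u hu ha] Qa.
have [||Q2 [pQ2 QQ2 Q2x cQ2]] := prime_over nB lB pQ cQ nQx (s := rcons xs z) _ _ fQ.
- by move=> y; rewrite inE => /predU1P[->|/mxz].
- by rewrite size_rcons.
have fQ2 : fin (addI Q2 (genI (rcons xs z))).
  apply: fin_sub fQ; rewrite rcons_cons genI_cons addIA; apply: addI_mono => //.
  by apply: addI_min => //; apply: gen1_min.
have u0 n : u n = 0.
  have [N] := ubnP n; elim: N n => // N IHN n; rewrite ltnS => nN.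
  have [a' ha'] : exists a', slim m (pser (fun j => u (n + j)%N) x) a'.
    by apply: (slim_ex cB) => k; apply: expm_pser.
  have ea : a = x ^+ n * a'.
    apply/eqP; rewrite -subr_eq0; apply/eqP; apply: cB.1 => M.
    have e : \sum_(i < n + M) pser u x i = x ^+ n * \sum_(i < M) pser (fun j => u (n + j)%N) x i.
      rewrite big_split_ord /= big1 ?add0r => [|i _].
        by rewrite mulr_sumr; apply: eq_bigr => i _; rewrite /pser exprD; ring.
      by rewrite /pser IHN ?mul0r //; apply: leq_trans nN.
    have -> : a - x ^+ n * a' = (a - \sum_(i < n + M) pser u x i)
       - x ^+ n * (a' - \sum_(i < M) pser (fun j => u (n + j)%N) x i) by rewrite e; ring.
    apply: idlB; last exact/idlM/ha'.
    by apply: (expI_le (leq_addl n M)); apply: ha.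
  have Qa' : Q a' by move: Qa; rewrite ea => /pQ.2[/(primeX pQ)|].
  apply: (IH Q2 (u n) pQ2 ms' cQ2 fQ2 (hu n)).
  rewrite -[u n](subKr a'); apply: idlB; first exact: QQ2.
  apply: (krull nB lB) => M.
  have -> : a' - u n = (a' - \sum_(i < M.+1) pser (fun j => u (n + j)%N) x i)
     + \sum_(i < M) pser (fun j => u (n + j)%N) x i.+1.
    rewrite big_ord_recl /= {1}/pser /= addn0 expr0 mulr1 opprD addrA addrNK; reflexivity.
  apply: idlD; first by apply: sub_addr; apply: (expI_le (leqnSn M)); apply: ha'.
  by apply: sub_addl; apply: idl_sum => i _; rewrite /pser exprS mulrCA; apply: idlMr.
apply: cB.1 => N; have := ha N; rewrite big1 ?subr0 // => i _.
by rewrite /pser u0 mul0r.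
Qed.

Hypothesis char0 : forall n, n.+1%:R != 0 :> B.

(** In characteristic 0 g can be replaced by its derivative, nonzero and of smaller size, as long as
    t is a root of it. *)
Lemma min_sep (S : B -> Prop) t g : subr S -> pover S g -> g != 0 -> g.[t] = 0 ->
  exists F, [/\ pover S F, F.[t] = 0 & F^`().[t] != 0].
Proof.
move=> hS hg g0 e.
have [n] := ubnP (size g); elim: n g hg g0 e => // n IH g hg g0 e; rewrite ltnS => gn.
have sg : (1 < size g)%N.
  rewrite ltnNge; apply/negP => /size1_polyC eg; move: e g0; rewrite eg hornerC => ->.
  by rewrite eqxx.
have [d0|] := eqVneq g^`().[t] 0; last by exists g.
have [||||F hF] := IH g^`(); [exact: pover_deriv| |exact: d0| |by exists F].
  have /eqP : g^`()`_(size g).-2 != 0.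
    rewrite coef_deriv -mulr_natr mulf_neq0 ?char0 //.
    by rewrite prednK -?lead_coefE ?lead_coef_eq0 //; lia.
  by apply: contra_not_neq => ->; rewrite coef0.
by apply: leq_trans gn; rewrite lt_size_deriv // -size_poly_gt0; lia.
Qed.

Lemma good_char0 (c : B) d : c != 0 -> coh_ge Z d.+2 -> ~ coh_ge Z d.+3 -> good_at c d.
Proof.
move=> c0 cZ ncZ; have pZ := @zero_prime B.
have [s [ss ms fs]] := params nB lB (dim_lt_gen1 ncZ z0).
case: s ss ms fs => [|x xs] //= [ss] ms fs.
have mx : m x by apply/ms/mem_head.
have mxs y : y \in xs -> m y by move=> hy; apply: ms; rewrite inE hy orbT.
have mxz y : y \in rcons xs z -> m y by rewrite mem_rcons inE => /predU1P[->|/mxs].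
have [ys hys] := resid_span nB lB Wres fs.
set R' := tower m W xs; set R := tower m W (x :: xs).
have hR' : subr R' by apply: tower_subr.
have hR : subr R by apply: tower_subr.
have span b : exists c : nat -> B, (forall i, R (c i)) /\ b = \sum_(i < size ys) c i * ys`_i.
  suff [u [hu e]] : exists c : nat -> B, (forall i, R (c i)) /\ Z (b - \sum_(i < size ys) c i * ys`_i).
    by exists u; split=> //; apply/eqP; rewrite -subr_eq0; apply/eqP.
  apply: (tower_fgen nB lB cB ms); rewrite zero_addI.
  by apply: (fgen_lim nB lB cB mz cW); rewrite addIC.
have /choice[F hF] y : exists F, [/\ pover R F, F.[y] = 0 & F^`().[y] != 0].
  have [g [hg gm g0]] := integral_poly hR y span; apply: (min_sep hR hg _ g0); exact: monic_neq0.
pose D := c * \prod_(y <- ys) (F y)^`().[y].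
have D0 : D != 0.
  rewrite mulf_neq0 // prodf_seq_neq0; apply/allP => y _ /=; by case: (hF y).
have fz : fin (genI (x :: rcons xs z)).
  apply: fin_sub fs; apply: addI_min; first by apply: gen1_min; apply: mem_genI; rewrite -rcons_cons mem_rcons mem_head.
  by apply: genI_map_sub => y hy; rewrite -rcons_cons mem_rcons inE hy orbT.
pose pi k := x - z ^+ k.+1.
have xpi (J : idl B) k : J (pi k) -> genI (x :: rcons xs z) <=I addI J (genI (rcons xs z)).
  move=> Jpi; apply: genI_min => y; rewrite inE => /predU1P[->|hy]; last exact/sub_addr/mem_genI.
  rewrite -[x](subrK (z ^+ k.+1)); apply: idlD; first exact: sub_addl.
  by rewrite exprSr; apply: idlM; apply/sub_addr/mem_genI; rewrite mem_rcons mem_head.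
have mpi k : m (pi k) by apply: idlB => //; rewrite exprSr; apply: idlM.
have sr : size (rcons xs z) = d.+1 by rewrite size_rcons ss.
have pi0 k : pi k != 0.
  apply/eqP => e; have := @coh_params Z _ (rcons xs z) pZ cZ mxz.
  rewrite sr ltnn => h; suff : false by []; apply: h.
  by apply: fin_sub fz; apply: (xpi _ k); rewrite e.
have /choice[Q hQ] k : exists Q, [/\ primeI Q, Q (pi k) & coh_ge Q d.+1].
  have [|||Q [pQ _ Qp cQ]] := prime_over nB lB pZ cZ (pi := pi k) (s := rcons xs z) _ _ sr.
  - by move/eqP; rewrite (negPf (pi0 k)).
  - by move=> y; rewrite inE => /predU1P[->|/mxz].
  - rewrite genI_cons zero_addI; apply: fin_sub fz; apply: (xpi _ k); exact: mem_gen1.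
  - by exists Q.
have fQ k : fin (addI (Q k) (genI (rcons xs z))).
  by apply: fin_sub fz; apply: (xpi _ k); case: (hQ k).
have dD := dim_lt_gen1 ncZ D0.
have [l hl] := pfilt_ex nB (@sub_top _ (genI [:: D])).
(* Otherwise all [Q k] are among finitely many primes over D. If two agree for i < j, that prime
   contains z^(i+1)(1 - z^(j-i)), hence z and x, and its coheight is too large for the remaining
   parameters. *)
have [k nQD] : exists k, ~ Q k D.
  apply: contrapT => hn.
  have inl k : In (Q k) l.
    have QD : Q k D by apply: contrapT => h; apply: hn; exists k.
    have [pQ _ cQ] := hQ k; have DQ : genI [:: D] <=I Q k by apply: gen1_min.
    have [P hP PQ] := pfilt_min hl pQ DQ.
    by rewrite (dim_lt_eq dD (pfilt_prime hl hP) (pfilt_le hl hP) PQ pQ cQ).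
  have [i [j [ij e]]] : exists i j, (i < j)%N /\ Q i = Q j.
    exact: pigeon inl.
  have [pQ Qi cQ] := hQ i; have [_ Qj _] := hQ j; rewrite -e in Qj.
  have [v hv] : exists v, (1 - z ^+ (j - i)%N) * v = 1.
    by apply: (m_unit lB); rewrite -(subnKC ij) addSnnS addKn exprS; apply: idlMr.
  have Qz : Q i z.
    apply: (primeX (n := i.+1) pQ); rewrite -[_ ^+ _]mulr1 -hv mulrA; apply: idlMr.
    have -> : z ^+ i.+1 * (1 - z ^+ (j - i)) = pi j - pi i.
      rewrite mulrBr mulr1 -exprD addSn subnKC ?(ltnW ij) //; rewrite /pi; ring.
    exact: idlB.
  have Qx : Q i x by rewrite -[x](subrK (z ^+ i.+1)); apply: idlD => //; rewrite exprS; apply: idlMr.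
  have := coh_params pQ cQ mxs; rewrite ss ltnn => h; suff : false by []; apply: h.
  apply: fin_sub fz; apply: genI_min => y; rewrite inE mem_rcons inE.
  by move=> /or3P[/eqP->|/eqP->|/mem_genI]; [apply: sub_addl|apply: sub_addl|apply: sub_addr].
have [pQ Qpi cQ] := hQ k.
have R'0 a : R' a -> Q k a -> a = 0.
  by apply: tower_zero => //; rewrite ss.
have locR b : R b -> Q k b -> loc (Q k) (pi k) b.
  move=> [a ha hb] Qb.
  have R'z : R' z by apply: tower_in.
  (* Substituting z^(k+1) for x in b gives b' in R'. The factor z^(nk) goes into the coefficient so
     that b' is a power series in z, the form required by [serclosed]. *)
  have [b' hb'] : exists b', slim m (pser (fun n => a n * z ^+ (n * k)%N) z) b'.
    by apply: (slim_ex cB) => n; apply: expm_pser.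
  have Rb' : R' b'.
    apply: (tower_serclosed cB mz mxs cW) hb' => n; apply: (subrM hR'); [exact: ha|exact: subrX].
  have /genI1P[v ev] : genI [:: pi k] (b - b').
    apply: (krull nB lB) => N.
    have -> : b - b' = (b - \sum_(n < N) pser a x n) - (b' - \sum_(n < N) pser (fun n => a n * z ^+ (n * k)%N) z n)
       + \sum_(n < N) a n * (x ^+ n - (z ^+ k.+1) ^+ n).
      have -> : \sum_(n < N) a n * (x ^+ n - (z ^+ k.+1) ^+ n) =
          \sum_(n < N) pser a x n - \sum_(n < N) pser (fun n => a n * z ^+ (n * k)%N) z n.
        rewrite -sumrB; apply: eq_bigr => n _.
        by rewrite /pser mulrBr -exprM mulSn mulnC addnC exprD mulrA.
      by ring.
    apply: idlD; first by apply: sub_addr; apply: idlB; [exact: hb|exact: hb'].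
    apply: sub_addl; apply: idl_sum => n _; apply: idlM; rewrite subrXX; apply: idlMr; exact: mem_gen1.
  have b'0 : b' = 0.
    apply: R'0 => //; rewrite -[b'](subKr b); apply: idlB => //; rewrite ev; exact: idlM.
  by move: ev; rewrite b'0 subr0 => ->; apply: loc_gen.
have locQ b : Q k b -> loc (Q k) (pi k) b.
  move=> Qb; apply: (loc_span pQ hR locR (ys := ys)) => //.
    move=> y hy; exists (F y); have [h1 h2 _] := hF y; split=> // h3; apply: nQD.
    apply: idlM; rewrite (big_rem y) //=; exact: idlMr.
  have [u [hu e]] := span b; exists 0, u; split=> //; [exact: subr0'|by rewrite add0r].
have [||||t nt ht] := @common_mult _ nB (Q k) (Q k) (fun w => exists v, w = v * pi k) pQ.
- by move=> b /locQ.
- by move=> _ _ [v ->] [w ->]; exists (v + w); rewrite mulrDl.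
- by move=> a _ [v ->]; exists (a * v); rewrite mulrA.
- by exists 0; rewrite mul0r.
exists (Q k), (pi k), t; split=> //; split=> // h; apply: nQD; exact: idlMr.
Qed.
End CharZero.

(** * Coefficient rings *)

Section CoefficientRing.
Variables (B : idomainType) (m : idl B).
Hypothesis (nB : noeth B) (lB : locl m) (cB : cmpl m).
Local Notation Z := (zeroI B).

(* [W] plays the role of the Witt vectors of the residue field, with [z] the
   residue characteristic, or of k[[z]] when that characteristic is 0. *)
Definition datum (W : B -> Prop) z := [/\ subr W, W z,
  forall a, W a -> m a -> exists2 w, W w & a = w * z,
  serclosed m W z & forall b, exists w, W w /\ m (b - w)].

(** The m-adic closure of S. Division by z passes to the closure since, by Artin-Rees in a domain,
    (m^(N+c) : z) lies in m^N. *)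
Lemma closure_datum (S : B -> Prop) z : subr S -> S z -> m z -> z != 0 ->
  (forall a, S a -> m a -> forall N, exists w, S w /\ expI m N (a - w * z)) ->
  (forall b, exists w, S w /\ m (b - w)) ->
  datum (fun a => forall N, exists w, S w /\ expI m N (a - w)) z.
Proof.
move=> hS Sz mz z0 Sm Sres.
have cl a : S a -> forall N, exists w, S w /\ expI m N (a - w).
  by move=> Sa N; exists a; rewrite subrr; split=> //; apply: idl0.
split.
- split; first by apply: cl; apply: subr1.
  + move=> a b ha hb N; have [v [Sv hv]] := ha N; have [w [Sw hw]] := hb N.
    exists (v - w); split; first exact: subrB.
    have -> : a - b - (v - w) = (a - v) - (b - w) by ring.
    exact: idlB.
  + move=> a b ha hb N; have [v [Sv hv]] := ha N; have [w [Sw hw]] := hb N.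
    exists (v * w); split; first exact: subrM.
    have -> : a * b - v * w = (a - v) * b + v * (b - w) by ring.
    by apply: idlD; [exact: idlMr|exact: idlM].
- exact: cl.
- move=> a Wa ma.
  have app N : exists w, S w /\ expI m N (a - w * z).
    have [v [Sv hv]] := Wa N.+1.
    have mv : m v by rewrite -[v](subKr a); apply: idlB => //; apply: (expI_sub (ltn0Sn N) hv).
    have [w [Sw hw]] := Sm v Sv mv N; exists w; split=> //.
    rewrite -[a](subrK v) -addrA; apply: idlD => //; exact: (expI_le (leqnSn N) hv).
  have /genI1P[b eb] : genI [:: z] a.
    apply: (krull nB lB) => N; have [w [_ hw]] := app N; rewrite -[a](subrK (w * z)).
    by apply: idlD; [exact: sub_addr|apply: sub_addl; apply: idlM; exact: mem_gen1].
  exists b => // N; have [s es] := nB m; have [c hc] := artin_rees nB Z z s.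
  have [w [Sw hw]] := app (N + c)%N; exists w; split=> //.
  have := hc N (b - w); rewrite -es zero_addI addIC addI_idr.
    by apply; rewrite colP mulrBr ![z * _]mulrC -eb.
  move=> y; rewrite colP => /eqP; rewrite mulf_eq0 (negPf z0) /= => /eqP ->; exact: idl0.
- move=> w l hw hl N.
  have /choice[v hv] n : exists v, S v /\ expI m N (w n - v) by apply: hw.
  exists (\sum_(n < N) v n * z ^+ n); split.
    by apply: subr_sum => // n _; apply: subrM => //; [case: (hv n)|apply: subrX].
  rewrite -[l](subrK (\sum_(n < N) pser w z n)) -addrA; apply: idlD; first exact: hl.
  by rewrite -sumrB; apply: idl_sum => n _; rewrite /pser -mulrBl; apply: idlMr; case: (hv n).
- by move=> b; have [w [Sw hw]] := Sres b; exists w; split=> //; apply: cl.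
Qed.

Lemma taylor2 (g : {poly B}) : forall u h, exists c, g.[u + h] = g.[u] + h * (g^`().[u] + h * c).
Proof.
elim/poly_ind: g => [|g a IH] u h.
  by exists 0; rewrite deriv0 !horner0; ring.
have [c e] := IH u h; exists (g^`().[u] + (u + h) * c).
rewrite derivD derivM derivC derivX !(hornerD, hornerM, hornerC, hornerX) e mulr1 addr0; ring.
Qed.

Lemma horner_cong (J : idl B) (g : {poly B}) a b : J (a - b) -> J (g.[a] - g.[b]).
Proof.
move=> h; have [c] := taylor2 g b (a - b); rewrite addrC subrK => ->.
by rewrite addrAC subrr add0r; apply: idlMr.
Qed.

Lemma hensel (g : {poly B}) u : m g.[u] -> ~ m g^`().[u] -> exists u', g.[u'] = 0 /\ m (u' - u).
Proof.
(* Newton's method with the fixed inverse v of the derivative at u; linear convergence is enough. *)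
move=> gu /lB.2[v hv]; pose w n := iter n (fun x => x - g.[x] * v) u.
have hw n : expI m n.+1 g.[w n] /\ m (w n - u).
  elim: n => [|n [IH1 IH2]]; first by rewrite /= prodI1 subrr; split=> //; apply: idl0.
  have mg : m g.[w n] by apply: (expI_sub (ltn0Sn n) IH1).
  split; last by rewrite /= -addrAC; apply: idlB => //; apply: idlMr.
  have [c e] := taylor2 g (w n) (- (g.[w n] * v)).
  have -> : g.[w n.+1] = g.[w n] * (v * (g^`().[u] - g^`().[w n]) + g.[w n] * (v * v * c)).
    by rewrite /= e -[X in X + _ = _]mulr1 -hv; ring.
  rewrite -[n.+2]addn1; apply: expI_memM => //; rewrite /= prodI1; apply: idlD; last exact: idlMr.
  by apply: idlM; rewrite -opprB; apply: idlN; apply: horner_cong.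
have [|l hl] := cB.2 w.
  move=> n; rewrite /= addrAC subrr add0r; apply/idlN/idlMr.
  exact: (expI_le (leqnSn n) (hw n).1).
exists l; split.
  apply: cB.1 => n; rewrite -[g.[l]](subrK g.[w n]); apply: idlD; first exact/horner_cong.
  exact: (expI_le (leqnSn n) (hw n).1).
rewrite -[l](subrK (w 1%N)) -addrA; apply: idlD; last by case: (hw 1%N).
by have := hl 1%N; rewrite [expI _ _]prodI1.
Qed.

Section ResidueZero.
Hypothesis res0 : forall n, ~ m n.+1%:R.

Lemma res0_neq0 n : n.+1%:R != 0 :> B.
Proof. by apply/eqP => e; apply: (res0 (n := n)); rewrite e; apply: idl0. Qed.

(** S is maximal among the subrings meeting m in 0. If u satisfies no relation over S modulo m, S[u]
    is again such a subring; otherwise a relation of least size is separable, and Hensel's lemma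
    gives a lift u' of the residue of u with S[u'] such a subring. *)
Lemma coef_field : exists S, [/\ subr S, forall a, S a -> m a -> a = 0
  & forall b, exists w, S w /\ m (b - w)].
Proof.
pose P S := subr S /\ forall a : B, S a -> m a -> a = 0.
have [||S [[hS Sm] Smax]] := @zorn_pred B P (fun a => exists u v : nat, a = u%:R - v%:R).
- split; first split.
  + by exists 1%N, 0%N; rewrite subr0.
  + by move=> _ _ [u [v ->]] [u' [v' ->]]; exists (u + v')%N, (v + u')%N; rewrite !natrD; ring.
  + move=> _ _ [u [v ->]] [u' [v' ->]]; exists (u * u' + v * v')%N, (u * v' + v * u')%N.
    by rewrite !natrD !natrM; ring.
  + move=> _ [u [v ->]]; case: (ltngtP u v) => [lt|lt|->]; last by rewrite subrr.
      rewrite -opprB -natrB ?(ltnW lt) // => /idlN; rewrite opprK.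
      by move: lt; rewrite -subn_gt0; case: (v - u)%N => // k _ /res0.
    rewrite -natrB ?(ltnW lt) //.
    by move: lt; rewrite -subn_gt0; case: (u - v)%N => // k _ /res0.
- move=> C [V0 CV0] hC totC; split; last by move=> a [V CV Va]; case: (hC V CV) => _; apply.
  split.
  + by exists V0 => //; apply: subr1; case: (hC _ CV0).
  + move=> y z [V CV Vy] [W CW Wz]; case: (totC _ _ CV CW) => h.
      by exists W => //; apply: subrB; [case: (hC _ CW)|exact: h|].
    by exists V => //; apply: subrB; [case: (hC _ CV)| |exact: h].
  + move=> y z [V CV Vy] [W CW Wz]; case: (totC _ _ CV CW) => h.
      by exists W => //; apply: subrM; [case: (hC _ CW)|exact: h|].
    by exists V => //; apply: subrM; [case: (hC _ CV)| |exact: h].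
exists S; split=> // u.
have adjS t : (forall a, polyext S t a -> m a -> a = 0) -> S t.
  move=> h; apply: (Smax (polyext S t)); [split=> //; exact: polyext_subr|by move=> a; apply: polyext_in|exact: polyext_gen].
have [[g [hg g0 mg]]|ng] := EM (exists g, [/\ pover S g, g != 0 & m g.[u]]); last first.
  exists u; rewrite subrr; split; last exact: idl0.
  apply: adjS => _ [g hg ->] mg; apply: contrapT => nz; apply: ng; exists g; split=> //.
  by apply: contra_notN nz => /eqP ->; rewrite horner0.
have {g hg g0 mg} [g [hg g0 mg] gmin] : exists2 g, [/\ pover S g, g != 0 & m g.[u]]
    & forall h, pover S h -> m h.[u] -> (size h < size g)%N -> h = 0.
  have [n] := ubnP (size g); elim: n g hg g0 mg => // n IH g hg g0 mg; rewrite ltnS => gn.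
  have [[h [hh mh lt h0]]|nh] := EM (exists h, [/\ pover S h, m h.[u], (size h < size g)%N & h != 0]).
    by apply: (IH h) => //; apply: leq_trans gn.
  by exists g => // h hh mh lt; apply: contrapT => /eqP h0; apply: nh; exists h.
have sg : (1 < size g)%N.
  rewrite ltnNge; apply/negP => /size1_polyC eg; move: mg; rewrite eg hornerC => /Sm e.
  by move: g0; rewrite eg e ?eqxx.
have d0 : g^`() != 0.
  have /eqP : g^`()`_(size g).-2 != 0.
    rewrite coef_deriv -mulr_natr mulf_neq0 ?res0_neq0 //.
    by rewrite prednK -?lead_coefE ?lead_coef_eq0 //; lia.
  by apply: contra_not_neq => ->; rewrite coef0.
have [|u' [gu' mu']] := @hensel g u mg.
  move=> mg'; case/eqP: d0; apply: gmin => //; first exact: pover_deriv.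
  by rewrite lt_size_deriv // -size_poly_gt0; lia.
exists u'; split; last by rewrite -opprB; apply: idlN.
apply: adjS => _ [h hh ->] mh.
(* Pseudo-division by g leaves a remainder of smaller size that vanishes at u modulo m, so it is 0;
   since g(u') = 0 and B is a domain, h(u') = 0. *)
have [k [q [r [hq hr lt e]]]] := pover_pdiv hS hg hh (ltnW sg).
have e' : lead_coef g ^+ k * h.[u'] = r.[u'].
  by have := congr1 (horner^~ u') e; rewrite /= hornerZ hornerD hornerM gu' mulr0 add0r.
have r0 : r = 0.
  apply: gmin => //; rewrite -[r.[u]](subKr r.[u']); apply: idlB; first by rewrite -e'; apply: idlM.
  exact: horner_cong.
move/eqP: e'; rewrite r0 horner0 mulf_eq0 expf_eq0 lead_coef_eq0 (negPf g0) andbF /=.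
by move/eqP.
Qed.

Lemma datum_res0 z : m z -> z != 0 -> exists W, datum W z.
Proof.
move=> mz z0; have [S [hS Sm Sres]] := coef_field.
eexists; apply: (@closure_datum (polyext S z)) => //; [exact: polyext_subr|exact: polyext_gen| |].
- move=> _ [g hg ->] mg N; have g00 : g`_0 = 0.
    apply: Sm => //; rewrite -[g`_0]horner_coef0 -[g.[0]](subKr g.[z]); apply: idlB => //.
    by apply: horner_cong; rewrite subr0.
  exists (drop_poly 1 g).[z]; split.
    by exists (drop_poly 1 g) => // i; rewrite coef_drop_poly; apply: hg.
  rewrite -{1}[g](poly_take_drop 1) hornerD hornerM hornerXn expr1.
  rewrite addrK; suff -> : take_poly 1 g = 0 by rewrite horner0; apply: idl0.
  apply/polyP => i; rewrite coef_take_poly coef0; case: ltnP => //; by case: i.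
- by move=> b; have [w [Sw hw]] := Sres b; exists w; split=> //; apply: polyext_in.
Qed.
End ResidueZero.
End CoefficientRing.

(** * Congruences modulo p and Teichmüller representatives *)

Section FrobeniusLift.
Variables (B : comNzRingType) (S : B -> Prop) (p : nat).
Hypotheses (hS : subr S) (pp : prime.prime p).

Definition pcong a b := exists2 w, S w & a - b = w * p%:R.

Lemma pcong_refl a : pcong a a.
Proof. by exists 0; [exact: subr0'|rewrite subrr mul0r]. Qed.
Lemma pcong_trans a b c : pcong a b -> pcong b c -> pcong a c.
Proof.
move=> [v Sv e] [w Sw e']; exists (v + w); first exact: subrD.
by rewrite mulrDl -e -e'; ring.
Qed.
Lemma pcongB a b c d : pcong a b -> pcong c d -> pcong (a - c) (b - d).
Proof.
move=> [v Sv e] [w Sw e']; exists (v - w); first exact: subrB.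
by rewrite mulrBl -e -e'; ring.
Qed.
Lemma pcongD a b c d : pcong a b -> pcong c d -> pcong (a + c) (b + d).
Proof.
move=> [v Sv e] [w Sw e']; exists (v + w); first exact: subrD.
by rewrite mulrDl -e -e'; ring.
Qed.
Lemma pcongX n a b : S a -> S b -> pcong a b -> pcong (a ^+ n) (b ^+ n).
Proof.
move=> Sa Sb [w Sw e]; exists (w * \sum_(i < n) a ^+ (n.-1 - i) * b ^+ i).
  by apply: subrM => //; apply: subr_sum => // i _; apply: subrM => //; apply: subrX.
by rewrite subrXX e mulrAC.
Qed.
Lemma pcong_frob a b : S a -> S b -> pcong ((a + b) ^+ p) (a ^+ p + b ^+ p).
Proof.
move=> Sa Sb; have p0 := prime_gt0 pp.
pose c (i : nat) := a ^+ (p - i) * b ^+ i *+ ('C(p, i) %/ p).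
exists (\sum_(1 <= i < p) c i).
  by apply: subr_sum => // i _; rewrite /c -mulr_natr; apply: (subrM hS); [apply: (subrM hS); exact: subrX|exact: subr_nat].
rewrite exprDn -(big_mkord xpredT (fun i => a ^+ (p - i) * b ^+ i *+ 'C(p, i))).
rewrite big_nat_recr //= big_ltn // subn0 subnn !expr0 mulr1 mul1r bin0 binn !mulr1n.
rewrite opprD addrACA subrr addr0 addrAC subrr add0r mulr_suml.
by apply: eq_big_nat => i hi; rewrite /c mulr_natr -mulrnA divnK ?prime_dvd_bin.
Qed.

Lemma pcong_frobn n a b : S a -> S b -> pcong ((a + b) ^+ (p ^ n)) (a ^+ (p ^ n) + b ^+ (p ^ n)).
Proof.
move=> Sa Sb; elim: n => [|n IH]; first by rewrite expn0 !expr1; apply: pcong_refl.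
rewrite expnSr !exprM; apply: (pcong_trans (b := (a ^+ (p ^ n) + b ^+ (p ^ n)) ^+ p)).
  by apply: pcongX => //; [apply: subrX => //; apply: subrD|apply: subrD => //; apply: subrX].
by apply: pcong_frob; apply: subrX.
Qed.
Lemma pcong_frobnB n a b : S a -> S b -> pcong ((a - b) ^+ (p ^ n)) (a ^+ (p ^ n) - b ^+ (p ^ n)).
Proof.
move=> Sa Sb; have := pcong_frobn n (subrB hS Sa Sb) Sb; rewrite subrK => h.
have := pcongB h (pcong_refl (b ^+ (p ^ n))); rewrite addrK => -[w Sw e].
exists (- w); first by apply: subrN.
by rewrite mulNr -e !opprB addrA.
Qed.
Lemma pcong_frobn_sum n (us : seq B) : (forall u, u \in us -> S u) ->
  pcong ((\sum_(u <- us) u) ^+ (p ^ n)) (\sum_(u <- us) u ^+ (p ^ n)).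
Proof.
elim: us => [|u us IH] h.
  by rewrite !big_nil expr0n expn_eq0 -leqn0 leqNgt prime_gt0 //=; apply: pcong_refl.
have h' v : v \in us -> S v by move=> hv; apply: h; rewrite inE hv orbT.
rewrite !big_cons; have Su := h u (mem_head _ _).
have Ss : S (\sum_(v <- us) v) by rewrite big_seq; apply: subr_sum => // v; apply: h'.
apply: (pcong_trans (pcong_frobn n Su Ss)); apply: pcongD; [exact: pcong_refl|exact: IH].
Qed.
End FrobeniusLift.

Section Teichmueller.
Variables (B : idomainType) (m : idl B) (p : nat).
Hypotheses (nB : noeth B) (lB : locl m) (cB : cmpl m) (kB : kclosed m)
  (pp : prime.prime p) (mp : m p%:R).

(** Teichmüller representatives, described by coherent p-power roots: this is multiplicative and
    provides p^N-th roots of the same kind. *)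
Definition teich t := exists s : nat -> B, s 0%N = t /\ forall n, s n.+1 ^+ p = s n.
Definition tspan b := exists us vs : seq B, [/\ forall u, u \in us -> teich u,
  forall v, v \in vs -> teich v & b = \sum_(u <- us) u - \sum_(v <- vs) v].

Lemma teich1 : teich 1. Proof. by exists (fun=> 1); split=> // n; rewrite expr1n. Qed.
Lemma teichM t u : teich t -> teich u -> teich (t * u).
Proof.
move=> [s [<- hs]] [r [<- hr]]; exists (fun n => s n * r n); split=> // n.
by rewrite exprMn hs hr.
Qed.
Lemma teich_root n t : teich t -> exists u, teich u /\ u ^+ (p ^ n) = t.
Proof.
move=> [s [<- hs]]; exists (s n); split.
  by exists (fun k => s (n + k)%N); split=> [|k]; rewrite ?addn0 // addnS.
by elim: n => [|n IH]; rewrite ?expn0 ?expr1 // expnS exprM hs.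
Qed.
Lemma tspan_teich t : teich t -> tspan t.
Proof.
move=> ht; exists [:: t], [::]; split=> //; first by move=> u; rewrite inE => /eqP ->.
by rewrite big_seq1 big_nil subr0.
Qed.
Lemma tspan_subr : subr tspan.
Proof.
have catT (us vs : seq B) : (forall u, u \in us -> teich u) -> (forall u, u \in vs -> teich u) ->
    forall u, u \in us ++ vs -> teich u.
  by move=> h1 h2 u; rewrite mem_cat => /orP[/h1|/h2].
split; first exact/tspan_teich/teich1.
- move=> _ _ [us [vs [hu hv ->]]] [us' [vs' [hu' hv' ->]]].
  exists (us ++ vs'), (vs ++ us'); split; try exact: catT.
  by rewrite !big_cat /=; ring.
- move=> _ _ [us [vs [hu hv ->]]] [us' [vs' [hu' hv' ->]]].
  pose X (s t : seq B) := [seq x * y | x <- s, y <- t].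
  have hX s t : (forall u, u \in s -> teich u) -> (forall u, u \in t -> teich u) ->
      forall u, u \in X s t -> teich u.
    by move=> h1 h2 _ /allpairsP[[x y] /= [hx hy ->]]; apply: teichM; [exact: h1|exact: h2].
  have eX s t : \sum_(u <- X s t) u = (\sum_(u <- s) u) * \sum_(u <- t) u.
    rewrite big_allpairs_dep mulr_suml; apply: eq_bigr => x _; by rewrite mulr_sumr.
  exists (X us us' ++ X vs vs'), (X us vs' ++ X vs us'); split; try by apply: catT; apply: hX.
  by rewrite !big_cat /= !eX; ring.
Qed.

(** Modulo p, a is (U - V)^(p^N), where U and V are sums of p^N-th roots of its terms. As a and p
    lie in m, so does U - V, and the power lies in m^N. *)
Lemma tspan_m a : tspan a -> m a -> forall N, exists w, tspan w /\ expI m N (a - w * p%:R).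
Proof.
move=> [us [vs [hu hv ea]]] ma N; have hS := tspan_subr.
have /choice[r hr] t : exists u, teich t -> teich u /\ u ^+ (p ^ N) = t.
  by have [/(teich_root N)[u hu']|h] := EM (teich t); [exists u|exists 0].
have rS (s : seq B) : (forall u, u \in s -> teich u) -> forall u, u \in [seq r t | t <- s] -> tspan u.
  by move=> h _ /mapP[t /h /hr[h' _] ->]; apply: tspan_teich.
have rE (s : seq B) : (forall u, u \in s -> teich u) -> \sum_(u <- [seq r t | t <- s]) u ^+ (p ^ N) = \sum_(u <- s) u.
  by move=> h; rewrite big_map big_seq [RHS]big_seq; apply: eq_bigr => u /h /hr[].
pose U := \sum_(u <- [seq r t | t <- us]) u; pose V := \sum_(u <- [seq r t | t <- vs]) u.
have SU : tspan U by rewrite /U big_seq; apply: subr_sum => // u; apply: rS.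
have SV : tspan V by rewrite /V big_seq; apply: subr_sum => // u; apply: rS.
have [w Sw ew] : pcong tspan p ((U - V) ^+ (p ^ N)) a.
  apply: (pcong_trans hS (pcong_frobnB hS pp N SU SV)).
  rewrite ea -(rE us hu) -(rE vs hv); apply: pcongB => //; apply: pcong_frobn_sum => //; exact: rS.
have mUV : m (U - V).
  apply: (primeX (n := p ^ N) (m_prime lB)); rewrite -[_ ^+ _](subrK a) ew.
  by apply: idlD => //; apply: idlM.
exists (- w); split; first by apply: subrN.
rewrite mulNr -ew opprK addrC subrK.
by apply: (expI_le (ltnW (ltn_expl N (prime_gt1 pp)))); apply: expI_mem.
Qed.

Lemma powp_cong i a b : expI m i.+1 (a - b) -> expI m i.+2 (a ^+ p - b ^+ p).
Proof.
move=> h; rewrite subrXX -addn1; apply: expI_memM => //; rewrite /= prodI1.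
have mab : m (a - b) by apply: expI_sub h.
have -> : \sum_(j < p) a ^+ (p.-1 - j) * b ^+ j =
   \sum_(j < p) (a ^+ (p.-1 - j) - b ^+ (p.-1 - j)) * b ^+ j + p%:R * b ^+ p.-1.
  have -> : p%:R * b ^+ p.-1 = \sum_(j < p) b ^+ p.-1 by rewrite sumr_const card_ord mulr_natl.
  rewrite -big_split; apply: eq_bigr => j _ /=.
  by rewrite mulrBl -exprD subnK ?subrK //; have := ltn_ord j; lia.
apply: idlD; last exact: idlMr.
by apply: idl_sum => j _; apply: idlMr; rewrite subrXX; apply: idlMr.
Qed.

(** v is a sequence of successive p-th roots modulo m starting at u. By [powp_cong] the powers
    v_(n+j)^(p^j) converge as j grows, and their limits t_n satisfy t_(n+1)^p = t_n. *)
Lemma teich_res u : exists t, teich t /\ m (u - t).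
Proof.
have pg := prime_gt0 pp.
have /choice[r hr] d : exists a, m (a ^+ p - d).
  have [|a ha] := kB (monicXnsubC d pg); first by rewrite size_XnsubC ?ltnS.
  by exists a; move: ha; rewrite hornerD hornerN hornerC hornerXn.
pose v n := iter n r u.
have pw k j : expI m j.+1 (v k.+1 ^+ (p ^ j.+1) - v k ^+ (p ^ j)).
  elim: j => [|j IH]; first by rewrite expn1 expn0 expr1 expI1; apply: hr.
  have e a i : a ^+ (p ^ i.+1) = (a ^+ (p ^ i)) ^+ p :> B by rewrite expnSr exprM.
  by rewrite (e (v k.+1) j.+1) (e (v k) j); apply: powp_cong.
have /choice[t ht] n : exists t, forall j, expI m j (t - v (n + j)%N ^+ (p ^ j)).
  apply: cB.2 => j; rewrite addnS; exact: (expI_le (leqnSn j) (pw _ j)).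
exists (t 0%N); split.
  exists t; split=> // n; apply/eqP; rewrite -subr_eq0; apply/eqP; apply: cB.1 => j.
  have -> : t n.+1 ^+ p - t n = (t n.+1 ^+ p - v (n + j.+1)%N ^+ (p ^ j.+1)) - (t n - v (n + j.+1)%N ^+ (p ^ j.+1)) by ring.
  apply: idlB; last exact: (expI_le (leqnSn j) (ht n j.+1)).
  by rewrite expnSr exprM subrXX; apply: idlMr; rewrite -addSnnS; apply: ht.
have -> : u - t 0%N = - (t 0%N - v 1%N ^+ p) - (v 1%N ^+ p - u) by ring.
apply: idlB; last exact: hr.
by apply: idlN; have := ht 0%N 1%N; rewrite [expI _ _]prodI1 add0n expn1.
Qed.

Lemma datum_mixed : p%:R != 0 :> B -> exists W, datum m W p%:R.
Proof.
move=> p0; eexists; apply: (@closure_datum _ m nB lB tspan p%:R) => //.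
- exact: tspan_subr.
- by apply: subr_nat; exact: tspan_subr.
- exact: tspan_m.
- by move=> b; have [t [ht mt]] := teich_res b; exists t; split=> //; apply: tspan_teich.
Qed.
End Teichmueller.

Section Good.
Variables (B : idomainType) (m : idl B).
Hypotheses (nB : noeth B) (lB : locl m) (cB : cmpl m) (kB : kclosed m).

Lemma good_ex (c : B) d : c != 0 -> coh_ge (zeroI B) d.+2 -> ~ coh_ge (zeroI B) d.+3 -> good_at c d.
Proof.
move=> c0 cZ ncZ.
have [[n /eqP n0]|/forallNP char0] := EM (exists n, n.+1%:R = 0 :> B).
  suff [p pp /eqP e] : exists2 p, prime.prime p & p%:R == 0 :> B.
    exact: (good_charp nB lB cB kB pp e).
  elim/ltn_ind: n n0 => n IH n0; have [pr|np] := boolP (prime.prime n.+1); first by exists n.+1.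
  have n1 : (0 < n)%N by case: (n) n0 => //; rewrite oner_eq0.
  have := pdiv_dvd n.+1; have := pdiv_prime (n := n.+1) n1; move: (pdiv _) => q pq /dvdnP[k ek].
  move: n0; rewrite ek natrM mulf_eq0 => /orP[k0|q0]; last by exists q.
  case: k ek k0 => // k ek k0; apply: (IH k) => //.
  rewrite -ltnS ek ltn_Pmulr //; exact: prime_gt1.
have {}char0 n : n.+1%:R != 0 :> B by apply/eqP/char0.
suff [W [z [z0 mz [hW Wz Wm cW Wr]]]] : exists W z, [/\ z != 0, m z & datum m W z].
  exact: (good_char0 nB lB cB hW Wz mz z0 Wm cW Wr char0 c0 cZ ncZ).
have [[n mn]|nn] := EM (exists n, m n.+1%:R); last first.
  have [z mz z0] : exists2 z, m z & z != 0.
    apply: contrapT => hn; have mZ : m = zeroI B.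
      apply: idl_anti; last exact: zero_sub.
      by move=> z mz; apply: contrapT => /eqP z0; apply: hn; exists z.
    by apply: (coh_m lB); rewrite mZ; apply: coh_ge_le cZ.
  have [|W hW] := datum_res0 nB lB cB _ mz z0; first by move=> n h; apply: nn; exists n.
  by exists W, z.
suff [p pp mp] : exists2 p, prime.prime p & m p%:R.
  have p0 : p%:R != 0 :> B by rewrite -(prednK (prime_gt0 pp)).
  by have [W hW] := datum_mixed nB lB cB kB pp mp p0; exists W, p%:R.
elim/ltn_ind: n mn => n IH mn; have [pr|np] := boolP (prime.prime n.+1); first by exists n.+1.
have n1 : (0 < n)%N by case: (n) mn => // /lB.1.
have := pdiv_dvd n.+1; have := pdiv_prime (n := n.+1) n1; move: (pdiv _) => q pq /dvdnP[k ek].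
move: mn; rewrite ek natrM => /(m_prime lB).2[k0|q0]; last by exists q.
case: k ek k0 => // k ek k0; apply: (IH k) => //.
rewrite -ltnS ek ltn_Pmulr //; exact: prime_gt1.
Qed.
End Good.

(** * Passing to quotient domains *)

Section QuotientDomain.
Variables (A : comNzRingType) (P : idl A).

(* The proof is an argument so that the ideal structure can be inferred. *)
Definition dpred (pP : primeI P) : {pred A} := fun a => `[< P a >].
Variable pP : primeI P.

Lemma dpred_closed : idealr_closed (dpred pP).
Proof.
split; [exact/asboolP/idl0|exact/asboolP/pP.1|].
move=> a x y /asboolP hx /asboolP hy; apply/asboolP.
by apply: idlD => //; apply: idlM.
Qed.
HB.instance Definition _ := isIdealr.Build A (dpred pP) dpred_closed.

Definition dom := {ideal_quot (dpred pP)}.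
HB.instance Definition _ := GRing.ComNzRing.on dom.

Definition dom_pi : {rmorphism A -> dom} := \pi_({ideal_quot (dpred pP)})%qT.

Lemma dom_pi0 a : dom_pi a = 0 <-> P a.
Proof.
have e := Quotient.idealrBE (dpred pP) a 0; rewrite subr0 in e.
have e0 : dom_pi 0 = 0 by exact: rmorph0.
split=> [h|h]; last by rewrite -e0; apply/eqP; rewrite -[_ == _]e; apply/asboolP.
by apply/asboolP; rewrite -[`[< _ >]]/(a \in dpred pP) e; apply/eqP; rewrite -[RHS]/(dom_pi 0) e0.
Qed.
Lemma dom_pi_surj b : exists a, dom_pi a = b.
Proof. by elim/quotW: b => a; exists a. Qed.

Definition dom_unit : {pred dom} := fun x => `[< exists y, y * x = 1 >].
Definition dom_inv (x : dom) : dom :=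
  if pselect (exists y, y * x = 1) is left h then projT1 (cid h) else x.
Lemma dom_mulVx : {in dom_unit, left_inverse 1 dom_inv *%R}.
Proof. by move=> x /asboolP h; rewrite /dom_inv; case: pselect => // h'; case: cid. Qed.
Lemma dom_unitPl (x y : dom) : y * x = 1 -> dom_unit x.
Proof. by move=> h; apply/asboolP; exists y. Qed.
Lemma dom_invr_out : {in [predC dom_unit], dom_inv =1 id}.
Proof. by move=> x /asboolPn h; rewrite /dom_inv; case: pselect. Qed.
HB.instance Definition _ := GRing.ComNzRing_hasMulInverse.Build dom dom_mulVx dom_unitPl dom_invr_out.

Lemma dom_integral : GRing.integral_domain_axiom dom.
Proof.
move=> x y; have [a <-] := dom_pi_surj x; have [b <-] := dom_pi_surj y.
rewrite -rmorphM => /dom_pi0/pP.2[/dom_pi0->|/dom_pi0->]; by rewrite eqxx ?orbT.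
Qed.
HB.instance Definition _ := GRing.ComUnitRing_isIntegral.Build dom dom_integral.

Lemma quot_domain : exists (B : idomainType) (f : {rmorphism A -> B}),
  (forall b, exists a, f a = b) /\ forall a, f a = 0 <-> P a.
Proof. by exists dom, dom_pi; split; [exact: dom_pi_surj|exact: dom_pi0]. Qed.
End QuotientDomain.

Section Transfer.
Variables (A B : comNzRingType) (P : idl A) (f : {rmorphism A -> B}).
Hypotheses (f_surj : forall b, exists a, f a = b) (f_ker : forall a, f a = 0 <-> P a).
Implicit Types (J K L : idl A) (X Y : idl B).

Program Definition pullI X : idl A := @Idl A (fun a => X (f a)) _.
Next Obligation.
split; first by rewrite rmorph0; apply: idl0.
- by move=> a b ha hb; rewrite rmorphD; apply: idlD.
- by move=> a b hb; rewrite rmorphM; apply: idlM.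
Qed.
Program Definition imgI J : idl B := @Idl B (fun b => exists2 a, J a & f a = b) _.
Next Obligation.
split; first by exists 0; [apply: idl0|rewrite rmorph0].
- by move=> _ _ [a ha <-] [b hb <-]; exists (a + b); [apply: idlD|rewrite rmorphD].
- move=> c _ [b hb <-]; have [a <-] := f_surj c.
  by exists (a * b); [apply: idlM|rewrite rmorphM].
Qed.

Lemma preE X a : pullI X a = X (f a). Proof. by []. Qed.
Lemma f_eq a b : f a = f b -> P (a - b).
Proof. by move=> e; apply/f_ker; rewrite rmorphB e subrr. Qed.
Lemma preI_ker X : P <=I pullI X.
Proof. by move=> a /f_ker e; rewrite preE e; apply: (idl0 X). Qed.
Lemma preK J : P <=I J -> pullI (imgI J) = J.
Proof.
move=> PJ; apply: idl_eq => a; split=> [[b Jb /f_eq e]|Ja]; last by exists a.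
by rewrite -[a](subKr b); apply: idlB => //; apply: PJ.
Qed.
Lemma imgK X : imgI (pullI X) = X.
Proof.
apply: idl_eq => b; split=> [[a Xa <-] //|Xb].
by have [a e] := f_surj b; exists a => //; rewrite preE e.
Qed.
Lemma img_mono J K : J <=I K -> imgI J <=I imgI K.
Proof. by move=> h _ [a /h ha <-]; exists a. Qed.
Lemma pre_mono X Y : X <=I Y -> pullI X <=I pullI Y.
Proof. by move=> h a; apply: h. Qed.
Lemma img_top : imgI (topI A) = topI B.
Proof. by apply: idl_eq => b; split=> // _; have [a <-] := f_surj b; exists a. Qed.
Lemma pre_top : pullI (topI B) = topI A.
Proof. by apply: idl_eq => b; split. Qed.
Lemma img_gen s : imgI (genI s) = genI [seq f a | a <- s].
Proof.
apply: idl_anti.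
  move=> _ [a ha <-]; have := genI_min (J := pullI (genI [seq f a | a <- s])) _ ha; apply.
  by move=> x hx; apply/mem_genI/map_f.
by apply: genI_min => _ /mapP[a ha ->]; exists a => //; apply: mem_genI.
Qed.
Lemma img_prod J K : imgI (prodI J K) = prodI (imgI J) (imgI K).
Proof.
apply: idl_anti.
  move=> _ [a ha <-].
  have : prodI J K <=I pullI (prodI (imgI J) (imgI K)).
    apply: prodI_min => x y hx hy; rewrite preE rmorphM.
    by apply: prodI_mem; [exists x|exists y].
  exact.
apply: prodI_min => _ _ [a ha <-] [b hb <-]; rewrite -rmorphM; exists (a * b) => //.
exact: prodI_mem.
Qed.
Lemma img_exp J n : imgI (expI J n) = expI (imgI J) n.
Proof. by elim: n => [|n IH] /=; [exact: img_top|rewrite img_prod IH]. Qed.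
Lemma img_add J : imgI (addI P J) = imgI J.
Proof.
apply: idl_anti; last by apply: img_mono; apply: sub_addr.
by move=> _ [_ [x [y [/f_ker Px Jy ->]]] <-]; exists y => //; rewrite rmorphD Px add0r.
Qed.

Lemma noeth_img : noeth A -> noeth B.
Proof.
move=> nA X; have [s es] := nA (pullI X); exists [seq f a | a <- s].
by rewrite -img_gen -es imgK.
Qed.
Lemma prime_pre X : primeI X -> primeI (pullI X).
Proof.
move=> [h1 hM]; split; first by rewrite preE rmorph1.
by move=> x y; rewrite preE rmorphM; apply: hM.
Qed.
Lemma prime_img J : P <=I J -> primeI J -> primeI (imgI J).
Proof.
move=> PJ [h1 hM]; have e a : imgI J (f a) = J a by rewrite -[in RHS](preK PJ).
split; first by rewrite -(rmorph1 f) e.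
move=> x y; have [a <-] := f_surj x; have [b <-] := f_surj y.
by rewrite -rmorphM !e; apply: hM.
Qed.
Lemma coh_img J n : P <=I J -> coh_ge (imgI J) n <-> coh_ge J n.
Proof.
elim: n J => [//|n IH] J PJ; split=> -[Q [pQ JQ nQ cQ]].
  have PQ := preI_ker Q; exists (pullI Q); split; [exact: prime_pre| | |].
  - by rewrite -(preK PJ); apply: pre_mono.
  - by move=> e; apply: nQ; rewrite -e imgK.
  - by apply/(IH _ PQ); rewrite imgK.
have PQ := subI_trans PJ JQ; exists (imgI Q); split; [exact: prime_img|exact: img_mono| |exact/IH].
by move=> e; apply: nQ; rewrite -(preK PQ) e preK.
Qed.
Lemma rch_morph (C D : comNzRingType) (phi : idl C -> idl D) (U V : idl C) n :
  (forall (K L : idl C), U <=I K -> K <=I L -> L <=I V -> phi K <=I phi L) ->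
  (forall (K L : idl C), U <=I K -> K <=I L -> L <=I V -> phi K = phi L -> K = L) ->
  rch n U V -> rch n (phi U) (phi V).
Proof.
elim: n U => [|n IH] U hm hi /=; first by move=> h; apply: hm.
case=> K [hK nK hr]; have KY := rch_sub hr; exists (phi K); split.
- exact: hm.
- by move=> e; apply: nK; apply/esym/hi.
- apply: IH hr => K' L h1 h2 h3; [apply: hm|apply: hi] => //; exact: subI_trans h1.
Qed.
Lemma rch_img J n : P <=I J -> rch n (imgI J) (topI B) <-> rch n J (topI A).
Proof.
move=> PJ; split=> h.
  rewrite -(preK PJ) -pre_top; apply: (rch_morph (phi := pullI)) h; first by move=> *; apply: pre_mono.
  by move=> K L _ _ _ e; rewrite -[K]imgK e imgK.
rewrite -img_top; apply: (rch_morph (phi := imgI)) h; first by move=> *; apply: img_mono.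
move=> K L JK KL _ e; have PK := subI_trans PJ JK.
by rewrite -(preK PK) e preK //; apply: subI_trans KL.
Qed.
Lemma lam_img J : P <=I J -> fin (imgI J) -> lam (imgI J) = lam J.
Proof.
move=> PJ /lamP[h1 h2]; apply/esym/lamE; split; first by apply/(rch_img _ PJ).
by move=> n /(rch_img _ PJ); apply: h2.
Qed.

Variable m : idl A.
Hypotheses (nA : noeth A) (lA : locl m) (Pm : P <=I m).

Lemma locl_img : locl (imgI m).
Proof.
have e a : imgI m (f a) = m a by rewrite -[in RHS](preK Pm).
split; first by rewrite -(rmorph1 f) e; apply: lA.1.
move=> x; have [a <-] := f_surj x; rewrite e => /lA.2[b hb].
by exists (f b); rewrite -rmorphM hb rmorph1.
Qed.
(** Separatedness is the closedness of P from [krull]; a Cauchy sequence is lifted difference by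
    difference. *)
Lemma cmpl_img : cmpl m -> cmpl (imgI m).
Proof.
move=> [_ cA]; split=> [x|u hu].
  have [a <-] := f_surj x => h; apply/f_ker/(krull nA lA) => n.
  have [b hb /f_eq e] : imgI (expI m n) (f a) by rewrite img_exp.
  rewrite -[a](subKr b); apply: idlB; [exact: sub_addr|exact: sub_addl].
have /choice[e he] n : exists e, expI m n e /\ f e = u n.+1 - u n.
  by have := hu n; rewrite -img_exp => -[e]; exists e.
have [a0 ea0] := f_surj (u 0%N).
have [|l hl] := cA (fun n => a0 + \sum_(i < n) e i).
  by move=> n; rewrite big_ord_recr /= opprD addrACA subrr add0r addrAC subrr add0r; case: (he n).
exists (f l) => n; rewrite -img_exp; exists (l - (a0 + \sum_(i < n) e i)); first exact: hl.
rewrite rmorphB rmorphD ea0; congr (_ - _); elim: n => [|n IH]; first by rewrite big_ord0 rmorph0 addr0.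
by rewrite big_ord_recr rmorphD /= addrA IH (he n).2 addrC subrK.
Qed.
Lemma kclosed_img : kclosed m -> kclosed (imgI m).
Proof.
move=> kA g gm sg; have [r hr] := choice f_surj.
pose n := (size g).-1; have sn : size g = n.+1 by rewrite prednK // (ltn_trans _ sg).
(* The top coefficient is set to 1 because an arbitrary lift would not be monic. *)
pose g' := \poly_(i < n.+1) (if i == n then 1 else r g`_i).
have sg' : size g' = n.+1 by rewrite size_poly_eq // eqxx oner_eq0.
have [||a ha] := kA g'.
- by rewrite monicE lead_coefE sg' coef_poly ltnSn /= eqxx.
- by rewrite sg' -sn.
exists (f a); exists g'.[a] => //; rewrite -horner_map /=; congr (_.[_]).
apply/polyP => i; rewrite coef_map coef_poly ltnS.
case: ltngtP => [lt|lt|->] /=; first by rewrite hr.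
  by rewrite rmorph0 nth_default // sn.
by rewrite rmorph1; move/monicP: gm; rewrite lead_coefE.
Qed.
End Transfer.

Section GoodPrime.
Variables (A : comNzRingType) (m : idl A) (p : nat).
Hypotheses (nA : noeth A) (lA : locl m) (cA : cmpl m) (kA : kclosed m) (pp : prime.prime p).

Lemma img_ker (B : comNzRingType) (P : idl A) (f : {rmorphism A -> B}) (f_surj : forall b, exists a, f a = b) :
  (forall a, f a = 0 <-> P a) -> imgI f_surj P = zeroI B.
Proof.
move=> f_ker; apply: idl_eq => b; split=> [[a /f_ker ea <-] //|->].
by exists 0; [apply: idl0|rewrite rmorph0].
Qed.

Lemma good_prime (P : idl A) c d : primeI P -> ~ P c -> coh_ge P d.+2 -> ~ coh_ge P d.+3 ->
  exists Q f t, [/\ primeI Q /\ P <=I Q, Q f /\ ~ P f, ~ Q t /\ ~ Q c, coh_ge Q d.+1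
    & forall b, Q b -> addI P (genI [:: f]) (t * b)].
Proof.
move=> pP nPc cP ncP; have [B [f [f_surj f_ker]]] := quot_domain pP.
have Pm := prime_sub_m lA pP; pose mB := imgI f_surj m.
have PP : P <=I P by [].
have [|||Q [x [t [pQ [Qx x0] [Qt Qc] cQ hQ]]]] := @good_ex B mB (noeth_img f_surj nA)
    (locl_img f_surj f_ker lA Pm) (cmpl_img f_surj f_ker nA lA cA) (kclosed_img f_surj kA) (f c) d.
- by apply/eqP => /f_ker.
- by rewrite -(img_ker f_surj f_ker); apply/(coh_img f_surj f_ker _ PP).
- by rewrite -(img_ker f_surj f_ker) => /(coh_img f_surj f_ker _ PP) /ncP.
have [x' ex] := f_surj x; have [t' et] := f_surj t.
exists (pullI f Q), x', t'; split.
- by split; [apply: prime_pre|apply: (preI_ker f_ker)].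
- by rewrite preE ex; split=> // /f_ker e; case/eqP: x0; rewrite -ex.
- by rewrite preE et.
- by apply/(coh_img f_surj f_ker _ (preI_ker f_ker Q)); rewrite imgK.
move=> b Qb; have [y] := hQ (f b) Qb; have [y' <-] := f_surj y.
rewrite -et -ex -!rmorphM => /(f_eq f_ker) h.
rewrite -[t' * b](subrK (y' * x')); apply: idlD; first exact: sub_addl.
by apply: sub_addr; apply: idlM; apply: mem_gen1.
Qed.

Lemma one_dim (P : idl A) : primeI P -> coh_ge P 1 -> ~ coh_ge P 2 ->
  exists h, ~ P h /\ ~~ (p %| lam (addI P (genI [:: h])))%N.
Proof.
move=> pP cP ncP; have [B [f [f_surj f_ker]]] := quot_domain pP.
have Pm := prime_sub_m lA pP; pose mB := imgI f_surj m.
have PP : P <=I P by [].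
have nB := noeth_img f_surj nA; have lB : locl mB := locl_img f_surj f_ker lA Pm.
have fB (b : B) : b != 0 -> fin (genI [:: b]).
  move=> b0; apply: (fin_dim nB lB _).2; apply: dim_lt_gen1 b0.
  by rewrite -(img_ker f_surj f_ker) => /(coh_img f_surj f_ker _ PP) /ncP.
have [a ma nPa] : exists2 a, m a & ~ P a.
  apply: not_subI => mP; case: cP => Q [pQ PQ nQ _]; apply: nQ.
  apply: idl_anti => // x Qx; apply: mP; exact: (prime_sub_m lA pQ).
have [||b [b0 hb]] := @one_dim_ord B mB (f a) p nB lB (cmpl_img f_surj f_ker nA lA cA) (kclosed_img f_surj kA) fB _ _ pp.
- by apply/eqP => /f_ker.
- by exists a.
have [h eh] := f_surj b; exists h; split; first by move/f_ker; rewrite eh; apply/eqP.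
have e : imgI f_surj (addI P (genI [:: h])) = genI [:: b] by rewrite (img_add f_surj f_ker) img_gen /= eh.
by rewrite -(lam_img f_ker) ?e //; [apply: sub_addl|apply: fB].
Qed.
End GoodPrime.

(** * Ideals as boolean predicates *)

Section Dictionary.
Variable A : comNzRingType.
Implicit Types (J K : idl A) (x y : A).

Section Proper.
Variables (K : idl A) (K1 : ~ K 1).
Definition proper_pred (_ : ~ K 1) : {pred A} := fun a => `[< K a >].
Lemma proper_pred_closed : idealr_closed (proper_pred K1).
Proof.
split; [exact/asboolP/idl0|exact/asboolP/K1|].
move=> a x y /asboolP hx /asboolP hy; apply/asboolP.
by apply: idlD => //; apply: idlM.
Qed.
HB.instance Definition _ := isIdealr.Build A (proper_pred K1) proper_pred_closed.
Definition idealr_of : idealr A := proper_pred K1.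
Lemma idealr_ofE a : (a \in idealr_of) <-> K a.
Proof. by split=> /asboolP. Qed.
End Proper.

Section PrimePred.
Variables (K : idl A) (pK : primeI K).
Lemma dpred_prime : prime_idealr_closed (dpred pK).
Proof. by move=> u v /asboolP/pK.2 h; apply/orP; case: h => h; [left|right]; apply/asboolP. Qed.
HB.instance Definition _ := isPrimeIdealrClosed.Build A (dpred pK) dpred_prime.
Definition prime_of : prime_idealr A := dpred pK.
Lemma prime_ofE a : (a \in prime_of) <-> K a.
Proof. by split=> /asboolP. Qed.
End PrimePred.

Program Definition idl_of (P : idealr A) : idl A := @Idl A (fun x => x \in P) _.
Next Obligation.
split=> [|x y|a x]; [exact: rpred0|exact: rpredD|exact: idealMr].
Qed.
Lemma idl_ofE (P : idealr A) x : idl_of P x = (x \in P). Proof. by []. Qed.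
Lemma prime_idl_of (P : prime_idealr A) : primeI (idl_of P).
Proof.
split; first by rewrite idl_ofE idealr1.
by move=> x y; rewrite idl_ofE prime_idealrM => /orP.
Qed.

Program Definition idl_smod (N : submodClosed A^o) : idl A := @Idl A (fun x => (x : A^o) \in N) _.
Next Obligation.
split=> [|x y|a x]; [exact: rpred0|exact: rpredD|exact: (rpredZ (s := N))].
Qed.

Lemma idl_smodE (N : submodClosed A^o) x : idl_smod N x = ((x : A^o) \in N). Proof. by []. Qed.
Lemma span_idl (X : A -> Prop) : idl_smod (Defs.span (X : A^o -> Prop)) = spanI X.
Proof.
apply: idl_anti; last first.
  apply: spanI_min => x Xx; apply/asboolP; exists [:: (1, x)]; first by move=> c; rewrite inE => /eqP ->.
  by rewrite big_seq1 /= scale1r.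
move=> x /asboolP[s hs ->]; rewrite big_seq; apply: idl_sum => c hc; apply: idlM.
by apply: sub_spanI; apply: hs.
Qed.
Lemma ideal_genE s : idl_smod (ideal_gen s) = genI s.
Proof. exact: span_idl. Qed.

Lemma span_self J : spanI J = J.
Proof. by apply: idl_anti; [apply: spanI_min|apply: sub_spanI]. Qed.

Lemma ideal_expE (a : {pred A}) J n : (forall x, x \in a <-> J x) -> idl_smod (ideal_exp a n) = expI J n.
Proof.
move=> aJ; rewrite span_idl; apply: idl_anti.
  apply: spanI_min => _ [t /allP ht ->].
  have : forall s : seq A, (forall x, x \in s -> x \in a) -> expI J (size s) (\prod_(y <- s) y).
    elim=> [|y s IH] h; rewrite ?big_nil ?big_cons //.
    apply: prodI_mem; first by apply/aJ/h/mem_head.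
    by apply: IH => x hx; apply: h; rewrite inE hx orbT.
  by move=> /(_ t ht); rewrite size_tuple.
elim: n => [|n IH].
  by move=> x _; rewrite -[x]mulr1; apply: idlM; apply: sub_spanI; exists [tuple] => //; rewrite big_nil.
apply: prodI_min => x y Jx /IH hy.
have : spanI (fun x : A => exists2 t : n.-tuple A, all (mem a) t & x = \prod_(y <- t) y)
    <=I colI (spanI (fun x : A => exists2 t : n.+1.-tuple A, all (mem a) t & x = \prod_(y <- t) y)) x.
  apply: spanI_min => _ [t ht ->]; rewrite colP; apply: sub_spanI.
  by exists [tuple of x :: t]; [rewrite /= ht andbT; apply/aJ|rewrite big_cons].
by apply.
Qed.

Lemma noeth_of : noetherian A -> noeth A.
Proof.
move=> nA J; have [s hs] := nA (Defs.span (J : A^o -> Prop)); exists s; rewrite -ideal_genE -[J in LHS]span_self -span_idl.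
by apply: idl_eq => x; rewrite idl_smodE hs.
Qed.

Lemma locl_of (m : idealr A) : noetherian A -> (forall J : idealr A, maximal_ideal J -> J =i m) ->
  locl (idl_of m).
Proof.
move=> nA mmax; split; first by rewrite idl_ofE idealr1.
move=> x nmx; apply: contrapT => nx; pose Phi J := ~ J 1.
have [|K [xK nK Kmax]] := noeth_max (noeth_of nA) (Phi := Phi) (J := genI [:: x]).
  by move=> /genI1P[c e]; apply: nx; exists c; rewrite mulrC.
have maxK : maximal_ideal (idealr_of nK).
  move=> J KJ y; have e : idl_of J = K.
    apply: Kmax; first by move=> z hz; apply/KJ/idealr_ofE.
    by rewrite /Phi idl_ofE idealr1.
  apply/idP/idP => [hy|/idealr_ofE]; last by rewrite -{1}e.
  by apply/idealr_ofE; rewrite -e.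
apply: nmx; rewrite idl_ofE -(mmax _ maxK); apply/idealr_ofE/xK; exact: mem_gen1.
Qed.

Lemma cmpl_of (m : idealr A) : adically_complete m -> cmpl (idl_of m).
Proof.
have eE n x : x \in ideal_exp m n <-> expI (idl_of m) n x.
  by rewrite -(@ideal_expE m (idl_of m)).
move=> [sep lim]; split=> [x h|u hu]; first by apply: sep => n; apply/eE.
have mon k i : expI (idl_of m) k (u (k + i)%N - u k).
  elim: i => [|i IH]; first by rewrite addn0 subrr; apply: idl0.
  rewrite addnS -[u _.+1](subrK (u (k + i)%N)) -addrA; apply: idlD => //.
  exact: (expI_le (leq_addr i k) (hu _)).
have [|l hl] := lim u.
  move=> k; exists k => i j /subnKC <- /subnKC <-; apply/eE.
  have -> : u (k + (i - k))%N - u (k + (j - k))%N = (u (k + (i - k))%N - u k) - (u (k + (j - k))%N - u k) by ring.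
  exact: idlB.
exists l => n; have [N hN] := hl n.
have -> : l - u n = (u (n + N)%N - u n) - (u (n + N)%N - l) by ring.
by apply: idlB => //; apply/eE/hN; apply: leq_addl.
Qed.

Lemma kclosed_of (m : idealr A) : GRing.closed_field_axiom {ideal_quot m} -> kclosed (idl_of m).
Proof.
move=> cl g gm sg; pose f : {rmorphism A -> {ideal_quot m}} := \pi_({ideal_quot m})%qT.
have f_surj b : exists a, f a = b by elim/quotW: b => a; exists a.
have f0 a : f a = 0 -> a \in m.
  move=> h; have := Quotient.idealrBE m a 0; rewrite subr0 => ->; apply/eqP.
  by rewrite -[LHS]/(f a) h -[RHS]/(f 0) rmorph0.
(* The axiom solves x^n = sum of P_i x^i, whence the sign. *)
have [|x hx] := cl (size g).-1 (fun i => - f g`_i); first by rewrite -ltnS prednK // (ltn_trans _ sg).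
have [a ea] := f_surj x; exists a; apply: f0.
have sn : size g = (size g).-1.+1 by rewrite prednK // (ltn_trans _ sg).
rewrite horner_coef sn big_ord_recr /= -lead_coefE (monicP gm) mul1r rmorphD rmorphXn /= ea hx.
rewrite rmorph_sum -big_split big1 // => i _ /=.
by rewrite rmorphM rmorphXn /= ea mulNr subrr.
Qed.

Lemma rch_seq n J : rch n J (topI A) <-> exists K : nat -> idl A,
  (forall i, (i < n)%N -> K i <=I K i.+1 /\ ~ (K i.+1 <=I K i)) /\ J <=I K 0%N.
Proof.
elim: n J => [|n IH] J /=; first by split=> // _; exists (fun=> J).
split=> [[L [JL nL /IH[K [hK LK]]]]|[K [hK JK]]].
  exists (fun i => if i is i'.+1 then K i' else J); split=> // -[|i] lt; last exact: hK.
  split; first exact: subI_trans JL LK.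
  by move=> KJ; apply: nL; apply: idl_anti => //; apply: subI_trans KJ.
exists (K 1%N); have [h1 h2] := hK 0%N isT; split.
- exact: subI_trans h1.
- by move=> e; apply: h2; rewrite e.
- by apply/IH; exists (fun i => K i.+1); split=> // i lt; apply: hK.
Qed.

Lemma coh_seq n : (exists2 P : idl A, primeI P & coh_ge P n) <-> exists K : nat -> idl A,
  (forall i, primeI (K i)) /\ forall i, (i < n)%N -> K i <=I K i.+1 /\ ~ (K i.+1 <=I K i).
Proof.
split=> [[P pP cP]|[K [pK hK]]].
  suff [K [h1 h2 _]] : exists K : nat -> idl A, [/\ forall i, primeI (K i),
     forall i, (i < n)%N -> K i <=I K i.+1 /\ ~ (K i.+1 <=I K i) & K 0%N = P] by exists K.
  elim: n P pP cP => [|n IH] P pP /=; first by exists (fun=> P).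
  move=> [Q [pQ PQ nQ /(IH Q pQ)[K [h1 h2 e]]]]; exists (fun i => if i is i'.+1 then K i' else P).
  split=> // [[|i] //|[|i] lt]; last exact: h2.
  by rewrite e; split=> // QP; apply: nQ; apply: idl_anti.
exists (K 0%N) => //; elim: n K pK hK => // n IH K pK hK.
exists (K 1%N); have [h1 h2] := hK 0%N isT; split=> //; first by move=> e; apply: h2; rewrite e.
by apply: (IH (fun i => K i.+1)) => // i lt; apply: hK.
Qed.

Lemma chain_coh n : prime_chain A n <-> exists2 P : idl A, primeI P & coh_ge P n.
Proof.
rewrite coh_seq; split=> [[P hP]|[K [pK hK]]].
  exists (fun i => idl_of (P i)); split; first by move=> i; apply: prime_idl_of.
  by move=> i /hP[h1 h2].
exists (fun i => prime_of (pK i)) => i /hK[h1 h2]; split; first by move=> x /prime_ofE/h1 h; apply/prime_ofE.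
by move=> h; apply: h2 => x /prime_ofE/h/prime_ofE.
Qed.
End Dictionary.

(** * The multiplicity as a limit *)

Section QuotientLength.
Variable A : comNzRingType.

Lemma quot_coh (P : prime_idealr A) n : prime_chain {ideal_quot P} n <-> coh_ge (idl_of P) n.
Proof.
pose f : {rmorphism A -> {ideal_quot P}} := \pi_({ideal_quot P})%qT.
have f_surj b : exists a, f a = b by elim/quotW: b => a; exists a.
have f_ker a : f a = 0 <-> idl_of P a.
  have e := Quotient.idealrBE P a 0; rewrite subr0 in e; rewrite idl_ofE e.
  by rewrite -(rmorph0 f); split=> [h|/eqP //]; apply/eqP.
have PP : idl_of P <=I idl_of P by [].
rewrite chain_coh -(coh_img f_surj f_ker n PP) (img_ker f_surj f_ker).
split=> [[Q _]|cZ]; first exact: coh_ge_sub (@zero_sub _ Q).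
exists (zeroI _) => //; rewrite -(img_ker f_surj f_ker).
exact: prime_img (prime_idl_of P).
Qed.

Lemma span_closed (V : lmodType A) (X : V -> Prop) v : X 0 -> (forall u w, X u -> X w -> X (u + w)) ->
  (forall a u, X u -> X (a *: u)) -> (v \in Defs.span X) <-> X v.
Proof.
move=> X0 XD XZ; split=> [/asboolP[s hs ->]|Xv].
  by rewrite big_seq; apply: big_ind => // c /hs; apply: XZ.
by apply/asboolP; exists [:: (1, v)]; [move=> c; rewrite inE => /eqP ->|rewrite big_seq1 scale1r].
Qed.

Variable N : submodClosed A^o.
Local Notation M := (quot_mod N).
Definition qpi (a : A) : M := \pi_(M)%qT (a : A^o).

Lemma qpiD a b : qpi (a + b) = qpi a + qpi b. Proof. by rewrite /qpi pi_quot_add. Qed.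
Lemma qpiZ a b : qpi (a * b) = a *: qpi b. Proof. by rewrite /qpi -[RHS]/(quot_scale _ _) pi_quot_scale. Qed.
Lemma qpi_eq a b : qpi a = qpi b <-> idl_smod N (a - b).
Proof.
have e : ((a : A^o) - b \in N) = (qpi a == qpi b) := Quotient.idealrBE (submod_zmod N) _ _.
by rewrite idl_smodE e; split=> /eqP.
Qed.
Lemma qpi0 : qpi 0 = 0.
Proof. by apply: (addrI (qpi 0)); rewrite -qpiD !addr0. Qed.
Lemma qpi_surj v : exists a, qpi a = v.
Proof. by elim/quotW: v => a; exists a. Qed.

Lemma quot_chain n : submod_chain M n <-> rch n (idl_smod N) (topI A).
Proof.
rewrite rch_seq; split=> [[S hS]|[K [hK NK]]].
  have ax i : [/\ qpi 0 \in S i, forall x y, qpi x \in S i -> qpi y \in S i -> qpi (x + y) \in S i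
     & forall a x, qpi x \in S i -> qpi (a * x) \in S i].
    split; first by rewrite qpi0 rpred0.
    - by move=> x y hx hy; rewrite qpiD rpredD.
    - by move=> a x hx; rewrite qpiZ rpredZ.
  exists (fun i => Idl (ax i)); split=> [i /hS[h1 h2]|x Nx]; last first.
    suff -> : idl_set (Idl (ax 0%N)) x = (qpi x \in S 0%N) by rewrite (qpi_eq x 0).2 ?subr0 // qpi0 rpred0.
    by [].
  split=> [x|h]; first exact: h1.
  by apply: h2 => v; have [a <-] := qpi_surj v; apply: h.
pose X i (v : M) := exists2 a, K i a & qpi a = v.
have XE i v : v \in Defs.span (X i) <-> X i v.
  apply: span_closed.
  - by exists 0; [apply: idl0|apply: qpi0].
  - by move=> _ _ [a ha <-] [b hb <-]; exists (a + b); [apply: idlD|rewrite qpiD].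
  - by move=> c _ [b hb <-]; exists (c * b); [apply: idlM|rewrite qpiZ].
have NKi i : (i <= n)%N -> idl_smod N <=I K i.
  elim: i => [_|i IH lt]; first exact: NK.
  by apply: subI_trans (IH (ltnW lt)) _; case: (hK i lt).
exists (fun i => Defs.span (X i) : submodClosed M) => i lt; have [h1 h2] := hK i lt; split=> [v|h].
  by move=> /XE[a ha <-]; apply/XE; exists a => //; apply: h1.
apply: h2 => a ha; have /h/XE[b hb /qpi_eq e] : qpi a \in Defs.span (X i.+1) by apply/XE; exists a.
rewrite -[a](subKr b); apply: idlB => //; exact: (NKi i (ltnW lt)).
Qed.

Lemma quot_length l : module_length M l <-> ilen (idl_smod N) (topI A) l.
Proof.
by split=> -[h1 h2]; split; try exact/quot_chain; move=> n /quot_chain; apply: h2.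
Qed.
End QuotientLength.

Lemma ideal_scaleE (A : comNzRingType) (a : {pred A}) (J : idl A) : (forall x, x \in a <-> J x) ->
  idl_smod (ideal_scale (A := A) a A^o) = J.
Proof.
move=> aJ; rewrite span_idl; apply: idl_anti.
  by apply: spanI_min => _ [c /aJ hc [w ->]]; apply: idlMr.
by move=> x /aJ hx; apply: sub_spanI; exists x => //; exists (1 : A); rewrite -[RHS]/(x * 1) mulr1.
Qed.

(** * Minimal primes in filtrations of a reduced ring *)

Section Reduced.
Variable A : comNzRingType.
Implicit Types (J P : idl A) (l : seq (idl A)).

(** x kills each of the [size l] factors of the filtration. *)
Lemma pfilt_nilp J l x : pfilt J (topI A) l -> (forall Q, In Q l -> Q x) -> J (x ^+ size l).
Proof.
move E : (topI A) => T h; elim: h E => [{}J <- _ //|{}J {}T y {}l _ _ IH e h] /=.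
have [j [_ [Jj /genI1P[c ->] ej]]] : addI J (genI [:: y]) (x ^+ size l).
  by apply: IH => // Q hQ; apply: h; right.
have Jyx : J (y * x) by rewrite -colP; apply: h; left.
rewrite exprS ej mulrDr mulrCA [x * y]mulrC; apply: idlD; exact: idlM.
Qed.

Lemma minimal_below l Q : exists Q0, [/\ Q0 = Q \/ In Q0 l, Q0 <=I Q &
  forall R, In R l -> R <=I Q0 -> R = Q0].
Proof.
elim: l Q => [|R l IH] Q; first by exists Q; split=> //; left.
have [Q0 [h1 h2 h3]] := IH Q; have [RQ|nRQ] := EM (R <=I Q0).
  exists R; split; [by right; left|exact: subI_trans RQ h2|].
  move=> S [<- //|hS] SR; have e := h3 S hS (subI_trans SR RQ); apply: idl_anti => //; by rewrite e.
exists Q0; split=> //; first by case: h1; [left|right; right].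
by move=> S [<- /nRQ //|]; apply: h3.
Qed.

(** If (J : y) = P, later primes contain y. Were P among them, y would lie in P, so cy in J and c in
    P. *)
Lemma cnt_minimal J l P c : pfilt J (topI A) l -> primeI P -> ~ P c ->
  (forall b, P b -> J (c * b)) -> In P l -> cnt P l = 1%N.
Proof.
move E : (topI A) => T h pP nc; elim: h E => // {}J {}T y {}l _ h IH e cP hP.
have eT : addI J (genI [:: y]) y by apply: add_gen1.
have JJ : J <=I addI J (genI [:: y]) by apply: sub_addl.
rewrite /cnt /= -/(cnt P l); have [eP|nP] := pselect (colI J y = P).
  rewrite (asboolT eP) cnt_notin // => hPl.
  have Py : P y by exact: (pfilt_le h hPl eT).
  by apply: nc; rewrite -eP colP mulrC; apply: cP.
rewrite (asboolF nP) add0n; apply: IH => //; first by move=> b /cP/JJ.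
by case: hP.
Qed.
End Reduced.

Lemma expn_ffact d : exists c : nat, forall n, (n.+1 ^ d <= n ^_ d + c * pw d n)%N.
Proof.
elim: d => [|d [c hc]]; first by exists 0%N.
exists (d.+1 + c)%N => n; rewrite ffactnSr expnSr.
have h1 : (n ^_ d * n.+1 <= n ^_ d * (n - d) + d.+1 * n ^_ d)%N.
  rewrite [(d.+1 * _)%N]mulnC -mulnDr leq_mul2l; apply/orP; right; lia.
have h2 : (c * pw d n * n.+1 <= c * n.+1 ^ d)%N.
  by rewrite -mulnA leq_mul2l; apply/orP; right; case: (d) => [|d'] //=; rewrite ?mul0n // expnSr.
have h3 : (n ^_ d <= n.+1 ^ d)%N.
  by elim: (d) => // k IH; rewrite ffactnSr expnSr; apply: leq_mul => //; lia.
have h4 := leq_mul (hc n) (leqnn n.+1); have h5 := leq_mul (leqnn d.+1) h3.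
move: h1 h2 h4 h5; rewrite /= mulnDl [((_ + c) * _)%N]mulnDl.
set x1 := (_ * _)%N; set x2 := (_ * _)%N; set x3 := (_ * _)%N; set x4 := (_ * _)%N; lia.
Qed.

Lemma ffact_expn d n : (n ^_ d <= n.+1 ^ d)%N.
Proof. by elim: d => // k IH; rewrite ffactnSr expnSr; apply: leq_mul => //; lia. Qed.

(** (d+1)! C(n, d+1) is a falling factorial, within O(n^d) of (n+1)^(d+1); N = n + 1 undoes the
    shift in [pfun]. *)
Lemma eqO_bin d e (u : nat -> nat) : eqO d.+1 (fun n => u n.+1) (fun n => e * 'C(n, d.+1))%N ->
  exists D : nat, forall N, (0 < N)%N ->
    (d.+1`! * u N <= e * N ^ d.+1 + D * N ^ d)%N /\ (e * N ^ d.+1 <= d.+1`! * u N + D * N ^ d)%N.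
Proof.
move=> [C hC]; have [c hc] := expn_ffact d.+1.
exists (d.+1`! * C + e * c)%N => -[//|n] _; have [h1 h2] := hC n.
have h3 := hc n; have h4 := ffact_expn d.+1 n.
have eb : (d.+1`! * (e * 'C(n, d.+1)) = e * n ^_ d.+1)%N by rewrite mulnCA [(_`! * _)%N]mulnC bin_ffact.
have := leq_mul (leqnn d.+1`!) h1; have := leq_mul (leqnn d.+1`!) h2.
have := leq_mul (leqnn e) h3; have := leq_mul (leqnn e) h4.
rewrite !mulnDr eb mulnDl /= !mulnA.
set x1 := (e * _)%N; set x2 := (e * _)%N; set x3 := (_ * _ * _)%N; set x4 := (_ * _ * _)%N; set x5 := (_ * u _)%N.
lia.
Qed.

Section Limit.
Import numFieldNormedType.Exports Num.Theory Order.TTheory.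
Local Open Scope classical_set_scope.

Lemma mult_limit (R : realType) d e D (u : nat -> nat) : (forall N, (0 < N)%N ->
    (d.+1`! * u N <= e * N ^ d.+1 + D * N ^ d)%N /\ (e * N ^ d.+1 <= d.+1`! * u N + D * N ^ d)%N) ->
  (fun n => (d.+1`!)%:R / n%:R ^+ d.+1 * (u n)%:R : R) @ \oo --> (e%:R : R).
Proof.
move=> h; apply/cvgrPdist_le => eps eps0; near=> N.
have N0 : (0 < N)%N by near: N; exists 1%N.
have Nr : 0 < N%:R :> R by rewrite ltr0n.
have hN : D%:R / eps <= N%:R by near: N; exact: nbhs_infty_ger.
have -> : e%:R - (d.+1`!)%:R / N%:R ^+ d.+1 * (u N)%:R =
    (e%:R * N%:R ^+ d.+1 - (d.+1`!)%:R * (u N)%:R) / N%:R ^+ d.+1 :> R.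
  by field; rewrite expf_neq0 ?gt_eqF.
rewrite normrM [`|_^-1|]gtr0_norm ?invr_gt0 ?exprn_gt0 // ler_pdivrMr ?exprn_gt0 //.
apply: (@le_trans _ _ (D%:R * N%:R ^+ d)); last first.
  rewrite exprS mulrA; apply: ler_wpM2r; first by rewrite exprn_ge0 // ltW.
  by move: hN; rewrite ler_pdivrMr // mulrC.
have [h1 h2] := h N N0; rewrite -!natrX -!natrM ler_norml; apply/andP; split.
  by rewrite lerBrDl lerBlDr -natrD ler_nat.
by rewrite lerBlDr addrC -natrD ler_nat.
Unshelve. all: by end_near.
Qed.
End Limit.

Section ParamSystems.
Variables (A : comNzRingType) (m : idealr A) (d : nat).
Hypotheses (nA : noeth A) (lA : locl (idl_of m)).
Local Notation Z := (zeroI A).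

Lemma minimal_coh l : equidimensional A d -> pfilt Z (topI A) l ->
  (forall P : idl A, primeI P -> ~ coh_ge P d.+1) /\
  forall P, primeI P -> (forall R, In R l -> R <=I P -> R = P) -> coh_ge P d.
Proof.
move=> eqd hl.
have key (P : idl A) : primeI P -> (forall R, In R l -> R <=I P -> R = P) -> coh_ge P d /\ ~ coh_ge P d.+1.
  move=> pP Pmin; have [|h1 h2] := eqd (prime_of pP).
    move=> Q QP a; have [R hR RQ] := pfilt_min hl (prime_idl_of Q) (@zero_sub _ _).
    have QP' : idl_of Q <=I P by move=> x /QP/prime_ofE.
    have e := Pmin R hR (subI_trans RQ QP').
    apply/idP/idP => [/QP //|/prime_ofE]; rewrite -e; exact: RQ.
  have e : idl_of (prime_of pP) = P by apply: idl_eq => x; apply: prime_ofE.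
  split; first by rewrite -e; apply/quot_coh.
  by rewrite -e => /quot_coh/h2; rewrite ltnn.
split=> [P pP cP|P pP /(key P pP)[]//].
have [P0 hP0 P0P] := pfilt_min hl pP (@zero_sub _ _).
have [Q [hQ QP0 Qmin]] := minimal_below l P0.
have hQl : In Q l by case: hQ => [->|].
have [_] := key Q (pfilt_prime hl hQl) Qmin; apply.
by apply: coh_ge_sub cP; apply: subI_trans P0P.
Qed.

(** With c in all other primes of l, cP lies in every prime of l, so it consists of nilpotents and
    is 0. *)
Lemma minimal_once l P : reduced A -> pfilt Z (topI A) l -> In P l ->
  (forall R, In R l -> R <=I P -> R = P) -> cnt P l = 1%N.
Proof.
move=> red hl hP Pmin; have pP := pfilt_prime hl hP.
have [|c [nc hc]] := @separate _ P l pP.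
  by move=> R hR nR /(Pmin R hR).
apply: (cnt_minimal hl pP nc) => // b Pb.
apply: (red _ (size l)); apply: (pfilt_nilp hl) => Q hQ.
have [->|nQ] := pselect (Q = P); first exact: idlM.
by apply: idlMr; apply: hc.
Qed.

Lemma parameter_ideal_of (f : d.-tuple A) : krull_dim A d -> (forall x, x \in f -> x \in m) ->
  fin (genI f) -> parameter_ideal m (ideal_gen f).
Proof.
move=> kd mf ff; split; last by exists d => //; exists f.
have fE x : x \in ideal_gen f <-> genI f x by rewrite -ideal_genE.
have fm : genI f <=I idl_of m by apply: genI_min => x /mf.
have [n hn] := fin_pow_ex nA lA ff.
have mX x : x \in m -> genI f (x ^+ n) by move=> mx; apply: hn; apply: expI_mem.
split; last first.
  move=> x; split=> [/mX h|[k /fE/fm h]]; first by exists n; apply/fE.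
  exact: (primeX (m_prime lA) h).
split; first by apply/negP => /fE/fm; apply: lA.1.
move=> x y /fE xy; have [my|nmy] := EM (idl_of m y); first by right; exists n; apply/fE/mX.
have [z yz] := lA.2 y nmy; left; apply/fE.
by rewrite -[x]mulr1 -yz mulrA; apply: idlMr.
Qed.
End ParamSystems.

Lemma regular_dim (A : comNzRingType) d : krull_dim A d -> module_dim A^o d.
Proof.
have e n : supp_chain A^o n <-> prime_chain A n.
  split=> [[P [_ h]]|[P h]]; exists P => //; split=> // i a h0.
  have -> : a = 0 by rewrite -[a]mulr1; apply: h0.
  by rewrite rpred0.
by move=> [/e h1 h2]; split=> // n /e; apply: h2.
Qed.

Theorem theorem2p6 (R : realType) (A : comNzRingType) (m : idealr A) (d : nat)
  (A_local : local_ring m)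
  (A_complete : adically_complete m)
  (A_reduced : reduced A)
  (A_equidim : equidimensional A d)
  (d_gt0 : (0 < d)%N)
  (k_closed : GRing.closed_field_axiom {ideal_quot m})
  (same_char : forall P Q : prime_idealr A,
     minimal_prime P -> minimal_prime Q ->
     [pchar residue_field P] =i [pchar residue_field Q])
  (p : nat) (p_prime : prime p) :
  exists f : d.-tuple A,
    parameter_ideal m (ideal_gen f) /\
    exists e : nat,
      multiplicity (A := A) (ideal_gen f) A^o (e%:R : R) /\ coprime e p.
Proof.
have [noeA _ mmax] := A_local.
have nA := noeth_of noeA; have lA := locl_of noeA mmax.
have cA := cmpl_of A_complete; have kA := kclosed_of k_closed.
have ZE (J : idl A) : addI (zeroI A) J = J by rewrite addIC addI_idr //; apply: zero_sub.
have [l hl] := pfilt_ex nA (@zero_sub _ (topI A)).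
have [dimA cohA] := minimal_coh A_equidim hl.
have [P0 hP0 _] := pfilt_min hl (m_prime lA) (@zero_sub _ _).
have [P [hP _ Pmin]] := minimal_below l P0.
have hPl : In P l by case: hP => [->|].
have pP := pfilt_prime hl hPl.
have kd : krull_dim A d.
  split; first by apply/chain_coh; exists P => //; apply: cohA.
  move=> k /chain_coh[Q pQ cQ]; rewrite leqNgt; apply/negP => lt; apply: (dimA Q pQ).
  exact: coh_ge_le cQ.
have [||||fs [sz mfs ffs [e [pe he]]]] := @params_ind A (idl_of m) nA lA p p_prime
    (@good_prime A (idl_of m) nA lA cA kA) (fun P => @one_dim A (idl_of m) p nA lA cA kA p_prime P) d (zeroI A) l P.
- by move=> Q hQ; split; [exact: pfilt_prime hl hQ|exact: zero_sub].
- by move=> Q pQ _; apply: dimA.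
- exact: cohA.
- by rewrite (minimal_once A_reduced hl) // dvdn1 neq_ltn prime_gt1 ?orbT.
have fP : size fs == d by apply/eqP.
pose f := Tuple fP; exists f; rewrite ZE in ffs.
split; first exact: parameter_ideal_of.
exists e; split; last by rewrite coprime_sym prime_coprime.
exists d, (fun n => lam (expI (genI fs) n)); split; first exact: regular_dim.
  move=> n; apply/quot_length.
  rewrite (@ideal_scaleE A _ (expI (genI fs) n)); last first.
    by move=> x; rewrite -(@ideal_expE A (ideal_gen f) (genI fs)) // => y; rewrite -ideal_genE.
  by apply: lamP; rewrite -(ZE (expI _ _)); apply: fin_expI; rewrite ZE.
have hO : eqO d (pfun (zeroI A) fs) (fun n => e * 'C(n, d))%N.
  by apply: eqO_trans he; rewrite -sz; apply: pfun_pfilt => //; rewrite ZE.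
case: d d_gt0 hO {A_equidim dimA cohA kd sz he fP f} => // d _ hO.
have [|D hD] := @eqO_bin d e (fun n => lam (expI (genI fs) n)); last exact: mult_limit hD.
by apply: eqO_ext hO => // n; rewrite /pfun ZE.
Qed.
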